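(* Let $(M,g)$ be a closed Riemannian manifold, let $\mu=\nu(g)$ be its Riemannian volume measure, let $k\ge 1$ be an integer, and let $W^{k,1}(M)$ be the Sobolev space of (equivalence classes of) real-valued functions, equipped with the norm \[ \varphi(u):=\Vert u\Vert_{W^{k,1}(M)}=\sum_{|\alpha|\le k}\int_M |D^{\alpha}u|\,d\mu , \] where the operators $D^{\alpha}$ are the compositions of smooth vector fields described in the context. Let $B\subset W^{k,1}(M)$ be the set of all equivalence classes $\tilde f\in W^{k,1}(M)$ such that for some (equivalently, any) representative $f$ of $\tilde f$ one has, for every $|\alpha|\le k$, $D^{\alpha}f(x)\neq 0$ for $\mu$-a.e. $x\in M$. Then the set of points of $W^{k,1}(M)$ at which $\varphi$ is G\^ateaux differentiable is exactly $B$. Moreover, for every $\tilde f\in B$ and every direction $h\in W^{k,1}(M)$, the G\^ateaux derivative of $\varphi$ at $\tilde f$ is given by \[ \partial_G\varphi(\tilde f)(h)=\sum_{|\alpha|\le k}\int_M \operatorname{sign}(D^{\alpha}f(x))\,D^{\alpha}h(x)\,d\mu(x), \] where $f$ is any representative of the class $\tilde f$.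
   Context: A closed Riemannian manifold is a compact smooth Riemannian manifold without boundary. The measure $\mu=\nu(g)$ is given in local coordinates by $d\nu(g)=\sqrt{\det(g_{ij})}\,dx$, where $dx$ is Lebesgue measure on $\mathbb{R}^n$, $n=\dim M$. Sobolev space: $W^{k,1}(M)$ is the completion of $C^\infty(M)$ with respect to the norm $\sum_{j=0}^k\int_M|\nabla^j u|\,d\nu(g)$, where $\nabla^j u$ is the $j$-th covariant derivative of $u$ ($\nabla^0u=u$) and $|\nabla^j u|$ is its pointwise norm with respect to $g$. Elements are equivalence classes, with $f\sim h$ iff $\|f-h\|_{W^{k,1}(M)}=0$. Equivalent norm through vector fields: fix a finite family $X_1,\dots,X_\ell$ of smooth vector fields on $M$; for a multi-index $\alpha=(\alpha_1,\dots,\alpha_\ell)\in\mathbb{N}_0^\ell$ put $D^\alpha:=X_1^{\alpha_1}\cdots X_\ell^{\alpha_\ell}$ and $|\alpha|=\alpha_1+\cdots+\alpha_\ell$ (so $D^0u=u$), acting on $W^{k,1}(M)$ in the weak sense, $D^\alpha u\in L^1(M)$ for $|\alpha|\le k$. The family is such that $\Vert u\Vert_{W^{k,1}(M)}=\sum_{|\alpha|\le k}\int_M|D^\alpha u|\,d\nu(g)$ is a norm on $W^{k,1}(M)$ equivalent to the one above; $W^{k,1}(M)$ is considered with this norm. Sign: $\operatorname{sign}(x)=x/|x|$ for real $x\ne0$, and $\operatorname{sign}(0)=0$. G\^ateaux differentiability: for Banach spaces $X,Y$ and an open set $\Omega\subseteq X$, a function $F:\Omega\to Y$ is G\^ateaux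 differentiable at $a\in\Omega$ if the limit $\lim_{t\to0}\frac{F(a+th)-F(a)}{t}=u(h)$ exists for all $h\in X$ and $u$ is a bounded linear operator from $X$ to $Y$; then $\partial_GF(a):=u$.
   Formalization: Added hypothesis: each vector field X_i is nonzero μ-a.e. Without it the claim fails: if some X_i vanishes on a set of positive measure (e.g. X_2=0 on the circle), B is empty, while φ still has points of Gâteaux differentiability. *)

(* Defs.v *)
From HB Require Import structures.
From mathcomp Require Import all_boot all_order all_algebra.
From mathcomp Require Import all_classical all_reals all_analysis.

Set Implicit Arguments.
Unset Strict Implicit.
Unset Printing Implicit Defensive.

Import Order.TTheory GRing.Theory Num.Theory.
Import numFieldNormedType.Exports.

Local Open Scope classical_set_scope.
Local Open Scope ring_scope.

Notation borel T := (g_sigma_algebraType (@open T)).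

Section Euclidean.
Context (R : realType) (n : nat).

Definition basis_vec (a : 'I_n) : 'rV[R]_n := delta_mx 0 a.

(* All iterated partial derivatives exist and are Frechet differentiable at
   every point of the (open) set U; this is C^oo on U.  Values of f outside U
   are irrelevant. *)
Definition smooth_on (U : set 'rV[R]_n) (f : 'rV[R]_n -> R) :=
  forall (s : seq 'I_n) y, U y ->
    differentiable (foldr (fun a h => 'D_(basis_vec a) h) f s) y.

(* This characterizes Lebesgue measure on the Borel sets of R^n. *)
Definition is_lebesgue (lam : {measure set (borel 'rV[R]_n) -> \bar R}) :=
  forall a b : 'rV[R]_n, (forall i, a 0 i <= b 0 i) ->
    lam [set x : 'rV[R]_n | forall i, a 0 i < x 0 i <= b 0 i] =
    (\prod_i (b 0 i - a 0 i))%:E.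

Section Covariant.
Variable G : 'rV[R]_n -> 'M[R]_n.

Definition christoffel (m a b : 'I_n) (y : 'rV[R]_n) : R :=
  2^-1 * \sum_c invmx (G y) m c *
    ('D_(basis_vec a) (fun z => G z b c) y
     + 'D_(basis_vec b) (fun z => G z a c) y
     - 'D_(basis_vec c) (fun z => G z a b) y).

(* Components of the j-th covariant derivative of u in the coordinate frame;
   the first index is the direction of the last differentiation. *)
Fixpoint covariant_deriv (j : nat) (u : 'rV[R]_n -> R) :
    ('I_j -> 'I_n) -> 'rV[R]_n -> R :=
  match j return ('I_j -> 'I_n) -> 'rV[R]_n -> R with
  | 0 => fun _ => u
  | j'.+1 => fun s y =>
      let r := fun p : 'I_j' => s (lift ord0 p) in
      'D_(basis_vec (s ord0)) (@covariant_deriv j' u r) y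
      - \sum_(p < j') \sum_(m < n)
          christoffel m (s ord0) (r p) y
          * @covariant_deriv j' u (fun q => if q == p then m else r q) y
  end.

Definition covariant_norm (j : nat) (u : 'rV[R]_n -> R) (y : 'rV[R]_n) : R :=
  Num.sqrt (\sum_(s : {ffun 'I_j -> 'I_n}) \sum_(t : {ffun 'I_j -> 'I_n})
    (\prod_(p < j) invmx (G y) (s p) (t p))
    * @covariant_deriv j u s y * @covariant_deriv j u t y).

End Covariant.
End Euclidean.

(* chart_map and chart_inv are total functions, meaningful only on chart_dom
   and chart_cod respectively. *)
Record chart (R : realType) (n : nat) (T : ptopologicalType) := Chart {
  chart_dom : set T;
  chart_cod : set 'rV[R]_n;
  chart_map : T -> 'rV[R]_n;
  chart_inv : 'rV[R]_n -> T;
  chart_dom_open : open chart_dom;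
  chart_cod_open : open chart_cod;
  chart_map_sub : forall x, chart_dom x -> chart_cod (chart_map x);
  chart_inv_sub : forall y, chart_cod y -> chart_dom (chart_inv y);
  chart_mapK : forall x, chart_dom x -> chart_inv (chart_map x) = x;
  chart_invK : forall y, chart_cod y -> chart_map (chart_inv y) = y;
  chart_map_cont : forall x, chart_dom x -> {for x, continuous chart_map};
  chart_inv_cont : forall y, chart_cod y -> {for y, continuous chart_inv}
}.

Section Overlap.
Context (R : realType) (n : nat) (T : ptopologicalType).

(* Points of the codomain of c1 whose preimage lies in the domain of c2. *)
Definition overlap (c1 c2 : chart R n T) : set 'rV[R]_n :=
  chart_cod c1 `&` chart_inv c1 @^-1` chart_dom c2.

Definition transition (c1 c2 : chart R n T) : 'rV[R]_n -> 'rV[R]_n :=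
  chart_map c2 \o chart_inv c1.

End Overlap.

Record smooth_manifold (R : realType) (n : nat) (T : ptopologicalType) :=
  SmoothManifold {
    atlas_idx : Type;
    atlas :> atlas_idx -> chart R n T;
    atlas_cover : forall x, exists i, chart_dom (atlas i) x;
    atlas_smooth : forall i j (b : 'I_n),
      smooth_on (overlap (atlas i) (atlas j))
        (fun y => transition (atlas i) (atlas j) y 0 b);
    manifold_hausdorff : hausdorff_space T;
    manifold_second_countable : @second_countable T
  }.

Section Manifold.
Context (R : realType) (n : nat) (T : ptopologicalType).
Variable M : smooth_manifold R n T.

Definition chart_at (x : T) : atlas_idx M := projT1 (cid (atlas_cover M x)).

Definition coord_at (x : T) : 'rV[R]_n := chart_map (M (chart_at x)) x.

Definition smooth_fun (u : T -> R) :=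
  forall i, smooth_on (chart_cod (M i)) (u \o chart_inv (M i)).

(* The components of the metric, as functions of the coordinates of each chart.
   Vectors are rows, so 'J has (a, b) entry d y^b / d x^a. *)
Record riemannian_metric := RiemannianMetric {
  metric_mx : atlas_idx M -> 'rV[R]_n -> 'M[R]_n;
  metric_smooth : forall i a b,
    smooth_on (chart_cod (M i)) (fun y => metric_mx i y a b);
  metric_sym : forall i y, chart_cod (M i) y ->
    (metric_mx i y)^T = metric_mx i y;
  metric_posdef : forall i y (v : 'rV[R]_n), chart_cod (M i) y -> v != 0 ->
    0 < (v *m metric_mx i y *m v^T) 0 0;
  metric_change : forall i j y, overlap (M i) (M j) y ->
    let J := 'J (transition (M i) (M j)) y in
    metric_mx i y = J *m metric_mx j (transition (M i) (M j) y) *m J^T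
}.

Record vector_field := VectorField {
  vf_comp : atlas_idx M -> 'rV[R]_n -> 'rV[R]_n;
  vf_smooth : forall i a,
    smooth_on (chart_cod (M i)) (fun y => vf_comp i y 0 a);
  vf_change : forall i j y, overlap (M i) (M j) y ->
    vf_comp j (transition (M i) (M j) y) =
    vf_comp i y *m 'J (transition (M i) (M j)) y
}.

Definition vf_at (X : vector_field) (x : T) : 'rV[R]_n :=
  vf_comp X (chart_at x) (coord_at x).

Definition vf_apply (X : vector_field) (u : T -> R) (x : T) : R :=
  'D_(vf_at X x) (u \o chart_inv (M (chart_at x))) (coord_at x).

Definition is_riemannian_volume (g : riemannian_metric)
    (mu : {measure set (borel T) -> \bar R}) :=
  exists2 lam : {measure set (borel 'rV[R]_n) -> \bar R}, is_lebesgue lam &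
    forall i (A : set (borel T)), measurable A -> A `<=` chart_dom (M i) ->
      mu A = (\int[lam]_(y in chart_map (M i) @` A)
                (Num.sqrt (\det (metric_mx g i y)))%:E)%E.

Section Sobolev.
Variables (g : riemannian_metric) (mu : {measure set (borel T) -> \bar R}).

Definition nabla_norm (j : nat) (u : T -> R) (x : T) : R :=
  covariant_norm (metric_mx g (chart_at x)) j
    (u \o chart_inv (M (chart_at x))) (coord_at x).

Definition nabla_sobolev_norm (k : nat) (u : T -> R) : R :=
  \sum_(j < k.+1) \int[mu]_x nabla_norm j u x.

(* (W, iota) is a completion of the space of smooth functions for
   nabla_sobolev_norm; it is unique up to a unique isometric isomorphism.
   Values of iota at non-smooth functions are irrelevant. *)
Definition is_sobolev_space (k : nat) (W : completeNormedModType R)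
    (iota : (T -> R) -> W) :=
  [/\ forall (a : R) (u v : T -> R), smooth_fun u -> smooth_fun v ->
        iota (fun x => a * u x + v x) = a *: iota u + iota v,
      forall u, smooth_fun u -> `|iota u| = nabla_sobolev_norm k u &
      dense (iota @` smooth_fun)].

(* f is a representative of w, i.e. the limit in L^1 of the smooth functions
   that tend to w. *)
Definition represents (W : completeNormedModType R) (iota : (T -> R) -> W)
    (w : W) (f : T -> R) :=
  mu.-integrable setT (EFin \o f) /\
  forall u_ : nat -> T -> R, (forall m, smooth_fun (u_ m)) ->
    iota (u_ m) @[m --> \oo] --> w ->
    (\int[mu]_x `|u_ m x - f x|) @[m --> \oo] --> 0.

(* Multi-indices alpha in N^l with |alpha| <= k have entries at most k. *)
Definition mindex (k l : nat) := {ffun 'I_l -> 'I_k.+1}.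

Definition mdegree (k l : nat) (al : mindex k l) : nat := (\sum_i al i)%N.

Section Derivatives.
Context (k l : nat).
Variable X : 'I_l -> vector_field.

(* X_0^(al 0) (X_1^(al 1) (... u)), for smooth u. *)
Definition classical_D (al : mindex k l) (u : T -> R) : T -> R :=
  foldr (fun i v => iter (al i) (vf_apply (X i)) v) u (enum 'I_l).

(* psi' is the image of psi under the formal transpose of D^al with respect to
   mu.  By the divergence theorem every smooth psi has exactly one smooth such
   psi'. *)
Definition transpose_D (al : mindex k l) (psi psi' : T -> R) :=
  forall u, smooth_fun u ->
    \int[mu]_x (classical_D al u x * psi x) = \int[mu]_x (u x * psi' x).

Definition weak_D (al : mindex k l) (f v : T -> R) :=
  mu.-integrable setT (EFin \o v) /\
  forall psi psi', smooth_fun psi -> smooth_fun psi' ->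
    transpose_D al psi psi' ->
    \int[mu]_x (v x * psi x) = \int[mu]_x (f x * psi' x).

(* A choice of D^al f; any two weak derivatives are equal mu-a.e. *)
Definition Dw (al : mindex k l) (f : T -> R) : T -> R :=
  xget (fun=> 0) [set v | weak_D al f v].

Variables (W : completeNormedModType R) (iota : (T -> R) -> W).

Definition representative (w : W) : T -> R :=
  xget (fun=> 0) [set f | represents iota w f].

Definition phi (w : W) : R :=
  \sum_(al : mindex k l | (mdegree al <= k)%N)
    \int[mu]_x `|Dw al (representative w) x|.

Definition phi_equivalent_norm :=
  exists c C : R, [/\ 0 < c, 0 < C &
    forall w : W, c * `|w| <= phi w <= C * `|w|].

Definition nowhere_vanishing_D (f : T -> R) :=
  forall al : mindex k l, (mdegree al <= k)%N ->
    \forall x \ae mu, Dw al f x != 0.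

Definition B_some : set W :=
  [set w | exists2 f, represents iota w f & nowhere_vanishing_D f].

Definition B_any : set W :=
  [set w | forall f, represents iota w f -> nowhere_vanishing_D f].

(* If some X_i vanishes on a set of positive measure, then B is empty (take
   D^al = X_i), whereas phi, being a continuous convex function on a separable
   Banach space, has points of Gateaux differentiability. *)
Definition nondegenerate_family :=
  forall i, \forall x \ae mu, vf_at (X i) x != 0.

End Derivatives.
End Sobolev.
End Manifold.

Section Gateaux.
Context (R : realType) (V Y : normedModType R).

Definition gateaux_deriv (F : V -> Y) (a : V) : V -> Y := fun h => 'D_h F a.

Definition gateaux_differentiable (F : V -> Y) (a : V) :=
  [/\ forall h, derivable F a h,
      linear (gateaux_deriv F a) &
      exists C : R, forall h, `|gateaux_deriv F a h| <= C * `|h|].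

End Gateaux.

(* Main.v *)
Require Import Defs.
From HB Require Import structures.
From mathcomp Require Import all_boot all_order all_algebra.
From mathcomp Require Import all_classical all_reals all_analysis.
From mathcomp Require Import perm measurable_realfun ring lra.

Import Order.TTheory GRing.Theory Num.Theory.
Import numFieldNormedType.Exports.

Local Open Scope classical_set_scope.
Local Open Scope ring_scope.

Set Implicit Arguments.
Unset Strict Implicit.
Unset Printing Implicit Defensive.

(** Along a line t |-> w + t v the function phi is a finite sum of functions t
    |-> int |a + t b|, where a and b are the weak derivatives D^al of
    representatives of w and of v ([phi_line]). At a point, the difference
    quotient of t |-> |a + t b| at 0 is bounded by |b|; it tends to sign(a) b
    + 1_{a = 0} |b| as t decreases to 0 and to sign(a) b - 1_{a = 0} |b| as t
    increases to 0. By dominated convergence phi has at w, in the direction v,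
    the one-sided derivatives P + Z and P - Z, where P is the sum of the
    integrals of sign(a) b and Z the sum of the integrals of |b| over {a = 0}
    ([phi_right_derivative], [phi_left_derivative]).

    If no D^al f vanishes on a set of positive measure, then Z = 0 for every
    v, so that phi is differentiable in every direction with derivative P; P
    is linear in v and |P| <= phi v <= C |v| ([gateaux_phi]). Conversely, if
    phi is differentiable at w in the direction of every smooth u, then Z = 0
    for all these u: almost everywhere on {D^al f = 0} each smooth u has D^al
    u = 0. This forces {D^al f = 0} to be negligible, because countably many
    smooth functions u suffice for one of the D^al u to be nonzero at almost
    every point ([nonvanishing_ae]). Indeed, let x be a point where no X_j
    vanishes. Some linear form is nonzero on all the X_j(x), hence some smooth
    u with u(x) = 0 has X_j u(x) != 0 for all j; then D^al (u^m), m = |al|, is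
    at x a nonzero multiple of a product of the numbers X_j u(x). It does not
    vanish near x, and the topology has a countable base.

    What remains is to see that weak derivatives of elements of W exist, are
    unique almost everywhere and depend linearly on the element. For the
    uniqueness, each smooth function has a smooth image under the formal
    transpose of D^al: by a partition of unity and integration by parts in a
    chart this reduces to the fact that a partial derivative of a compactly
    supported C^1 function on R^n has integral zero, a consequence of the
    translation invariance of Lebesgue measure ([integral_partial_eq0],
    [vf_transpose]). Moreover an integrable function orthogonal to all smooth
    functions vanishes almost everywhere, because the indicators of open sets
    are bounded limits of smooth functions ([fundamental_lemma]). For the
    existence, w is the limit of smooth functions u_m, whose derivatives D^al
    u_m form a Cauchy sequence in L^1 since phi is dominated by the norm of W;
    L^1 is complete, and weak derivatives are closed under limits in L^1
    ([Dw_represents]). *)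

(** * Functions of class C^m on open sets of R^n *)

Section NearDifferentiable.
Context (R : realType) (V W : normedModType R).

(** The differential at x depends only on the germ at x; for the derivative in
    a single direction this is [near_eq_derive]. *)
Lemma near_eq_differentiable (f g : V -> W) (x : V) :
  (\near x, f x = g x) -> differentiable f x -> differentiable g x.
Proof.
move=> fg df.
have gE : g \o shift x = cst (g x) + 'd f x +o_ 0 id.
  apply/eqaddoP => e e0.
  have [_ /eqaddoP/(_ _ e0) fE] := (diff_locallyP _ _).1 df.
  have fg0 : \forall h \near (0 : V), f (h + x) = g (h + x).
    by move: fg; rewrite (near_shift 0 x); apply: filterS => h; rewrite /= subr0.
  near=> h.
  have -> : ((g \o shift x) - (cst (g x) + 'd f x)) h =
      ((f \o shift x) - (cst (f x) + 'd f x)) h.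
    rewrite !fctE /=.
    by rewrite -(nbhs_singleton fg) -(near fg0 h).
  by near: h.
have dfg := diff_unique (diff_continuous df) gE.
apply/diff_locallyP; rewrite dfg; split => //.
exact: diff_continuous.
Unshelve. all: by end_near. Qed.

End NearDifferentiable.

Section Ck.
Context (R : realType) (n : nat).

(** Every partial derivative of order at most m is Frechet differentiable on
    U. This is slightly stronger than C^m, but only the conjunction over all m
    is of interest ([smooth_onP]), and the induction on m gives the closure
    properties directly. *)
Fixpoint Ck (m : nat) (U : set 'rV[R]_n) (f : 'rV[R]_n -> R) : Prop :=
  (forall y, U y -> differentiable f y) /\
  match m with
  | 0 => True
  | m'.+1 => forall a : 'I_n, Ck m' U ('D_(basis_vec R a) f)
  end.

Implicit Types (U : set 'rV[R]_n) (f g : 'rV[R]_n -> R).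

Lemma Ck_diff m U f y : Ck m U f -> U y -> differentiable f y.
Proof. by case: m => [|m] [df _] /df. Qed.

Lemma CkSE m U f : Ck m.+1 U f <->
  (forall y, U y -> differentiable f y) /\
  forall a, Ck m U ('D_(basis_vec R a) f).
Proof. by []. Qed.

Lemma CkS m U f : Ck m.+1 U f -> Ck m U f.
Proof.
elim: m f => [|m ih] f [df dDf]; split => // a.
exact/ih/dDf.
Qed.

Lemma smooth_onP U f : smooth_on U f <-> forall m, Ck m U f.
Proof.
split => [sf m|Cf s y Uy].
  elim: m f sf => [|m ih] f sf; (split; first by move=> y /(sf [::])) => //.
  by move=> a; apply: ih => s y Uy; have := sf (rcons s a) y Uy; rewrite foldr_rcons.
have : Ck (size s) U f by [].
elim/last_ind: s f {Cf} => [|s a ih] f; first by move=> Cf; exact: (Ck_diff Cf).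
by rewrite size_rcons foldr_rcons => -[_ /(_ a)]; exact: ih.
Qed.

Lemma Ck_ext m U f g : open U -> {in U, f =1 g} -> Ck m U f -> Ck m U g.
Proof.
move=> oU; elim: m f g => [|m ih] f g fg [df dDf].
  split => // y Uy; apply: near_eq_differentiable (df _ Uy).
  have := open_nbhs_nbhs (conj oU Uy).
  by apply: filterS => z /mem_set; exact: fg.
split.
  move=> y Uy; apply: near_eq_differentiable (df _ Uy).
  have := open_nbhs_nbhs (conj oU Uy).
  by apply: filterS => z /mem_set; exact: fg.
move=> a; apply: ih (dDf a) => y /set_mem Uy.
apply: near_eq_derive.
have := open_nbhs_nbhs (conj oU Uy).
by apply: filterS => z /mem_set; exact: fg.
Qed.

Lemma Ck_sub m U U' f : U `<=` U' -> Ck m U' f -> Ck m U f.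
Proof.
move=> UU'; elim: m f => [|m ih] f [df dDf]; split => //.
- by move=> y /UU'; exact: df.
- by move=> y /UU'; exact: df.
- by move=> a; exact/ih/dDf.
Qed.

Lemma Ck_local m U f :
  (forall y, U y -> exists2 U', U' y & Ck m U' f) -> Ck m U f.
Proof.
elim: m f => [|m ih] f loc.
  by split => // y /loc[U' U'y [df _]]; exact: df.
split=> [y /loc[U' U'y [df _]]|a]; first exact: df.
by apply: ih => y /loc[U' U'y /CkSE[_ Df]]; exists U'.
Qed.

Lemma Ck_cst m U c : Ck m U (cst c).
Proof.
elim: m c => [|m ih] c; split => // a.
have -> : 'D_(basis_vec R a) (cst c) = cst 0 :> ('rV[R]_n -> R).
  by apply/funext => y; rewrite derive_cst.
exact: ih.
Qed.

Lemma derive_coord (v y : 'rV[R]_n) (b : 'I_n) :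
  'D_v (fun z : 'rV[R]_n => z 0 b) y = v 0 b.
Proof.
have := @derive_mx R _ 1 n id y v (@derivable_id _ _ _ _).
by rewrite derive_id => /rowP /(_ b); rewrite mxE => ->.
Qed.

Lemma Ck_coord m U b : Ck m U (fun z : 'rV[R]_n => z 0 b).
Proof.
have dc y : differentiable (fun z : 'rV[R]_n => z 0 b) y.
  exact: differentiable_coord.
case: m => [|m]; split => // a.
have -> : 'D_(basis_vec R a) (fun z : 'rV[R]_n => z 0 b) =
    cst ((basis_vec R a) 0 b).
  by apply/funext => y; rewrite derive_coord.
exact: Ck_cst.
Qed.

Lemma CkD m U f g : open U -> Ck m U f -> Ck m U g -> Ck m U (f + g).
Proof.
move=> oU; elim: m f g => [|m ih] f g Cf Cg.
  by have [df _] := Cf; have [dg _] := Cg; split => // y Uy; apply: differentiableD; [exact: df|exact: dg].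
move: Cf Cg => /CkSE[df Df] /CkSE[dg Dg].
split=> [y Uy|a]; first by apply: differentiableD; [exact: df|exact: dg].
apply: (@Ck_ext _ _ ('D_(basis_vec R a) f + 'D_(basis_vec R a) g)) => //.
  move=> y /set_mem Uy; rewrite deriveD//; apply: diff_derivable.
    exact: df.
  exact: dg.
by apply: ih; [exact: Df|exact: Dg].
Qed.

Lemma CkM m U f g : open U -> Ck m U f -> Ck m U g -> Ck m U (f * g).
Proof.
move=> oU; elim: m f g => [|m ih] f g Cf Cg.
  by split => // y Uy; apply: differentiableM; apply: Ck_diff Uy; eassumption.
split=> [y Uy|a].
  by apply: differentiableM; apply: Ck_diff Uy; eassumption.
apply: (@Ck_ext _ _ (f * 'D_(basis_vec R a) g + g * 'D_(basis_vec R a) f)) => //.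
  move=> y /set_mem Uy; rewrite deriveM//; apply: diff_derivable.
    exact: (Ck_diff Cf).
  exact: (Ck_diff Cg).
have /CkSE[_ Df] := Cf; have /CkSE[_ Dg] := Cg.
by apply: CkD => //; apply: ih; by [exact: CkS|exact: Df|exact: Dg].
Qed.

Lemma CkV m U f : open U -> (forall y, U y -> f y != 0) -> Ck m U f ->
  Ck m U (fun y => (f y)^-1).
Proof.
move=> oU f0; elim: m => [|m ih] Cf.
  split => // y Uy; apply: differentiableV; last exact: f0.
  exact: Ck_diff Cf Uy.
split=> [y Uy|a].
  by apply: differentiableV; [exact: Ck_diff Cf Uy|exact: f0].
have CV : Ck m U (fun y => (f y)^-1) by apply: ih; exact: CkS.
apply: (@Ck_ext _ _ (cst (-1) * ((fun y => (f y)^-1) *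
   ((fun y => (f y)^-1) * 'D_(basis_vec R a) f)))) => //.
  move=> y /set_mem Uy; rewrite deriveV//; last 2 first.
  - exact: f0.
  - apply: diff_derivable; exact: Ck_diff Cf Uy.
  by rewrite !fctE mulN1r scaleNr /GRing.scale /= -exprVn expr2 mulrA.
have /CkSE[_ Df] := Cf.
apply: CkM => //; first exact: Ck_cst.
by apply: CkM => //; apply: CkM => //; exact: Df.
Qed.

End Ck.

Section Ck_chain.
Context (R : realType) (n : nat).
Implicit Types (U : set 'rV[R]_n) (f : 'rV[R]_n -> R).

Lemma comp1_differentiable (g : R -> R) f (y : 'rV[R]_n) :
  differentiable f y -> derivable g (f y) 1 -> differentiable (g \o f) y.
Proof.
by move=> df /derivable1_diffP dg; exact: differentiable_comp.
Qed.

Lemma derive_comp1 (g : R -> R) f (v y : 'rV[R]_n) :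
  differentiable f y -> derivable g (f y) 1 ->
  'D_v (g \o f) y = derive1 g (f y) * 'D_v f y.
Proof.
move=> df dg; have dg' := (derivable1_diffP _ _).1 dg.
rewrite deriveE; last exact: differentiable_comp.
rewrite diff_comp//= deriv1E// deriveE//.
by rewrite mulrC.
Qed.

(** If the derivative of each member of G is again in G, every member is
    infinitely differentiable; quantifying over such a family replaces a
    formula for the iterated derivatives. *)
Lemma Ck_comp1 (G : set (R -> R)) (V : set R) :
  (forall g, G g -> (forall x, V x -> derivable g x 1) /\
     exists2 g', G g' & forall x, V x -> derive1 g x = g' x) ->
  forall m U f g, open U -> (forall y, U y -> V (f y)) -> G g -> Ck m U f ->
  Ck m U (g \o f).
Proof.
move=> GP m U f g oU UV; elim: m g => [|m ih] g Gg Cf.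
  split => // y Uy; apply: comp1_differentiable; first exact: Ck_diff Cf Uy.
  by apply: (GP _ Gg).1; exact: UV.
have [dg [g' Gg' gg']] := GP _ Gg.
apply/CkSE; split=> [y Uy|a].
  by apply: comp1_differentiable; [exact: Ck_diff Cf Uy|apply: dg; exact: UV].
apply: (@Ck_ext _ _ _ _ ((g' \o f) * 'D_(basis_vec R a) f)) => //.
  move=> y /set_mem Uy; rewrite derive_comp1.
  - by rewrite gg'//; exact: UV.
  - exact: Ck_diff Cf Uy.
  - by apply: dg; exact: UV.
have /CkSE[_ Df] := Cf.
by apply: CkM => //; apply: ih => //; exact: CkS.
Qed.

Lemma Ck_sqrt m U f : open U -> (forall y, U y -> 0 < f y) ->
  Ck m U f -> Ck m U (fun y => Num.sqrt (f y)).
Proof.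
move=> oU f0; elim: m => [|m ih] Cf.
  split => // y Uy; apply: (@comp1_differentiable Num.sqrt).
    exact: Ck_diff Cf Uy.
  by have [] := is_derive1_sqrt (f0 _ Uy).
apply/CkSE; split=> [y Uy|a].
  apply: (@comp1_differentiable Num.sqrt); first exact: Ck_diff Cf Uy.
  by have [] := is_derive1_sqrt (f0 _ Uy).
have Cs : Ck m U (fun y => Num.sqrt (f y)) by apply: ih; exact: CkS.
apply: (@Ck_ext _ _ _ _ ((fun y => ((cst 2 * (fun y => Num.sqrt (f y))) y)^-1) *
   'D_(basis_vec R a) f)) => //.
  move=> y /set_mem Uy; rewrite (@derive_comp1 Num.sqrt).
  - by rewrite derive1E derive_sqrt ?f0.
  - exact: Ck_diff Cf Uy.
  - by have [] := is_derive1_sqrt (f0 _ Uy).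
have /CkSE[_ Df] := Cf.
apply: CkM => //; apply: CkV => //; last by apply: CkM => //; exact: Ck_cst.
by move=> y Uy; rewrite mulf_neq0// gt_eqF// sqrtr_gt0 f0.
Qed.

Lemma Ck_sum m U I (r : seq I) (F : I -> 'rV[R]_n -> R) : open U ->
  (forall i, Ck m U (F i)) -> Ck m U (\sum_(i <- r) F i).
Proof.
move=> oU CF; elim: r => [|i r ih]; first by rewrite big_nil; exact: Ck_cst.
by rewrite big_cons; exact: CkD.
Qed.

Lemma Ck_prod m U I (r : seq I) (F : I -> 'rV[R]_n -> R) : open U ->
  (forall i, Ck m U (F i)) -> Ck m U (\prod_(i <- r) F i).
Proof.
move=> oU CF; elim: r => [|i r ih]; first by rewrite big_nil; exact: Ck_cst.
by rewrite big_cons; exact: CkM.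
Qed.

(** A map is the sum of its coordinates times the basis vectors. *)
Lemma differentiable_rV p (F : 'rV[R]_n -> 'rV[R]_p) (y : 'rV[R]_n) :
  (forall b, differentiable (fun z => F z 0 b) y) -> differentiable F y.
Proof.
move=> dF.
have -> : F = \sum_(b < p) (fun z => F z 0 b *: basis_vec R b).
  apply/funext => z; rewrite fct_sumE [LHS]row_sum_delta.
  by apply: eq_bigr.
by apply: differentiable_sum => b; exact: differentiableZl.
Qed.

Lemma derive_rV p (F : 'rV[R]_n -> 'rV[R]_p) (v y : 'rV[R]_n) b :
  differentiable F y -> ('D_v F y) 0 b = 'D_v (fun z => F z 0 b) y.
Proof.
move=> dF; rewrite derive_mx ?mxE//; exact: diff_derivable.
Qed.

Lemma derive_dir f (v y : 'rV[R]_n) : differentiable f y ->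
  'D_v f y = \sum_a v 0 a * 'D_(basis_vec R a) f y.
Proof.
move=> df; rewrite deriveE// {1}[v]row_sum_delta linear_sum.
by apply: eq_bigr => a _; rewrite linearZ deriveE.
Qed.

End Ck_chain.

Section Ck_comp.
Context (R : realType) (n p : nat).

Lemma derive_comp_rV (F : 'rV[R]_n -> 'rV[R]_p) (f : 'rV[R]_p -> R) v y :
  differentiable F y -> differentiable f (F y) ->
  'D_v (f \o F) y = 'D_('D_v F y) f (F y).
Proof.
move=> dF df; rewrite deriveE; last exact: differentiable_comp.
by rewrite diff_comp// !deriveE.
Qed.

Lemma Ck_comp m (U : set 'rV[R]_n) (V : set 'rV[R]_p)
    (F : 'rV[R]_n -> 'rV[R]_p) (f : 'rV[R]_p -> R) :
  open U -> (forall y, U y -> V (F y)) ->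
  (forall b, Ck m U (fun z => F z 0 b)) -> Ck m V f -> Ck m U (f \o F).
Proof.
move=> oU UV; elim: m f => [|m ih] f CF Cf.
  split => // y Uy; apply: differentiable_comp.
    by apply: differentiable_rV => b; exact: Ck_diff (CF b) Uy.
  by apply: Ck_diff Cf _; exact: UV.
have dF y : U y -> differentiable F y.
  by move=> Uy; apply: differentiable_rV => b; exact: Ck_diff (CF b) Uy.
apply/CkSE; split=> [y Uy|a].
  apply: differentiable_comp; first exact: dF.
  by apply: Ck_diff Cf _; exact: UV.
apply: (@Ck_ext _ _ _ _ (\sum_(b < p) (('D_(basis_vec R b) f \o F) *
   'D_(basis_vec R a) (fun z => F z 0 b)))) => //.
  move=> y /set_mem Uy; rewrite derive_comp_rV//; last 2 first.
  - exact: dF.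
  - by apply: Ck_diff Cf _; exact: UV.
  rewrite derive_dir; last by apply: Ck_diff Cf _; exact: UV.
  rewrite fct_sumE; apply: eq_bigr => b _.
  have DF : ('D_(basis_vec R a) F y) 0 b = 'D_(basis_vec R a) (fun z => F z 0 b) y.
    by apply: derive_rV; exact: dF.
  by rewrite DF [LHS]mulrC.
have /CkSE[_ Df] := Cf.
apply: Ck_sum => // b; apply: CkM => //.
  by apply: ih => [c|]; [exact/CkS/CF|exact: Df].
by have /CkSE[_] := CF b; exact.
Qed.

End Ck_comp.

(** * A smooth ramp *)

Section Flat.
Context (R : realType).
Implicit Types (p : {poly R}) (x : R).

(** The function p(1/x) exp(-1/x) extended by zero to x <= 0. These functions,
    p ranging over all polynomials, form a family closed under
    differentiation, which is what makes exp(-1/x) smooth at 0. *)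
Definition flat p x : R := if 0 < x then p.[x^-1] * expR (- x^-1) else 0.

(** For x > 0 the series of exp gives exp(1/x) >= x^-(i+1) / (i+1)!, hence
    x^-i exp(-1/x) <= (i+1)! x. *)
Lemma flat_bound p : exists C : R, forall x, `|flat p x| <= C * `|x|.
Proof.
exists (\sum_(i < size p) `|p`_i| * (i.+1)`!%:R) => x.
rewrite /flat; case: ifPn => [x0|_]; last first.
  by rewrite normr0 mulr_ge0// sumr_ge0// => i _; rewrite mulr_ge0.
rewrite horner_coef normrM mulr_suml (gtr0_norm x0).
rewrite (ger0_norm (expR_ge0 _)).
apply: (le_trans (ler_wpM2r (expR_ge0 _) (ler_norm_sum _ _ _))).
rewrite mulr_suml; apply: ler_sum => i _.
rewrite normrM -!mulrA ler_wpM2l//.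
rewrite (@ger0_norm _ (_ ^+ _)); last by rewrite exprn_ge0// invr_ge0 ltW.
rewrite expRN ler_pdivrMr ?expR_gt0//.
have := @expR_ge1Dxn R x^-1 i; rewrite invr_ge0 (ltW x0) => /(_ isT) h.
have {}h : x^-1 ^+ i.+1 / (i.+1)`!%:R <= expR x^-1.
  by apply: le_trans h; rewrite lerDr.
rewrite ler_pdivrMr ?ltr0n ?fact_gt0// in h.
rewrite exprSr ler_pdivrMr// in h.
by rewrite mulrAC [_ * expR _]mulrC.
Qed.

(** Away from 0 this is a computation. At 0 the difference quotient of flat p
    is flat (p X), which tends to 0 by [flat_bound]. *)
Lemma is_derive_flat p x : is_derive x 1 (flat p) (flat ('X^2 * (p - p^`())) x).
Proof.
have [x0|x0|->] := ltgtP x 0; last first.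
- rewrite [X in is_derive _ _ _ X]/flat ltxx.
  have [C hC] := flat_bound (p * 'X).
  have key : (fun h : R => h^-1 *: (flat p (h *: 1 + 0) - flat p 0)) @ 0^' --> (0 : R).
    apply/cvgr0Pnorm_le => e e0; near=> h.
    have -> : h^-1 *: (flat p (h *: 1 + 0) - flat p 0) = flat (p * 'X) h.
      rewrite addr0 /flat ltxx subr0 /GRing.scale /= mulr1.
      case: ifPn => h0; last by rewrite mulr0.
      by rewrite hornerM hornerX; ring.
    apply: (le_trans (hC h)).
    (* the + 1 covers the case C = 0 *)
    have h1 : `|h| <= e / (`|C| + 1).
      near: h; apply: dnbhs0_le; rewrite divr_gt0// ltr_wpDl//.
    apply: (@le_trans _ _ ((`|C| + 1) * `|h|)).
      by rewrite ler_wpM2r// (le_trans (ler_norm _))// lerDl.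
    by rewrite mulrC -ler_pdivlMr// ltr_wpDl.
  apply: DeriveDef; first by apply/cvg_ex; exists 0.
  exact/cvg_lim.
- rewrite [X in is_derive _ _ _ X]/flat x0.
  pose G t := p.[t] * expR (- t).
  apply: (@near_eq_is_derive _ _ _ (G \o (fun z => z^-1))).
    near=> z; rewrite /flat ifT//.
    by near: z; exact: lt_nbhsr.
  have dG (t : R) : is_derive t (1 : R) G ((p^`() - p).[t] * expR (- t)).
    have dE : is_derive t (1 : R) (expR \o -%R) (expR (- t) * -1).
      exact: is_derive1_comp.
    have := is_deriveM (is_derive_poly p t) dE.
    rewrite (_ : _ * _ = G)//; move=> dG; apply: is_derive_eq.
    by rewrite !hornerE /= /GRing.scale /=; ring.
  have dV : is_derive x 1 (fun z : R => z^-1) (- x ^- 2 *: 1).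
    by apply: (@is_deriveV R id x 1 1); rewrite gt_eqF.
  have dGV := is_derive1_comp (dG _) dV.
  apply: is_derive_eq.
  rewrite !hornerE /= /GRing.scale /= exprVn; ring.
- rewrite [flat _ x]/flat ltNge (ltW x0)/=.
  have d0 : is_derive x (1 : R) (cst (0 : R)) 0 by exact: is_derive_cst.
  apply: near_eq_is_derive d0; near=> z.
  rewrite /flat ifF//; apply/negbTE; rewrite -leNgt ltW//.
  by near: z; exact: lt_nbhsl.
Unshelve. all: by end_near. Qed.

Lemma Ck_flat n m (U : set 'rV[R]_n) p (f : 'rV[R]_n -> R) : open U ->
  Ck m U f -> Ck m U (fun y => flat p (f y)).
Proof.
move=> oU Cf.
apply: (@Ck_comp1 R n (range flat) setT _ m U f (flat p)) => //.
move=> _ [q _ <-]; split => [x _|].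
  by have [] := is_derive_flat q x.
exists (flat ('X^2 * (q - q^`()))) => // x _.
by rewrite derive1E; have [_ ->] := is_derive_flat q x.
Qed.

Definition ramp (x : R) := flat 1 x.

Lemma ramp_ge0 x : 0 <= ramp x.
Proof. by rewrite /ramp /flat; case: ifP => // _; rewrite hornerC mul1r expR_ge0. Qed.

Lemma ramp_le1 x : ramp x <= 1.
Proof.
rewrite /ramp /flat; case: ifP => // x0; rewrite hornerC mul1r.
by rewrite -expR0 ler_expR oppr_le0 invr_ge0 ltW.
Qed.

Lemma ramp_gt0 x : (0 < ramp x) = (0 < x).
Proof.
rewrite /ramp /flat; case: ifP => [x0|]; last by rewrite ltxx.
by rewrite hornerC mul1r expR_gt0.
Qed.

(** Applied to larger and larger multiples of a function, the ramp produces
    the indicator of the set where that function is positive. *)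
Lemma cvg_ramp x :
  (fun m : nat => ramp (m.+1%:R * x)) @ \oo --> ((0 < x)%R%:R : R).
Proof.
have [x0|x0] := ltP 0 x; last first.
  rewrite (_ : (fun _ => _) = cst 0); first exact: cvg_cst.
  apply/funext => m; rewrite /ramp /flat ifF//.
  by apply/negbTE; rewrite -leNgt mulr_ge0_le0.
rewrite (_ : (fun _ => _) = (fun m : nat => expR (- (harmonic m * x^-1)))).
  have c0 : (fun m : nat => - (harmonic m * x^-1)) @ \oo --> (0 : R).
    rewrite -oppr0; apply: cvgN; rewrite -(mul0r x^-1).
    by apply: cvgMl; exact: cvg_harmonic.
  have := @continuous_cvg _ _ _ \oo _ _ _ _ (@continuous_expR R 0) c0.
  by rewrite expR0; apply.
apply/funext => m.
by rewrite /ramp /flat ifT ?mulr_gt0// hornerC mul1r invfM.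
Qed.

End Flat.

(** * Borel sets, and translation invariance of Lebesgue measure *)

Section Borel.
Context (R : realType) (T : ptopologicalType).

Lemma open_borel (A : set T) : open A -> measurable (A : set (borel T)).
Proof. by move=> oA; exact: sub_sigma_algebra. Qed.

Lemma open_fun_borel (D : set T) (f : T -> R) : open D ->
  (forall x, D x -> {for x, continuous f}) ->
  measurable_fun (D : set (borel T)) (f : borel T -> R).
Proof.
move=> oD cf; apply: (measurability _ (RGenOInfty.measurableE R)).
move=> /= _ [_ [a ->]] <-; apply: open_borel.
rewrite openE => x [Dx /= fx]; apply: filterI.
  by apply: open_nbhs_nbhs.
by apply: (cf _ Dx); apply: open_nbhs_nbhs; split => //; exact: interval_open.
Qed.

Lemma continuous_borel (f : T -> R) : continuous f ->
  measurable_fun [set: borel T] (f : borel T -> R).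
Proof. by move=> cf; exact: (open_fun_borel (@openT T) (fun x _ => cf x)). Qed.

End Borel.

Section BorelMap.
Context (T1 T2 : ptopologicalType).

Lemma open_map_borel (D : set T1) (f : T1 -> T2) : open D ->
  (forall x, D x -> {for x, continuous f}) ->
  measurable_fun (D : set (borel T1)) (f : borel T1 -> borel T2).
Proof.
move=> oD cf; apply: (measurability (@open T2 : set (set (borel T2)))) => //.
move=> /= _ [A oA <-]; apply: open_borel.
rewrite openE => x [Dx /= fx]; apply: filterI.
  by apply: open_nbhs_nbhs.
by apply: (cf _ Dx); apply: open_nbhs_nbhs.
Qed.

Lemma closed_borel (A : set T1) : closed A -> measurable (A : set (borel T1)).
Proof.
move=> cA; rewrite -(setCK A); apply: measurableC.
by apply: open_borel; exact: closed_openC.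
Qed.

End BorelMap.

Section BoundedSupport.
Context d (T : measurableType d) (R : realType) (mu : {measure set T -> \bar R}).

Lemma integrable_bounded_support (A : set T) (f : T -> R) (C : R) :
  measurable A -> (mu A < +oo)%E -> measurable_fun setT f ->
  (forall x, `|f x| <= C * \1_A x) -> mu.-integrable setT (EFin \o f).
Proof.
move=> mA muA mf fC.
apply: (@le_integrable _ _ _ _ _ _ _ (fun x => (C%:E * (\1_A x)%:E)%E)) => //.
- exact/measurable_EFinP.
- move=> x _ /=; rewrite lee_fin (le_trans (fC x))//; exact: ler_norm.
- apply: integrableZl => //; apply/integrableP; split.
    by apply/measurable_EFinP; exact: measurable_indic.
  under eq_integral do rewrite gee0_abs ?lee_fin//.
  by rewrite integral_indic// setIT.
Qed.

End BoundedSupport.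

Section ImageMeasure.
Context d d' (T1 : measurableType d) (T2 : measurableType d') (R : realType).

(** The pushforward as a bundled measure, so that it can be compared with
    another measure by [measure_unique]. *)
Definition image_measure (m : {measure set T1 -> \bar R}) (f : T1 -> T2)
    (mf : measurable_fun setT f) : {measure set T2 -> \bar R} :=
  measure_function_pushforward__canonical__measure_function_Measure m mf.

Lemma image_measureE m (f : T1 -> T2) (mf : measurable_fun setT f) A :
  image_measure m mf A = m (f @^-1` A).
Proof. by []. Qed.

End ImageMeasure.

Section Lebesgue.
Context (R : realType) (n : nat).
Local Notation V := 'rV[R]_n.
Implicit Types a b c x y : V.

Definition box a b : set V := [set x | forall i, a 0 i < x 0 i <= b 0 i].

Lemma nbhs_rV x (A : set V) : nbhs x A ->
  exists2 e : R, 0 < e & forall y, (forall i, `|x 0 i - y 0 i| < e) -> A y.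
Proof.
move=> /nbhs_ballP[e /= e0 eA]; exists e => // y xy; apply: eA.
by split => // i j; rewrite (ord1 i); exact: xy.
Qed.

Lemma box_borel a b : measurable (box a b : set (borel V)).
Proof.
have -> : box a b = ~` \bigcup_(i : 'I_n)
   ~` ((fun x : V => x 0 i) @^-1` `]a 0 i, b 0 i]%classic).
  rewrite setC_bigcup; apply/seteqP; split => x.
    by move=> abx i _; rewrite setCK/= in_itv/=; exact: abx.
  by move=> + i => /(_ i I); rewrite setCK/= in_itv.
apply: measurableC; apply: countable_bigcupT_measurable; first exact: countableP.
move=> i; apply: measurableC.
have mc : measurable_fun [set: borel V] ((fun x : V => x 0 i) : borel V -> R).
  by apply: continuous_borel => x; exact: coord_continuous.
by rewrite -[X in measurable X]setTI; exact: mc.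
Qed.

(** An open set is the union of the countably many boxes with rational corners
    that it contains. *)
Lemma borel_box : @measurable _ (borel V) = <<s [set A | exists a b, A = box a b] >>.
Proof.
apply/seteqP; split; last first.
  apply: smallest_sub; first exact: sigma_algebra_measurable.
  by move=> _ [a [b ->]]; exact: box_borel.
apply: smallest_sub; first exact: smallest_sigma_algebra.
move=> O oO.
pose q2 (q : 'rV[rat]_n) : V := map_mx ratr q.
pose P := [set q : 'rV[rat]_n * 'rV[rat]_n | box (q2 q.1) (q2 q.2) `<=` O].
have -> : O = \bigcup_(q in P) box (q2 q.1) (q2 q.2).
  apply/seteqP; split; last by move=> x [q Pq]; exact: Pq.
  move=> x Ox; have [e e0 eO] := nbhs_rV (open_nbhs_nbhs (conj oO Ox)).
  have /choice[l lP] i : exists r : rat, ratr r \in `]x 0 i - e, x 0 i[.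
    by apply: rat_in_itvoo; rewrite ltrBlDr ltrDl.
  have /choice[u uP] i : exists r : rat, ratr r \in `]x 0 i, x 0 i + e[.
    by apply: rat_in_itvoo; rewrite ltrDl.
  exists (\row_i l i, \row_i u i) => /=.
    move=> y /= lyu; apply: eO => i; have := lyu i.
    rewrite !mxE; move: (lP i) (uP i); rewrite !in_itv/= => /andP[l1 l2] /andP[u1 u2] /andP[y1 y2].
    by rewrite ltr_norml; apply/andP; split; lra.
  move=> i; rewrite !mxE; move: (lP i) (uP i); rewrite !in_itv/=.
  by move=> /andP[l1 l2] /andP[u1 u2]; rewrite l2 ltW.
rewrite bigcup_mkcond.
pose G := [set A | exists a b, A = box a b].
apply: (@countable_bigcupT_measurable _ (g_sigma_algebraType G)).
  exact: countableP.
move=> q; case: ifPn => _; last exact: measurable0.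
by apply: sub_sigma_algebra; exists (q2 q.1), (q2 q.2).
Qed.

Variable lam : {measure set (borel V) -> \bar R}.
Hypothesis lamP : is_lebesgue lam.

Lemma lebesgue_box_shift a b c :
  lam ((fun x => x + c) @^-1` box a b) = lam (box a b).
Proof.
have -> : (fun x => x + c) @^-1` box a b = box (a - c) (b - c).
  apply/seteqP; split => x /= h i; move: (h i); rewrite !mxE.
    by rewrite ltrBlDr lerBrDr.
  by rewrite ltrBlDr lerBrDr.
have [ab|/existsNP[i /negP]] := pselect (forall i, a 0 i <= b 0 i).
  rewrite !lamP//; first by congr (_%:E); apply: eq_bigr => i _; rewrite !mxE; ring.
  by move=> i; rewrite !mxE lerD2r.
rewrite -ltNge => ba.
have -> : box a b = set0.
  apply/seteqP; split => // x /(_ i) /andP[h1 h2].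
  by have := lt_le_trans h1 h2; rewrite ltNge ltW.
have -> : box (a - c) (b - c) = set0; last by [].
apply/seteqP; split => // x /(_ i); rewrite !mxE => /andP[h1 h2].
by have := lt_le_trans h1 h2; rewrite ltrD2r ltNge ltW.
Qed.

Lemma lebesgue_box_lty a b : (lam (box a b) < +oo)%E.
Proof.
have [ab|/existsNP[i /negP]] := pselect (forall i, a 0 i <= b 0 i).
  by rewrite lamP// ltry.
rewrite -ltNge => ba.
have -> : box a b = set0; last by rewrite measure0.
apply/seteqP; split => // x /(_ i) /andP[h1 h2].
by have := lt_le_trans h1 h2; rewrite ltNge ltW.
Qed.

Lemma continuous_shift c : continuous (fun x : V => x + c).
Proof. by move=> x; apply: (@cvgD _ V _ (nbhs x) _ id (cst c)); [exact: cvg_id|exact: cvg_cst]. Qed.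

Lemma shift_borel c : measurable_fun [set: borel V] ((fun x => x + c) : borel V -> borel V).
Proof. by apply: open_map_borel; [exact: openT|move=> x _; exact: continuous_shift]. Qed.

(** Both sides are measures in A that agree on the boxes, and the boxes are
    stable under intersection and generate the Borel sets. *)
Lemma lebesgue_shift c A : measurable (A : set (borel V)) ->
  lam ((fun x => x + c) @^-1` A) = lam A.
Proof.
move=> mA.
pose f : borel V -> borel V := fun x => x + c.
have mf : measurable_fun setT f := shift_borel c.
pose m1 : {measure set (borel V) -> \bar R} := image_measure lam mf.
rewrite [LHS](_ : _ = m1 A)//.
refine (@measure_unique _ R (borel V) [set A | exists a b, A = box a b]
  (fun k => box (const_mx (- k%:R)) (const_mx k%:R)) borel_box _ _ _ m1 lam _ _ A mA).
- move=> _ _ [a1 [b1 ->]] [a2 [b2 ->]].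
  exists (\row_i Num.max (a1 0 i) (a2 0 i)), (\row_i Num.min (b1 0 i) (b2 0 i)).
  apply/seteqP; split => x.
    move=> [h1 h2] i; have := h1 i; have := h2 i; rewrite !mxE.
    by rewrite gt_max le_min => /andP[-> ->] /andP[-> ->].
  move=> h; split => i; have := h i; rewrite !mxE;
    by rewrite gt_max le_min => /andP[/andP[? ?] /andP[? ?]]; apply/andP.
- by move=> k; eexists; eexists.
- apply/seteqP; split => // x _.
  exists (Num.bound `|x|).+1 => // i; rewrite !mxE.
  have xi : `|x 0 i| <= `|x|.
    rewrite [leRHS]/Num.Def.normr/= mx_normrE.
    exact: (le_bigmax _ (fun ij => `|x ij.1 ij.2|) (0, i)).
  have xk : `|x 0 i| < (Num.bound `|x|).+1%:R.
    apply: (le_lt_trans xi); apply: (lt_trans (archi_boundP _)) => //.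
    by rewrite ltr_nat.
  by move: xk; rewrite ltr_norml => /andP[-> /ltW ->].
- by move=> _ [a [b ->]]; exact: lebesgue_box_shift.
- move=> k; rewrite /m1 image_measureE lebesgue_box_shift; exact: lebesgue_box_lty.
Qed.

Lemma integral_shift c (f : V -> R) : measurable_fun setT (f : borel V -> R) ->
  lam.-integrable setT (EFin \o f) ->
  \int[lam]_x f (x + c) = \int[lam]_x f x.
Proof.
move=> mf intf; rewrite /Rintegral; congr fine.
pose s : borel V -> borel V := fun x => x + c.
have ms : measurable_fun setT s := shift_borel c.
pose m1 : {measure set (borel V) -> \bar R} := image_measure lam ms.
have m1E A : measurable (A : set (borel V)) -> A `<=` setT -> m1 A = lam A.
  by move=> mA _; exact: lebesgue_shift.
transitivity (\int[m1]_x (f x)%:E)%E; last exact: eq_measure_integral.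
have mfs : measurable_fun setT (f \o s) by exact: measurableT_comp.
symmetry; apply: (integral_pushforward ms (mu := lam) (D := setT)) => //.
  exact/measurable_EFinP.
apply/integrableP; split; first exact/measurable_EFinP.
have := ge0_integral_pushforward ms lam (f := fun x => `|(f x)%:E|%E) measurableT.
move=> <-//.
- rewrite [ltLHS](_ : _ = \int[m1]_x `|(f x)%:E|)%E//.
  rewrite (eq_measure_integral lam)//.
  by have /integrableP[] := intf.
- by apply/measurable_EFinP; exact: measurableT_comp.
Qed.

Lemma lebesgue_ball_lty (N : R) :
  (lam [set x : V | (`|x| <= N)%R] < +oo)%E.
Proof.
apply: (le_lt_trans _ (lebesgue_box_lty (const_mx (- (N + 1))) (const_mx N))).
apply: le_measure; rewrite ?inE.
- apply: closed_borel; apply: (@preimage_closed V R (fun x => `|x|) [set r | r <= N]).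
    by move=> x _; exact: norm_continuous.
  exact: closed_le.
- exact: box_borel.
- move=> x /= xN i; rewrite !mxE.
  have xi : `|x 0 i| <= `|x|.
    rewrite [leRHS]/Num.Def.normr/= mx_normrE.
    exact: (le_bigmax _ (fun ij => `|x ij.1 ij.2|) (0, i)).
  have := le_trans xi xN; rewrite ler_norml => /andP[h1 ->]; rewrite andbT.
  by apply: lt_le_trans h1; rewrite ltrN2 ltrDl.
Qed.

End Lebesgue.

(** * Integrable real functions and dominated convergence *)

Section RealIntegrable.
Context d (T : measurableType d) (R : realType) (mu : {measure set T -> \bar R}).
Implicit Types f g : T -> R.
Local Notation integrableR f := (mu.-integrable setT (EFin \o f)).

Lemma integrableRD f g : integrableR f -> integrableR g ->
  integrableR (fun x => f x + g x).
Proof. by move=> intf intg; exact: (integrableD measurableT intf intg). Qed.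

Lemma integrableRB f g : integrableR f -> integrableR g ->
  integrableR (fun x => f x - g x).
Proof. by move=> intf intg; exact: (integrableB measurableT intf intg). Qed.

Lemma integrableRZ (c : R) f : integrableR f -> integrableR (fun x => c * f x).
Proof. by move=> intf; exact: (integrableZl measurableT c intf). Qed.

Lemma integrableR_norm f : integrableR f -> integrableR (fun x => `|f x|).
Proof. by move=> intf; exact: (integrable_norm intf). Qed.

Lemma integrableR_measurable f : integrableR f -> measurable_fun setT f.
Proof. by move=> intf; apply/measurable_EFinP; exact: measurable_int intf. Qed.

Lemma integrableR_le f g : measurable_fun setT f -> integrableR g ->
  (forall x, `|f x| <= g x) -> integrableR f.
Proof.
move=> mf intg fg; apply: (@le_integrable _ _ _ _ _ _ _ (EFin \o g)) => //.
  exact/measurable_EFinP.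
by move=> x _; rewrite /= lee_fin (le_trans (fg x))// ler_norm.
Qed.

Lemma integrableRM f g (C : R) : measurable_fun setT f -> integrableR g ->
  (forall x, `|f x| <= C) -> integrableR (fun x => f x * g x).
Proof.
move=> mf intg fC.
apply: (@integrableR_le _ (fun x => C * `|g x|)).
- by apply: measurable_funM => //; exact: integrableR_measurable.
- exact/integrableRZ/integrableR_norm.
- by move=> x; rewrite normrM ler_wpM2r.
Qed.

End RealIntegrable.

Section RealDominatedConvergence.
Context d (T : measurableType d) (R : realType) (mu : {measure set T -> \bar R}).

Lemma Rintegral_dominated (f_ : nat -> T -> R) (f g : T -> R) :
  (forall m, measurable_fun setT (f_ m)) -> measurable_fun setT f ->
  {ae mu, forall x, (fun m => f_ m x) @ \oo --> f x} ->
  mu.-integrable setT (EFin \o g) ->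
  {ae mu, forall x, forall m, `|f_ m x| <= g x} ->
  [/\ mu.-integrable setT (EFin \o f),
      (fun m => \int[mu]_x `|f_ m x - f x|) @ \oo --> (0 : R) &
      (fun m => \int[mu]_x f_ m x) @ \oo --> \int[mu]_x f x].
Proof.
move=> mf_ mf f_f ig f_g.
have [] := @dominated_convergence _ _ _ mu _ measurableT
  (fun m => EFin \o f_ m) (EFin \o f) (EFin \o g).
- by move=> m; exact/measurable_EFinP.
- exact/measurable_EFinP.
- by apply: filterS f_f => x f_fx _; apply: cvg_EFin => //; exact: nearW.
- exact: ig.
- by apply: filterS f_g => x f_gx m _; rewrite /= lee_fin.
move=> intf c1 c2; split => //.
  exact: (fine_cvg c1).
have c2' : [sequence (\int[mu]_x (EFin \o f_ n) x)%E]_n @ \oo -->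
    (\int[mu]_x f x)%:E.
  by rewrite /Rintegral fineK//; exact: integrable_fin_num.
exact: (fine_cvg c2').
Qed.

Lemma integrable_cvg (f_ : nat -> T -> R) (f : T -> R) :
  (forall m, mu.-integrable setT (EFin \o f_ m)) ->
  mu.-integrable setT (EFin \o f) ->
  (fun m => \int[mu]_x `|f_ m x - f x|) @ \oo --> (0 : R) ->
  (fun m => \int[mu]_x f_ m x) @ \oo --> \int[mu]_x f x.
Proof.
move=> if_ if0 h; apply/cvgrPdist_le => e e0.
move/cvgr0Pnorm_le : h => /(_ _ e0); apply: filterS => m; apply: le_trans.
rewrite distrC -RintegralB//.
rewrite [leRHS]ger0_norm; last by apply: Rintegral_ge0.
have iB : mu.-integrable setT (EFin \o (fun x => f_ m x - f x)).
  exact: integrableRB.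
exact: (le_trans (le_normr_Rintegral _ iB)).
Qed.

End RealDominatedConvergence.

(** * The integral of a partial derivative *)

Section DivergenceRn.
Context (R : realType) (n : nat).
Local Notation V := 'rV[R]_n.
Variable lam : {measure set (borel V) -> \bar R}.
Hypothesis lamP : is_lebesgue lam.

Lemma ball_compact (N : R) : compact [set x : V | (`|x| <= N)%R].
Proof.
apply: bounded_closed_compact.
  exists N; split; first exact: num_real.
  by move=> M NM x /= xN; rewrite (le_trans xN)// ltW.
apply: (@preimage_closed V R (fun x => `|x|) [set r | r <= N]).
  by move=> x _; exact: norm_continuous.
exact: closed_le.
Qed.

Lemma bounded_compact_support (f : V -> R) N : continuous f ->
  (forall y, N < `|y| -> f y = 0) -> exists C, forall y, `|f y| <= C.
Proof.
move=> cf f0.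
have [[z zK]|K0] := pselect ([set x : V | (`|x| <= N)%R] !=set0); last first.
  exists 0 => y; rewrite f0 ?normr0// ltNge; apply/negP => yN.
  by apply: K0; exists y.
have cnf : continuous (fun x => `|f x|).
  by move=> x; apply: continuous_comp; [exact: cf|exact: norm_continuous].
have [|c cK cmax] := @compact_EVT_max _ _ (fun x => `|f x|) _ (ex_intro _ z zK)
    (@ball_compact N).
  exact: continuous_subspaceT.
exists `|f c| => y; have [yN|Ny] := leP `|y| N.
  by apply: cmax; rewrite inE.
by rewrite f0// normr0.
Qed.

Lemma is_derive_line (f : V -> R) (y e : V) (s : R) :
  differentiable f (s *: e + y) ->
  is_derive s 1 (fun s : R => f (s *: e + y)) ('D_e f (s *: e + y)).
Proof.
move=> df; have de := @diff_derivable _ _ _ f _ e df.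
have E : (fun h : R => h^-1 *: (((fun s : R => f (s *: e + y)) \o shift s) (h *: 1)
    - f (s *: e + y))) =
    (fun h => h^-1 *: ((f \o shift (s *: e + y)) (h *: e) - f (s *: e + y))).
  apply/funext => h /=; congr (_ *: (f _ - _)).
  by rewrite [h *: 1]mulr1 scalerDl addrA.
by apply: DeriveDef; rewrite ?/derivable ?/derive E.
Qed.

(** The difference quotients of f in the direction a have integral zero, since
    Lebesgue measure is invariant under translations, and they converge to the
    partial derivative. The mean value theorem bounds them uniformly, and they
    vanish off a fixed bounded set. *)
Lemma integral_partial_eq0 (a : 'I_n) (f : V -> R) (N : R) :
  Ck 1 setT f -> (forall y, N < `|y| -> f y = 0) ->
  \int[lam]_y 'D_(basis_vec R a) f y = 0.
Proof.
move=> /CkSE[df Df] f0; set e := basis_vec R a; pose D := 'D_e f.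
have cf : continuous f by move=> y; apply: differentiable_continuous; exact: df.
have cD : continuous D.
  by move=> y; apply: differentiable_continuous; exact: Ck_diff (Df a) _.
have D0 y : N < `|y| -> D y = 0.
  move=> Ny; rewrite /D (@near_eq_derive _ _ _ _ (cst 0)) ?derive_cst//.
  have cn := @norm_continuous _ V y.
  near=> z; apply: f0; near: z.
  exact: (cn _ (lt_nbhsr Ny)).
have [C DC] := bounded_compact_support cD D0.
(* the translates of f by t m e, where 0 < t m <= 1, all vanish off K *)
pose N' := N + `|e|; pose K : set (borel V) := [set x : V | (`|x| <= N')%R].
have mK : measurable K.
  apply: closed_borel; apply: compact_closed; last exact: ball_compact.
  exact: norm_hausdorff.
pose t (m : nat) : R := harmonic m.
have t0 m : 0 < t m by exact: harmonic_gt0.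
have t1 m : t m <= 1 by rewrite /t /harmonic/= invf_le1// ler1n.
pose q m y : R := (t m)^-1 * (f (t m *: e + y) - f y).
have yK_norm (y : V) : y \notin K -> N + `|e| < `|y|.
  by rewrite notin_setE /K/= => /negP; rewrite -ltNge.
have fK0 y : y \notin K -> f y = 0.
  by move=> /yK_norm yN; rewrite f0// (le_lt_trans _ yN)// lerDl.
have fK m y : y \notin K -> f (t m *: e + y) = 0.
  move=> /yK_norm yN; apply: f0.
  rewrite -ltrBrDr in yN; apply: (lt_le_trans yN).
  rewrite lerBlDr addrC -[leLHS]normrN.
  have -> : - y = t m *: e - (t m *: e + y) by rewrite opprD addrA subrr add0r.
  rewrite (le_trans (ler_normB _ _))// lerD2r normrZ ger0_norm ?(ltW (t0 m))//.
  by rewrite ler_piMl.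
have qC m y : `|q m y| <= C * \1_K y.
  rewrite indicE; case: (boolP (y \in K)) => [_|yK]; last first.
    by rewrite mulr0 /q fK// (fK0 _ yK) subr0 mulr0 normr0.
  rewrite mulr1.
  (* q m y is a value of D, by the mean value theorem on the segment from y
     to t m e + y *)
  have [|c cI E] := @MVT_segment R (fun s => f (s *: e + y))
      (fun s => D (s *: e + y)) 0 (t m) (ltW (t0 m)) (fun s _ => is_derive_line (df _ I)).
    apply: continuous_subspaceT => s.
    apply: differentiable_continuous.
    apply/derivable1_diffP.
    by have [] := is_derive_line (df (s *: e + y) I).
  rewrite scale0r add0r subr0 in E.
  by rewrite /q E mulrC mulfK ?gt_eqF.
have tcvg : t @ \oo --> (0 : R)^'.
  move=> A A0; have {}A0 : nbhs (0 : R) [set y | y != 0 -> A y] := A0.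
  have ev : \forall m \near \oo, t m != 0 -> A (t m) := @cvg_harmonic R _ A0.
  by apply: filterS ev => m; apply; rewrite gt_eqF.
have qD y : (fun m => q m y) @ \oo --> D y.
  have := @diff_derivable _ _ _ f _ e (df y I).
  by move=> dy; exact: (cvg_comp _ _ tcvg dy).
have mf (g : V -> R) : continuous g -> measurable_fun setT (g : borel V -> R).
  exact: continuous_borel.
have cfs m : continuous (fun y => f (t m *: e + y)).
  move=> y; apply: (@continuous_comp _ _ _ (fun y => t m *: e + y) f); last exact: cf.
  by apply: (@cvgD _ V _ (nbhs y) _ (cst (t m *: e)) id); [exact: cvg_cst|exact: cvg_id].
have cq m : continuous (q m).
  move=> y; apply: (@continuousM _ _ (cst (t m)^-1)
    (fun y => f (t m *: e + y) - f y)); first exact: cst_continuous.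
  by apply: (@continuousB _ _ _ (fun y => f (t m *: e + y)) f); [exact: cfs|exact: cf].
have lamK : (lam K < +oo)%E by exact: lebesgue_ball_lty.
have intK C' (g : V -> R) : continuous g -> (forall y, `|g y| <= C' * \1_K y) ->
    lam.-integrable setT (EFin \o g).
  by move=> /mf mg gC; exact: (integrable_bounded_support mK lamK mg gC).
have ig : lam.-integrable setT (EFin \o (fun y => `|C| * \1_K y)).
  apply: (@integrable_bounded_support _ _ _ _ K _ `|C|) => //.
    by apply: measurable_funM => //; exact: measurable_indic.
  by move=> y; rewrite ger0_norm// mulr_ge0.
have [B fB] := bounded_compact_support cf f0.
have intf : lam.-integrable setT (EFin \o f).
  apply: (intK B) => // y; rewrite indicE; case: (boolP (y \in K)) => yK.
    by rewrite mulr1.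
  by rewrite mulr0 fK0 ?normr0.
have intfs m : lam.-integrable setT (EFin \o (fun y => f (t m *: e + y))).
  apply: (intK B) => // y; rewrite indicE; case: (boolP (y \in K)) => yK.
    by rewrite mulr1.
  by rewrite mulr0 fK ?normr0.
have ae1 : {ae lam, forall x, (fun m => q m x) @ \oo --> D x} by exact: aeW.
have ae2 : {ae lam, forall x, forall m, `|q m x| <= `|C| * \1_K x}.
  apply: aeW => x m; apply: (le_trans (qC m x)).
  by rewrite ler_wpM2r// ler_norm.
have [_ _] := Rintegral_dominated (fun m => mf _ (cq m)) (mf _ cD) ae1 ig ae2.
rewrite (_ : (fun m => _) = cst 0) => [h|].
  by have := cvg_unique _ (cvg_cst (0 : R)) h => ->.
apply/funext => m /=.
rewrite RintegralZl//; last exact: integrableRB.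
rewrite RintegralB//.
under eq_Rintegral do rewrite addrC.
by rewrite integral_shift// ?subrr ?mulr0//; exact: mf.
Unshelve. all: by end_near. Qed.

End DivergenceRn.

(** * Smooth functions and vector fields on a manifold *)

Section SmoothFunctions.
Context (R : realType) (n : nat) (T : ptopologicalType).
Variable M : smooth_manifold R n T.
Implicit Types (u v : T -> R) (i j : atlas_idx M) (X : vector_field M).

Lemma smooth_funP u :
  smooth_fun M u <-> forall i m, Ck m (chart_cod (M i)) (u \o chart_inv (M i)).
Proof. by split=> su i; [apply/smooth_onP|apply/smooth_onP]; exact: su. Qed.

Lemma smooth_fun_cst (c : R) : smooth_fun M (cst c).
Proof. by apply/smooth_funP => i m; exact: Ck_cst. Qed.

Lemma smooth_funD u v : smooth_fun M u -> smooth_fun M v ->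
  smooth_fun M (fun x => u x + v x).
Proof.
move=> /smooth_funP su /smooth_funP sv; apply/smooth_funP => i m.
by have h := CkD (@chart_cod_open _ _ _ (M i)) (su i m) (sv i m).
Qed.

Lemma smooth_funM u v : smooth_fun M u -> smooth_fun M v ->
  smooth_fun M (fun x => u x * v x).
Proof.
move=> /smooth_funP su /smooth_funP sv; apply/smooth_funP => i m.
by have h := CkM (@chart_cod_open _ _ _ (M i)) (su i m) (sv i m).
Qed.

Lemma smooth_funZ c u : smooth_fun M u -> smooth_fun M (fun x => c * u x).
Proof. by move=> su; apply: smooth_funM su; exact: smooth_fun_cst. Qed.

Lemma smooth_funB u v : smooth_fun M u -> smooth_fun M v ->
  smooth_fun M (fun x => u x - v x).
Proof.
move=> su /(smooth_funZ (-1)) sv.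
rewrite (_ : (fun _ => _) = (fun x => u x + -1 * v x)); first exact: smooth_funD.
by apply/funext => x; rewrite mulN1r.
Qed.

Lemma smooth_funV u : (forall x, u x != 0) -> smooth_fun M u ->
  smooth_fun M (fun x => (u x)^-1).
Proof.
move=> u0 /smooth_funP su; apply/smooth_funP => i m.
have h := @CkV _ _ _ _ _ (@chart_cod_open _ _ _ (M i)) (fun y _ => u0 _) (su i m).
exact: h.
Qed.

Lemma smooth_fun_ramp u : smooth_fun M u -> smooth_fun M (fun x => ramp (u x)).
Proof.
move=> /smooth_funP su; apply/smooth_funP => i m.
have h := @Ck_flat _ _ _ _ 1 _ (@chart_cod_open _ _ _ (M i)) (su i m); exact: h.
Qed.

Lemma smooth_fun_sum I (r : seq I) (F : I -> T -> R) :
  (forall a, smooth_fun M (F a)) -> smooth_fun M (fun x => \sum_(a <- r) F a x).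
Proof.
move=> sF; elim: r => [|a r ih].
  rewrite (_ : (fun _ => _) = cst 0); first exact: smooth_fun_cst.
  by apply/funext => x; rewrite big_nil.
rewrite (_ : (fun _ => _) = (fun x => F a x + \sum_(a <- r) F a x)).
  exact: smooth_funD.
by apply/funext => x; rewrite big_cons.
Qed.

Lemma smooth_fun_exp u k : smooth_fun M u -> smooth_fun M (fun x => u x ^+ k).
Proof.
move=> su; elim: k => [|k ih].
  rewrite (_ : (fun _ => _) = cst 1); first exact: smooth_fun_cst.
  by apply/funext => x; rewrite expr0.
rewrite (_ : (fun _ => _) = (fun x => u x * u x ^+ k)); first exact: smooth_funM.
by apply/funext => x; rewrite exprS.
Qed.

Lemma smooth_fun_diff u i y : smooth_fun M u -> chart_cod (M i) y ->
  differentiable (u \o chart_inv (M i)) y.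
Proof. by move=> /smooth_funP /(_ i 0%N) /Ck_diff; exact. Qed.

Lemma near_chart_dom i x : chart_dom (M i) x -> \near x, chart_dom (M i) x.
Proof. by move=> xi; apply: open_nbhs_nbhs; split => //; exact: chart_dom_open. Qed.

Lemma near_chart_cod i y : chart_cod (M i) y -> \near y, chart_cod (M i) y.
Proof. by move=> yi; apply: open_nbhs_nbhs; split => //; exact: chart_cod_open. Qed.

Lemma smooth_fun_continuous u : smooth_fun M u -> continuous u.
Proof.
move=> su x; have [i xi] := atlas_cover M x.
have c1 : {for x, continuous ((u \o chart_inv (M i)) \o chart_map (M i))}.
  apply: continuous_comp; first exact: chart_map_cont.
  apply: differentiable_continuous; apply: smooth_fun_diff => //.
  exact: chart_map_sub.
have E : u x = ((u \o chart_inv (M i)) \o chart_map (M i)) x.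
  by rewrite /= chart_mapK.
rewrite /continuous_at E; apply: cvg_trans c1; apply: near_eq_cvg.
by apply: filterS (near_chart_dom xi) => z zi; rewrite /= chart_mapK.
Qed.

Lemma chart_inv_preimage_open i (O : set T) : open O ->
  open (chart_cod (M i) `&` chart_inv (M i) @^-1` O).
Proof.
move=> oO; rewrite openE => y [yi Oy]; apply: filterI; first exact: near_chart_cod.
by apply: (chart_inv_cont yi); apply: open_nbhs_nbhs.
Qed.

Lemma overlap_open i j : open (overlap (M i) (M j)).
Proof. by apply: chart_inv_preimage_open; exact: chart_dom_open. Qed.

Lemma transition_diff i j y : overlap (M i) (M j) y ->
  differentiable (transition (M i) (M j)) y.
Proof.
move=> ijy; apply: differentiable_rV => b.
exact: (@atlas_smooth _ _ _ M i j b [::] y ijy).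
Qed.

Lemma comp_transition u i j y : overlap (M i) (M j) y ->
  (u \o chart_inv (M j)) (transition (M i) (M j) y) = (u \o chart_inv (M i)) y.
Proof. by move=> [yi yj]; rewrite /transition /= chart_mapK. Qed.

Definition chart_ext i (f : 'rV[R]_n -> R) (x : T) : R :=
  if `[< chart_dom (M i) x >] then f (chart_map (M i) x) else 0.

Lemma chart_ext_inv i f y : chart_cod (M i) y ->
  chart_ext i f (chart_inv (M i) y) = f y.
Proof.
move=> yi; rewrite /chart_ext ifT; first by rewrite chart_invK.
by apply/asboolP; exact: chart_inv_sub.
Qed.

Lemma chart_inv_compact_closed i (K : set 'rV[R]_n) : compact K ->
  K `<=` chart_cod (M i) -> closed (chart_inv (M i) @` K).
Proof.
move=> cK Ki; apply: compact_closed; first exact: manifold_hausdorff M.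
apply: continuous_compact cK; apply: continuous_in_subspaceT => y.
by move=> /set_mem /Ki; exact: chart_inv_cont.
Qed.

(** The extension is zero off the image of K, whose complement is open since a
    compact subset of a Hausdorff space is closed. On the domain of the chart
    i, the extension is f composed with a transition map. *)
Lemma chart_ext_smooth i (K : set 'rV[R]_n) f : compact K ->
  K `<=` chart_cod (M i) -> (forall m, Ck m (chart_cod (M i)) f) ->
  (forall y, chart_cod (M i) y -> ~ K y -> f y = 0) ->
  smooth_fun M (chart_ext i f).
Proof.
move=> cK Ki Cf f0; apply/smooth_funP => j m; apply: Ck_local => y yj.
have [yi|yi] := pselect (chart_dom (M i) (chart_inv (M j) y)).
  exists (overlap (M j) (M i)) => //.
  apply: (@Ck_ext _ _ _ _ (f \o transition (M j) (M i))).
  - exact: overlap_open.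
  - move=> z /set_mem[zj zi]; rewrite /chart_ext /= ifT//.
    exact/asboolP.
  - apply: (@Ck_comp _ _ _ _ _ (chart_cod (M i))) => //.
    + exact: overlap_open.
    + by move=> z [zj zi]; exact: chart_map_sub.
    + by move=> b; move: m; apply/smooth_onP; exact: atlas_smooth.
exists (chart_cod (M j) `&` chart_inv (M j) @^-1` ~` (chart_inv (M i) @` K)).
  split => // -[z Kz zy]; apply: yi; rewrite -zy.
  by apply: chart_inv_sub; exact: Ki.
apply: (@Ck_ext _ _ _ _ (cst 0)); last exact: Ck_cst.
  apply: chart_inv_preimage_open; apply: closed_openC.
  exact: chart_inv_compact_closed.
move=> z /set_mem[zj /= zK]; rewrite /chart_ext; case: ifPn => // /asboolP zi.
rewrite f0//; first exact: chart_map_sub.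
by move=> Kz; apply: zK; exists (chart_map (M i) (chart_inv (M j) z)) => //;
  rewrite chart_mapK.
Qed.

(** The value at a point is defined with one chosen chart there; by the chain
    rule, the transformation rule of the components makes it the same in every
    chart. *)
Lemma vf_applyE X u i y : smooth_fun M u -> chart_cod (M i) y ->
  vf_apply X u (chart_inv (M i) y) =
  'D_(vf_comp X i y) (u \o chart_inv (M i)) y.
Proof.
move=> su yi; set x := chart_inv (M i) y; set j := chart_at M x.
have xj : chart_dom (M j) x by rewrite /j /chart_at; case: cid.
have ijy : overlap (M i) (M j) y by split.
have Ey : coord_at M x = transition (M i) (M j) y by [].
rewrite /vf_apply -/j Ey /vf_at -/j Ey (vf_change X ijy).
rewrite -(deriveEjacobian _ (transition_diff ijy)).
rewrite -derive_comp_rV; last 2 first.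
- exact: transition_diff.
- by apply: smooth_fun_diff => //; exact: chart_map_sub.
apply: near_eq_derive.
have := open_nbhs_nbhs (conj (@overlap_open i j) ijy).
by apply: filterS => z; exact: comp_transition.
Qed.

Lemma vf_apply_coord X u i y : smooth_fun M u -> chart_cod (M i) y ->
  vf_apply X u (chart_inv (M i) y) =
  \sum_a vf_comp X i y 0 a * 'D_(basis_vec R a) (u \o chart_inv (M i)) y.
Proof.
by move=> su yi; rewrite vf_applyE// derive_dir//; exact: smooth_fun_diff.
Qed.

Lemma vf_apply_smooth X u : smooth_fun M u -> smooth_fun M (vf_apply X u).
Proof.
move=> su; apply/smooth_funP => i m.
apply: (@Ck_ext _ _ _ _ (\sum_a ((fun y => vf_comp X i y 0 a) *
   'D_(basis_vec R a) (u \o chart_inv (M i))))).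
- exact: chart_cod_open.
- by move=> y /set_mem yi; rewrite fct_sumE /= vf_apply_coord.
- apply: Ck_sum; first exact: chart_cod_open.
  move=> a; apply: CkM; first exact: chart_cod_open.
    by move: m; apply/smooth_onP; exact: vf_smooth.
  by move: su => /smooth_funP /(_ i m.+1) /CkSE[].
Qed.

Lemma at_chart_dom x : chart_dom (M (chart_at M x)) x.
Proof. by rewrite /chart_at; case: cid. Qed.

Lemma coord_at_cod x : chart_cod (M (chart_at M x)) (coord_at M x).
Proof. by apply: chart_map_sub; exact: at_chart_dom. Qed.

Lemma smooth_fun_derivable u x w : smooth_fun M u ->
  derivable (u \o chart_inv (M (chart_at M x))) (coord_at M x) w.
Proof.
by move=> su; apply: diff_derivable; apply: smooth_fun_diff => //; exact: coord_at_cod.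
Qed.

Lemma vf_applyD X u v x : smooth_fun M u -> smooth_fun M v ->
  vf_apply X (fun x => u x + v x) x = vf_apply X u x + vf_apply X v x.
Proof. by move=> su sv; apply: deriveD; exact: smooth_fun_derivable. Qed.

Lemma vf_applyM X u v x : smooth_fun M u -> smooth_fun M v ->
  vf_apply X (fun x => u x * v x) x = u x * vf_apply X v x + v x * vf_apply X u x.
Proof.
move=> su sv; rewrite /vf_apply.
have E (w : T -> R) : w x = (w \o chart_inv (M (chart_at M x))) (coord_at M x).
  by rewrite /= /coord_at chart_mapK//; exact: at_chart_dom.
by rewrite (E u) (E v); apply: deriveM; exact: smooth_fun_derivable.
Qed.

Lemma vf_apply_cst X (c : R) x : vf_apply X (cst c) x = 0.
Proof. by rewrite /vf_apply (_ : _ \o _ = cst c)// derive_cst. Qed.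

Lemma vf_applyZ X (c : R) u x : smooth_fun M u ->
  vf_apply X (fun x => c * u x) x = c * vf_apply X u x.
Proof.
move=> su; rewrite (vf_applyM X x (@smooth_fun_cst c) su) vf_apply_cst.
by rewrite mulr0 addr0.
Qed.

End SmoothFunctions.

(** * Bump functions and partitions of unity *)

Section BoxBump.
Context (R : realType) (n : nat).
Implicit Types (c y : 'rV[R]_n) (r : R).

Definition box_bump c r y : R :=
  \prod_(a < n) (ramp (r - (y 0 a - c 0 a)) * ramp (r + (y 0 a - c 0 a))).

Lemma box_bump_ge0 c r y : 0 <= box_bump c r y.
Proof. by apply: prodr_ge0 => a _; rewrite mulr_ge0// ramp_ge0. Qed.

Lemma ramp_eq0 (x : R) : x <= 0 -> ramp x = 0.
Proof. by move=> x0; rewrite /ramp /flat ifF//; apply/negbTE; rewrite -leNgt. Qed.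

Lemma box_bump_neq0 c r y : box_bump c r y != 0 ->
  forall a, `|c 0 a - y 0 a| < r.
Proof.
move=> + a; apply: contraNT; rewrite -leNgt ler_normr => h.
rewrite /box_bump (bigD1 a)//=.
case/orP: h => h.
  by rewrite [X in _ * X * _]ramp_eq0 ?mulr0 ?mul0r//; lra.
by rewrite [X in X * _ * _]ramp_eq0 ?mul0r//; lra.
Qed.

Lemma box_bump_center c r : 0 < r -> 0 < box_bump c r c.
Proof.
by move=> r0; apply: prodr_gt0 => a _; rewrite subrr subr0 addr0 mulr_gt0// ramp_gt0.
Qed.

Lemma Ck_box_bump m c r U : open U -> Ck m U (box_bump c r).
Proof.
move=> oU.
have C1 a : Ck m U (fun y : 'rV[R]_n => y 0 a - c 0 a).
  by have h := CkD oU (@Ck_coord _ _ m U a) (@Ck_cst _ _ m U (- c 0 a)).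
have C2 a : Ck m U (fun y : 'rV[R]_n => r + (y 0 a - c 0 a)).
  by have h := CkD oU (@Ck_cst _ _ m U r) (C1 a).
have C3 a : Ck m U (fun y : 'rV[R]_n => r - (y 0 a - c 0 a)).
  have h := CkD oU (@Ck_cst _ _ m U r) (CkM oU (@Ck_cst _ _ m U (-1)) (C1 a)).
  apply: Ck_ext h => // y _.
  by rewrite !fctE mulN1r.
have h := @Ck_prod _ _ m U _ (index_enum 'I_n)
  (fun a => (fun y : 'rV[R]_n => ramp (r - (y 0 a - c 0 a))) *
            (fun y : 'rV[R]_n => ramp (r + (y 0 a - c 0 a)))) oU
  (fun a => CkM oU (@Ck_flat _ _ _ _ 1 _ oU (C3 a)) (@Ck_flat _ _ _ _ 1 _ oU (C2 a))).
apply: Ck_ext h => // y _.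
by rewrite /box_bump fct_prodE.
Qed.

End BoxBump.

Section Bump.
Context (R : realType) (n : nat) (T : ptopologicalType).
Variable M : smooth_manifold R n T.

Definition chart_supported (i : atlas_idx M) (b : T -> R) :=
  exists K : set 'rV[R]_n, [/\ compact K, K `<=` chart_cod (M i) &
    forall x, b x != 0 -> chart_dom (M i) x /\ K (chart_map (M i) x)].

Lemma closed_box_compact (c : 'rV[R]_n) (r : R) :
  compact [set y : 'rV[R]_n | forall a, `|c 0 a - y 0 a| <= r].
Proof.
rewrite (_ : mkset _ = [set y : 'rV[R]_n | forall a, `[c 0 a - r, c 0 a + r]%classic (y 0 a)]).
  by apply: (@rV_compact _ _ (fun a => `[c 0 a - r, c 0 a + r]%classic)) => a;
    exact: segment_compact.
apply/seteqP; split => y h a; have := h a; rewrite /= in_itv/= ler_norml.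
  by move=> /andP[h1 h2]; apply/andP; split; lra.
by move=> /andP[h1 h2]; apply/andP; split; lra.
Qed.

Lemma bump_exists (x : T) (O : set T) i : open O -> O x -> chart_dom (M i) x ->
  exists b : T -> R, [/\ smooth_fun M b, chart_supported i b,
    (forall z, 0 <= b z), 0 < b x & forall z, b z != 0 -> O z].
Proof.
move=> oO Ox xi; set y := chart_map (M i) x.
have yi : chart_cod (M i) y by exact: chart_map_sub.
have Oy : (chart_cod (M i) `&` chart_inv (M i) @^-1` O) y.
  by split => //=; rewrite chart_mapK.
have [e e0 eO] := nbhs_rV (open_nbhs_nbhs (conj (@chart_inv_preimage_open _ _ _ _ i O oO) Oy)).
pose r := e / 2; have r0 : 0 < r by rewrite divr_gt0.
have re : r < e by rewrite /r ltr_pdivrMr// ltr_pMr// ltr1n.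
pose K := [set z : 'rV[R]_n | forall a, `|y 0 a - z 0 a| <= r].
have KO z : K z -> (chart_cod (M i) `&` chart_inv (M i) @^-1` O) z.
  by move=> Kz; apply: eO => a; exact: le_lt_trans (Kz a) re.
have bK z : box_bump y r z != 0 -> K z.
  by move=> /box_bump_neq0 h a; exact: ltW.
exists (chart_ext i (box_bump y r)); split.
- apply: (@chart_ext_smooth _ _ _ _ i K).
  + exact: closed_box_compact.
  + by move=> z /KO[].
  + by move=> m; apply: Ck_box_bump; exact: chart_cod_open.
  + by move=> z zi /(contra_not (@bK z)) /negP; rewrite negbK => /eqP.
- exists K; split.
  + exact: closed_box_compact.
  + by move=> z /KO[].
  + move=> z; rewrite /chart_ext; case: ifPn => [/asboolP zi /bK|_] //.
    by rewrite eqxx.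
- by move=> z; rewrite /chart_ext; case: ifP => // _; exact: box_bump_ge0.
- rewrite /chart_ext ifT; first exact: box_bump_center.
  exact/asboolP.
- move=> z; rewrite /chart_ext; case: ifPn => [/asboolP zi /bK /KO[_ /=]|_].
    by rewrite chart_mapK.
  by rewrite eqxx.
Qed.

(** Finitely many bumps have no common zero by compactness; divide each of
    them by their sum. *)
Lemma partition_of_unity : compact [set: T] ->
  exists (N : nat) (chi : 'I_N -> T -> R) (idx : 'I_N -> atlas_idx M),
  [/\ forall a, smooth_fun M (chi a), forall a, chart_supported (idx a) (chi a) &
    forall x, \sum_a chi a x = 1].
Proof.
move=> cT.
have /choice[b bP] (x : T) : exists b : T -> R,
    [/\ smooth_fun M b, chart_supported (chart_at M x) b,
    (forall z, 0 <= b z) & 0 < b x].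
  have [b [sb cb b0 bx _]] := bump_exists (@openT T) I (at_chart_dom M x).
  by exists b.
have : cover_compact [set: T] by rewrite -compact_cover.
move=> /(_ T setT (fun x => [set z | 0 < b x z])) [].
- move=> x _; have [sb _ _ _] := bP x.
  have cb := smooth_fun_continuous sb.
  apply: (@open_comp _ _ (b x) [set r | 0 < r]) => [z _|]; first exact: cb.
  exact: open_gt.
- by move=> x _; exists x => //=; have [] := bP x.
move=> D _ covD.
pose s := finmap.enum_fset D.
exists (size s).
pose pt (a : 'I_(size s)) : T := nth point s a.
pose S x := \sum_(a < size s) b (pt a) x.
have S0 x : 0 < S x.
  have [z zD bz] := covD x I.
  have zs : z \in s by [].
  have iz : (index z s < size s)%N by rewrite index_mem.
  rewrite /S (bigD1 (Ordinal iz))//= ltr_wpDr//.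
    by apply: sumr_ge0 => a _; have [] := bP (pt a).
  by rewrite /pt/= nth_index.
have sS : smooth_fun M S by apply: smooth_fun_sum => a; have [] := bP (pt a).
exists (fun a x => b (pt a) x * (S x)^-1), (fun a => chart_at M (pt a)); split.
- move=> a; apply: smooth_funM; first by have [] := bP (pt a).
  by apply: smooth_funV => // x; rewrite gt_eqF.
- move=> a; have [_ [K [cK Ki bK]] _ _] := bP (pt a); exists K; split => //.
  by move=> x bx; apply: bK; apply: contraNneq bx => ->; rewrite mul0r.
- by move=> x; rewrite -mulr_suml; apply: mulfV; rewrite gt_eqF//; exact: S0.
Qed.

End Bump.

(** * The Riemannian volume in a chart *)

Section PosDet.
Context (R : realType) (n : nat).

Lemma posdef_det_neq0 (A : 'M[R]_n) :
  (forall v : 'rV[R]_n, v != 0 -> 0 < (v *m A *m v^T) 0 0) -> \det A != 0.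
Proof.
move=> Apos; apply/negP => /det0P[v v0 vA].
by have := Apos v v0; rewrite vA mul0mx mxE ltxx.
Qed.

Lemma scalar_posdef (v : 'rV[R]_n) : v != 0 -> 0 < (v *m v^T) 0 0.
Proof.
move=> v0; rewrite lt_neqAle; apply/andP; split; last first.
  by rewrite mxE sumr_ge0// => a _; rewrite mxE -expr2 sqr_ge0.
rewrite eq_sym; apply: contraNneq v0 => v0.
apply/eqP/rowP => a; rewrite mxE; move/eqP: v0; rewrite mxE psumr_eq0.
  by move=> /allP/(_ a (mem_index_enum _)); rewrite mxE -expr2 sqrf_eq0 => /eqP.
by move=> b _; rewrite mxE -expr2 sqr_ge0.
Qed.

(** The determinant is nonzero on the segment from the identity to A, which
    consists of positive definite matrices, so it keeps the sign that it has
    at the identity. *)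
Lemma posdef_det (A : 'M[R]_n) :
  (forall v : 'rV[R]_n, v != 0 -> 0 < (v *m A *m v^T) 0 0) -> 0 < \det A.
Proof.
move=> Apos.
(* the points (1 - t) I + t A of the segment, with t as an indeterminate *)
pose P : 'M[{poly R}]_n := (1 - 'X)%:M + 'X *: map_mx polyC A.
pose p := \det P.
have pE t : p.[t] = \det ((1 - t)%:M + t *: A).
  rewrite /p -horner_evalE -det_map_mx; congr (\det _).
  apply/matrixP => i j.
  transitivity (P i j).[t]; first by rewrite mxE.
  by rewrite /P !mxE hornerD hornerMn !hornerE.
have p0 t : 0 <= t <= 1 -> p.[t] != 0.
  move=> /andP[t0 t1]; rewrite pE; apply: posdef_det_neq0 => v v0.
  rewrite mulmxDr mulmxDl mxE -scalemxAr -scalemxAl mul_mx_scalar -scalemxAl !mxE.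
  have h1 := scalar_posdef v0; have h2 := Apos v v0.
  rewrite !mxE in h1 h2.
  have [->|tn0] := eqVneq t 0; first by rewrite subr0 mul1r mul0r addr0.
  by rewrite ltr_wpDl// ?mulr_ge0 ?subr_ge0// ?ltW// mulr_gt0// lt_neqAle eq_sym tn0.
have p01 : p.[0] = 1 by rewrite pE subr0 scale0r addr0 det1.
have p11 : p.[1] = \det A by rewrite pE subrr scale1r -scalemx1 scale0r add0r.
rewrite -p11 ltNge; apply/negP => p1.
have [x xI px] : exists2 x, x \in `[0, 1] & p.[x] = 0.
  apply: IVT => //.
    by apply: continuous_subspaceT; exact: continuous_horner.
  by rewrite p01 (min_idPr _) ?(max_idPl _) ?p1 ?ler01// (le_trans p1).
by have := p0 x; rewrite px eqxx; move: xI; rewrite in_itv/= => -> /(_ isT).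
Qed.

End PosDet.

Section ChangeOfVariables.
Local Open Scope ereal_scope.
Context d1 d2 (T1 : measurableType d1) (T2 : measurableType d2) (R : realType).
Variables (m1 : {measure set T1 -> \bar R}) (m2 : {measure set T2 -> \bar R}).
Variables (D1 : set T1) (D2 : set T2) (p : T2 -> T1) (w : T2 -> R).
Hypotheses (mD1 : measurable D1) (mD2 : measurable D2).
Hypotheses (mp : measurable_fun D2 p) (mw : measurable_fun D2 w).
Hypothesis w0 : forall y, D2 y -> (0 <= w y)%R.
Hypothesis pD : forall y, D2 y -> D1 (p y).
Hypothesis m1E : forall A, measurable A -> A `<=` D1 ->
  m1 A = \int[m2]_(y in D2 `&` p @^-1` A) (w y)%:E.

Import HBNNSimple.

(** The hypothesis [m1E] is the case of an indicator function; simple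
    functions and monotone convergence give the general case. *)
Lemma ge0_change_of_variables (f : T1 -> \bar R) : (forall x, 0 <= f x) ->
  measurable_fun D1 f ->
  \int[m1]_(x in D1) f x = \int[m2]_(y in D2) (f (p y) * (w y)%:E).
Proof.
move=> f0 mf.
pose h := nnsfun_approx mD1 mf.
have mhp k : measurable_fun D2 (fun y => (h k (p y))%:E).
  apply/measurable_EFinP; apply: (measurable_comp mD1) => //.
    by move=> _ [y Dy <-]; exact: pD.
  exact: measurable_funTS.
have mwE : measurable_fun D2 (EFin \o w) by exact/measurable_EFinP.
have -> : \int[m1]_(x in D1) f x = lim (\int[m1]_(x in D1) (EFin \o h k) x @[k --> \oo]).
  have fE x : D1 x -> f x = lim ((EFin \o h k) x @[k --> \oo]).
    by move=> Ex; apply/esym/cvg_lim => //; exact: cvg_nnsfun_approx.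
  under eq_integral => x /[!inE] /fE -> //.
  apply: monotone_convergence => //.
  - move=> k; apply/measurable_EFinP.
    by apply: (measurable_funS measurableT) => //; exact/measurable_funP.
  - by move=> k x Ex //=; rewrite lee_fin.
  - by move=> x Ex a b ab; rewrite lee_fin; exact/lefP/nd_nnsfun_approx.
have -> : \int[m2]_(y in D2) (f (p y) * (w y)%:E) =
    lim (\int[m2]_(y in D2) ((h k (p y))%:E * (w y)%:E) @[k --> \oo]).
  have fg y : D2 y -> f (p y) * (w y)%:E =
      lim ((h k (p y))%:E * (w y)%:E @[k --> \oo]).
    move=> Dy; apply/esym/cvg_lim => //; apply: cvgeZr => //.
    by apply: cvg_nnsfun_approx => //; exact: pD.
  under eq_integral => x /[!inE] /fg -> //.
  apply: monotone_convergence => [//| | |].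
  - by move=> k; exact: emeasurable_funM.
  - by move=> k y Dy /=; rewrite mule_ge0 ?lee_fin ?w0.
  - move=> y Dy a b ab/=; rewrite lee_wpmul2r ?lee_fin ?w0//.
    exact/lefP/nd_nnsfun_approx.
congr (lim _); congr (_ @ \oo); apply/funext => k.
transitivity (\int[m1]_(x in D1)
   (\sum_(y \in range (h k)) (y * \1_(h k @^-1` [set y]) x)%:E)).
  by apply: eq_integral => t tE; rewrite /= fimfunE -fsumEFin.
transitivity (\int[m2]_(z in D2)
   (\sum_(y \in range (h k)) (y * \1_(h k @^-1` [set y]) (p z))%:E * (w z)%:E)); last first.
  under [RHS]eq_integral => z zD.
    rewrite fimfunE -fsumEFin// ge0_mule_fsuml => [|y]; last exact: nnfun_muleindic_ge0.
    over.
  by [].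
have indich r : measurable_fun D1 (fun x => (r * \1_(h k @^-1` [set r]) x)%:E).
  by apply: (measurable_comp measurableT) => //; exact: measurable_funM.
have indicp r : measurable_fun D2 (fun z => (r * \1_(h k @^-1` [set r]) (p z))%:E).
  apply/measurable_EFinP; apply: measurable_funM => //.
  have mE : measurable (h k @^-1` [set r]) by exact: measurable_sfunP.
  apply: (@measurable_comp _ _ _ _ _ _ D1 (\1_(h k @^-1` [set r]) : T1 -> R)) => //.
    by move=> _ [y Dy <-]; exact: pD.
rewrite ge0_integral_fsum//; last by move=> y x _; exact: nnfun_muleindic_ge0.
rewrite ge0_integral_fsum//; last 2 first.
- by move=> y; exact: emeasurable_funM.
- move=> y z Dz; apply: mule_ge0; last by rewrite lee_fin w0.
  by rewrite EFinM nnfun_muleindic_ge0.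
apply: eq_fsbigr => r /[!inE] rh.
have r0 : (0 <= r)%R by case: rh => x _ <-.
set E := h k @^-1` [set r].
have mE : measurable E by exact: measurable_sfunP.
under eq_integral do rewrite EFinM.
rewrite ge0_integralZl//; last by apply/measurable_EFinP; exact: measurable_indic.
rewrite integral_indic// m1E; [|exact: measurableI|exact: subIsetr].
under [RHS]eq_integral do rewrite EFinM -muleA.
rewrite [RHS]ge0_integralZl//; last 2 first.
- apply: emeasurable_funM => //; apply/measurable_EFinP.
  apply: (@measurable_comp _ _ _ _ _ _ D1 (\1_E : T1 -> R)) => //.
    by move=> _ [y Dy <-]; exact: pD.
- by move=> x Dx; rewrite mule_ge0// lee_fin ?w0.
congr (_ * _).
rewrite [LHS]integral_mkcond [RHS]integral_mkcond; apply: eq_integral => z _.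
rewrite /restrict /= in_setI.
have [zD|zD] := boolP (z \in D2) => //=.
rewrite indicE; have -> : (z \in p @^-1` (E `&` D1)) = (p z \in E).
  apply/idP/idP => [/set_mem[Ez _]|/set_mem Ez]; apply/mem_set => //.
  by split => //; apply: pD; exact/set_mem.
by case: (p z \in E); rewrite ?mul1e ?mul0e.
Qed.

End ChangeOfVariables.

Lemma measure_bigsetU_lty d (T : measurableType d) (R : realType)
    (mu : {measure set T -> \bar R}) (I : Type) (r : seq I) (F : I -> set T) :
  (forall a, measurable (F a)) -> (forall a, (mu (F a) < +oo)%E) ->
  (mu (\big[setU/set0]_(a <- r) F a) < +oo)%E.
Proof.
move=> mF Foo; elim: r => [|a r ih]; first by rewrite big_nil measure0.
rewrite big_cons; apply: (@le_lt_trans _ _ (mu (F a) + mu (\big[setU/set0]_(a <- r) F a))%E).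
  by apply: measureU2 => //; exact: bigsetU_measurable.
by rewrite lte_add_pinfty.
Qed.

Section RiemannianMeasure.
Context (R : realType) (n : nat) (T : ptopologicalType).
Variables (M : smooth_manifold R n T) (g : riemannian_metric M).
Variable mu : {measure set (borel T) -> \bar R}.
Variable lam : {measure set (borel 'rV[R]_n) -> \bar R}.
Hypothesis lamP : is_lebesgue lam.

Definition density (i : atlas_idx M) (y : 'rV[R]_n) : R :=
  Num.sqrt (\det (metric_mx g i y)).

Hypothesis muP : forall i (A : set (borel T)), measurable A ->
  A `<=` chart_dom (M i) ->
  mu A = (\int[lam]_(y in chart_map (M i) @` A) (density i y)%:E)%E.

Lemma metric_det_gt0 i y : chart_cod (M i) y -> 0 < \det (metric_mx g i y).
Proof. by move=> yi; apply: posdef_det => v v0; exact: metric_posdef. Qed.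

Lemma density_gt0 i y : chart_cod (M i) y -> 0 < density i y.
Proof. by move=> yi; rewrite sqrtr_gt0 metric_det_gt0. Qed.

Lemma Ck_density i m : Ck m (chart_cod (M i)) (density i).
Proof.
have oi := @chart_cod_open _ _ _ (M i).
apply: (@Ck_sqrt _ _ m _ (fun y => \det (metric_mx g i y))) => //.
  by move=> y yi; exact: metric_det_gt0.
have Cg a b : Ck m (chart_cod (M i)) (fun y => metric_mx g i y a b).
  by move: m; apply/smooth_onP; exact: metric_smooth.
have h := @Ck_sum _ _ m _ _ (index_enum {perm 'I_n}) (fun s : {perm 'I_n} =>
  cst ((-1) ^+ odd_perm s) * \prod_a (fun y => metric_mx g i y a (s a))) oi
  (fun s => CkM oi (@Ck_cst _ _ m _ ((-1) ^+ odd_perm s)) (Ck_prod _ oi (fun a => Cg a (s a)))).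
apply: Ck_ext h => // y _.
rewrite fct_sumE; apply: eq_bigr => s _.
by rewrite !fctE fct_prodE.
Qed.

Lemma chart_map_image i (A : set T) : A `<=` chart_dom (M i) ->
  chart_map (M i) @` A = chart_cod (M i) `&` chart_inv (M i) @^-1` A.
Proof.
move=> Ai; apply/seteqP; split => [_ [x Ax <-]|y [yi Ay]].
  have xi := Ai _ Ax; split; first exact: chart_map_sub.
  by rewrite /= chart_mapK.
by exists (chart_inv (M i) y) => //; rewrite chart_invK.
Qed.

Let Vb := borel 'rV[R]_n.
Let Tb := borel T.

Lemma chart_cod_borel i : measurable (chart_cod (M i) : set Vb).
Proof. by apply: open_borel; exact: chart_cod_open. Qed.

Lemma chart_dom_borel i : measurable (chart_dom (M i) : set Tb).
Proof. by apply: open_borel; exact: chart_dom_open. Qed.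

Lemma Ck_borel i (f : 'rV[R]_n -> R) : Ck 0 (chart_cod (M i)) f ->
  measurable_fun (chart_cod (M i) : set Vb) (f : Vb -> R).
Proof.
move=> Cf; apply: open_fun_borel; first exact: chart_cod_open.
by move=> y yi; apply: differentiable_continuous; exact: Ck_diff Cf yi.
Qed.

Lemma chart_inv_borel i :
  measurable_fun (chart_cod (M i) : set Vb) (chart_inv (M i) : Vb -> Tb).
Proof.
apply: open_map_borel; first exact: chart_cod_open.
by move=> y; exact: chart_inv_cont.
Qed.

Lemma ge0_integral_chart i (f : Tb -> \bar R) : (forall x, 0 <= f x)%E ->
  measurable_fun setT f ->
  (\int[mu]_(x in chart_dom (M i)) f x =
   \int[lam]_(y in chart_cod (M i)) (f (chart_inv (M i) y) * (density i y)%:E))%E.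
Proof.
move=> f0 mf.
apply: (@ge0_change_of_variables _ _ Tb Vb R mu lam (chart_dom (M i))
  (chart_cod (M i)) (chart_inv (M i)) (density i)) => //.
- exact: chart_dom_borel.
- exact: chart_cod_borel.
- exact: chart_inv_borel.
- by apply: Ck_borel; exact: Ck_density.
- by move=> y yi; rewrite ltW// density_gt0.
- by move=> y yi; exact: chart_inv_sub.
- by move=> A mA Ai; rewrite (muP mA Ai) chart_map_image.
- exact: measurable_funTS.
Qed.

(** The positive and the negative part are treated separately by
    [ge0_integral_chart]; multiplication by the positive density commutes with
    taking them. *)
Lemma Rintegral_chart i (f : T -> R) : measurable_fun setT (f : Tb -> R) ->
  (forall x, ~ chart_dom (M i) x -> f x = 0) ->
  \int[mu]_x f x =
  \int[lam]_(y in chart_cod (M i)) (f (chart_inv (M i) y) * density i y).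
Proof.
move=> mf f0; rewrite /Rintegral; congr fine.
have -> : (\int[mu]_x (f x)%:E = \int[mu]_(x in chart_dom (M i)) (f x)%:E)%E.
  rewrite [RHS]integral_mkcond; apply: eq_integral => x _.
  by rewrite /restrict; case: ifPn => //; rewrite notin_setE => /f0 ->.
have mfE : measurable_fun setT (EFin \o f : Tb -> \bar R) by exact/measurable_EFinP.
rewrite [LHS]integralE [RHS](integralE lam).
rewrite ge0_integral_chart//; last exact: measurable_funepos.
rewrite ge0_integral_chart//; last exact: measurable_funeneg.
congr (_ - _)%E; apply: eq_integral => y /set_mem yi; have w0 := density_gt0 yi.
  by rewrite !funeposE -EFin_max -EFinM -EFin_max maxr_pMl ?mul0r// ltW.
by rewrite !funenegE -!EFinN -EFin_max -EFinM -EFin_max maxr_pMl ?mul0r ?mulNr// ltW.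
Qed.

Hypothesis cT : compact [set: T].

(** In the chart the support lies in a compact set, which has finite Lebesgue
    measure and on which the density is bounded. *)
Lemma chart_supported_measure_lty (i : atlas_idx M) (b : T -> R) : smooth_fun M b ->
  chart_supported i b -> (mu [set x | b x != 0%R] < +oo)%E.
Proof.
move=> sb [K [cK Ki bK]].
have cb := smooth_fun_continuous sb.
have mB : measurable ([set x | b x != 0] : set Tb).
  apply: open_borel; apply: (@open_comp _ _ b [set r | r != 0]) => [z _|].
    exact: cb.
  exact: open_neq.
have [C CK] : exists C, forall y, K y -> density i y <= C.
  have [[z zK]|K0] := pselect (K !=set0); last first.
    by exists 0 => y Ky; exfalso; apply: K0; exists y.
  have [|c cKK cmax] := @compact_EVT_max _ _ (density i) K (ex_intro _ z zK) cK.
    apply: continuous_in_subspaceT => y /set_mem /Ki yi.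
    apply: differentiable_continuous; exact: (Ck_diff (Ck_density i 0) yi).
  by exists (density i c) => y Ky; apply: cmax; rewrite inE.
have Bi : [set x | b x != 0] `<=` chart_dom (M i) by move=> x /bK[].
rewrite (muP mB Bi).
pose E : set Vb := chart_map (M i) @` [set x | b x != 0].
have mE : measurable E.
  by rewrite /E chart_map_image//; exact: (@chart_inv_borel i (chart_cod_borel i) _ mB).
have EK : E `<=` K by move=> _ [x /bK[_ ?] <-].
have [N KN] := compact_bounded cK.
pose N1 := `|N| + 1.
have lamE : (lam E < +oo)%E.
  apply: le_lt_trans (lebesgue_ball_lty lamP N1).
  apply: le_measure; rewrite ?inE//.
    by apply: closed_borel; apply: compact_closed; [exact: norm_hausdorff|exact: ball_compact].
  move=> y /EK Ky /=; apply: KN.2 => //.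
  by rewrite /N1 (le_lt_trans (ler_norm _))// ltrDl.
apply: (@le_lt_trans _ _ (\int[lam]_(y in E) (`|C|)%:E)%E).
  apply: ge0_le_integral => //.
  - by move=> y _; rewrite lee_fin sqrtr_ge0.
  - apply/measurable_EFinP; apply: measurable_funS (Ck_borel (Ck_density i 0)).
      exact: chart_cod_borel.
    by move=> y /EK /Ki.
  - by move=> y /EK Ky; rewrite lee_fin (le_trans (CK _ Ky))// ler_norm.
rewrite integral_cst//; apply: lte_mul_pinfty => //.
Qed.

Lemma riemannian_measure_lty : (mu [set: T] < +oo)%E.
Proof.
have [N [chi [idx [schi cchi chi1]]]] := partition_of_unity M cT.
have mB a : measurable ([set x | chi a x != 0] : set Tb).
  have cb := smooth_fun_continuous (schi a).
  apply: open_borel; apply: (@open_comp _ _ (chi a) [set r | r != 0]) => [z _|].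
    exact: cb.
  exact: open_neq.
have cov : [set: Tb] `<=` \big[setU/set0]_(a < N) [set x | chi a x != 0].
  move=> x _; rewrite -bigcup_seq.
  have [//|h] := pselect (exists a, chi a x != 0).
    by move=> [a xa]; exists a => //=; rewrite mem_index_enum.
  have : \sum_a chi a x = 0.
    apply: big1 => a _; apply/eqP; apply: contra_notT h => xa; by exists a.
  by rewrite chi1 => /eqP; rewrite oner_eq0.
apply: (@le_lt_trans _ _ (mu (\big[setU/set0]_(a < N) [set x | chi a x != 0%R]))).
  apply: le_measure => //; rewrite ?inE//.
  exact: bigsetU_measurable.
apply: measure_bigsetU_lty => // a.
by have := chart_supported_measure_lty (schi a) (cchi a).
Qed.

End RiemannianMeasure.

(** * Integration by parts for a vector field *)

Section RintegralSum.
Context d (T : measurableType d) (R : realType) (mu : {measure set T -> \bar R}).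

Lemma integrableR_sum I (r : seq I) (F : I -> T -> R) :
  (forall a, mu.-integrable setT (EFin \o F a)) ->
  mu.-integrable setT (EFin \o (fun x => \sum_(a <- r) F a x)).
Proof.
move=> intF; elim: r => [|a r ih].
  rewrite (_ : _ \o _ = cst 0%E); first exact: integrable0.
  by apply/funext => x; rewrite /= big_nil.
rewrite (_ : _ \o _ = EFin \o (fun x => F a x + \sum_(a <- r) F a x)).
  exact: integrableRD.
by apply/funext => x; rewrite /= big_cons.
Qed.

Lemma Rintegral_sum I (r : seq I) (F : I -> T -> R) :
  (forall a, mu.-integrable setT (EFin \o F a)) ->
  \int[mu]_x (\sum_(a <- r) F a x) = \sum_(a <- r) \int[mu]_x F a x.
Proof.
move=> intF; elim: r => [|a r ih].
  rewrite big_nil; under eq_Rintegral do rewrite big_nil.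
  by rewrite Rintegral_cst// mul0r.
rewrite big_cons -ih -RintegralD//; last exact: integrableR_sum.
by apply: eq_Rintegral => x _; rewrite big_cons.
Qed.

End RintegralSum.

Lemma integrable_compact_support (R : realType) (n : nat)
    (lam : {measure set (borel 'rV[R]_n) -> \bar R}) (f : 'rV[R]_n -> R) (N : R) :
  is_lebesgue lam -> continuous f -> (forall y, N < `|y| -> f y = 0) ->
  lam.-integrable setT (EFin \o f).
Proof.
move=> lamP cf f0; have [C fC] := bounded_compact_support cf f0.
have mK : measurable ([set x : 'rV[R]_n | `|x| <= N] : set (borel 'rV[R]_n)).
  by apply: closed_borel; apply: compact_closed; [exact: norm_hausdorff|exact: ball_compact].
apply: (integrable_bounded_support mK (lebesgue_ball_lty lamP N)
  (continuous_borel cf) (C := C)) => y.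
rewrite indicE; case: (boolP (y \in _)) => [_|]; first by rewrite mulr1.
by rewrite notin_setE /= => /negP; rewrite -ltNge => /f0 ->; rewrite normr0 mulr0.
Qed.

Section CompactIntegrable.
Context (R : realType) (T : ptopologicalType).
Variable mu : {measure set (borel T) -> \bar R}.
Hypotheses (cT : compact [set: T]) (muT : (mu [set: T] < +oo)%E).

Lemma continuous_bounded (u : T -> R) : continuous u ->
  exists C, forall x, `|u x| <= C.
Proof.
move=> cu; have [|c _ cmax] := @compact_EVT_max _ _ (fun x => `|u x|) _ (ex_intro _ point I) cT.
  apply: continuous_subspaceT => x.
  by apply: continuous_comp; [exact: cu|exact: norm_continuous].
by exists `|u c| => x; apply: cmax; rewrite inE.
Qed.

Lemma bounded_integrable (u : T -> R) C : measurable_fun setT (u : borel T -> R) ->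
  (forall x, `|u x| <= C) -> mu.-integrable setT (EFin \o u).
Proof.
move=> mu_ uC; apply: (integrable_bounded_support measurableT muT mu_ (C := C)) => x.
by rewrite indicT mulr1.
Qed.

Lemma continuous_integrable (u : T -> R) : continuous u ->
  mu.-integrable setT (EFin \o u).
Proof.
move=> cu; have [C uC] := continuous_bounded cu.
by apply: bounded_integrable uC; exact: continuous_borel.
Qed.

End CompactIntegrable.

Section Divergence.
Context (R : realType) (n : nat) (T : ptopologicalType).
Variables (M : smooth_manifold R n T) (g : riemannian_metric M).
Variable mu : {measure set (borel T) -> \bar R}.
Hypothesis mu_vol : is_riemannian_volume g mu.
Hypothesis cT : compact [set: T].

Lemma volume_lty : (mu [set: T] < +oo)%E.
Proof.
by have [lam lamP muP] := mu_vol; exact: (riemannian_measure_lty lamP muP cT).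
Qed.

Lemma smooth_integrable u : smooth_fun M u -> mu.-integrable setT (EFin \o u).
Proof.
move=> /smooth_fun_continuous cu.
by apply: continuous_integrable; [exact: cT|exact: volume_lty|exact: cu].
Qed.

(** Let w be the density in the chart i and X^a the components of X. In
    coordinates the left-hand side is the sum over a of the integrals of (d_a
    u) X^a b w. Integration by parts moves d_a to the other factors, which
    gives psi = - w^-1 * sum_a d_a (X^a b w), extended by zero. *)
Lemma local_transpose (X : vector_field M) (i : atlas_idx M) (b : T -> R) :
  smooth_fun M b -> chart_supported i b ->
  exists2 psi, smooth_fun M psi & forall u, smooth_fun M u ->
    \int[mu]_x (vf_apply X u x * b x) = \int[mu]_x (u x * psi x).
Proof.
move=> sb [K [cK Ki bK]]; have [lam lamP muP] := mu_vol.
have oi := @chart_cod_open _ _ _ (M i).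
have clK : closed K by apply: compact_closed => //; exact: norm_hausdorff.
have [N [_ KN]] := compact_bounded cK.
have {}KN y : N + 1 < `|y| -> ~ K y.
  move=> Ny Ky; have := KN (N + 1); rewrite ltrDl ltr01 => /(_ isT y Ky) /=.
  by rewrite leNgt Ny.
pose c := @chart_cod _ _ _ (M i); pose s := chart_inv (M i).
pose W (a : 'I_n) := (b \o s) * ((fun y => vf_comp X i y 0 a) * density g i).
have CW a m : Ck m c (W a).
  apply: CkM => //; first by have /smooth_funP := sb; exact.
  apply: CkM => //; last exact: Ck_density.
  by move: m; apply/smooth_onP; exact: vf_smooth.
have b0 y : c y -> ~ K y -> b (s y) = 0.
  move=> cy nKy; apply/eqP; apply: contra_notT nKy => /bK[_].
  by rewrite /s chart_invK.
have W0 a y : c y -> ~ K y -> W a y = 0.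
  by move=> cy nKy; rewrite /W !fctE /= b0// mul0r.
have nearK y : ~ K y -> \near y, ~ K y.
  by move=> nKy; apply: open_nbhs_nbhs; split => //; exact: closed_openC.
have DW0 a y : c y -> ~ K y -> 'D_(basis_vec R a) (W a) y = 0.
  move=> cy nKy; rewrite (@near_eq_derive _ _ _ _ (cst 0)) ?derive_cst//.
  near=> z; apply: W0; near: z; first exact: near_chart_cod.
  exact: nearK.
(* the expression in the chart of the function psi to be found *)
pose Psi := cst (-1) * ((fun y => (density g i y)^-1) *
  \sum_a 'D_(basis_vec R a) (W a)).
have CPsi m : Ck m c Psi.
  apply: CkM => //; first exact: Ck_cst.
  apply: CkM => //.
    apply: CkV => //; last exact: Ck_density.
    by move=> y cy; rewrite gt_eqF//; exact: density_gt0.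
  by apply: Ck_sum => // a; have /CkSE[_] := CW a m.+1; exact.
exists (chart_ext i Psi).
  apply: (chart_ext_smooth cK Ki CPsi) => y cy nKy.
  by rewrite /Psi !fctE fct_sumE big1 ?mulr0// => a _; exact: DW0.
move=> u su.
have sX := vf_apply_smooth X su.
have sPsi : smooth_fun M (chart_ext i Psi).
  apply: (chart_ext_smooth cK Ki CPsi) => y cy nKy.
  by rewrite /Psi !fctE fct_sumE big1 ?mulr0// => a _; exact: DW0.
apply/eqP; rewrite -subr_eq0; apply/eqP.
rewrite -RintegralB//; last 2 first.
- by apply: smooth_integrable; exact: smooth_funM.
- by apply: smooth_integrable; exact: smooth_funM.
pose H x := vf_apply X u x * b x - u x * chart_ext i Psi x.
have sH : smooth_fun M H by apply: smooth_funB; exact: smooth_funM.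
(* the function u X^a b w of the coordinates, extended by zero to all of
   R^n, to which the vanishing of the integral of a partial derivative
   applies *)
pose Phi a y := if `[< c y >] then u (s y) * W a y else 0.
have Phi0 a y : ~ K y -> Phi a y = 0.
  move=> nKy; rewrite /Phi; case: ifPn => // /asboolP cy.
  by rewrite W0// mulr0.
have PhiE a y : c y -> Phi a y = ((u \o s) * W a) y.
  by move=> cy; rewrite /Phi asboolT.
have CPhi a m : Ck m setT (Phi a).
  apply: Ck_local => y _; have [cy|ncy] := pselect (c y).
    exists c => //; apply: (@Ck_ext _ _ _ _ ((u \o s) * W a)) => //.
      by move=> z /set_mem cz; rewrite PhiE.
    by apply: CkM => //; have /smooth_funP := su; exact.
  exists (~` K); first by move=> /Ki.
  apply: (@Ck_ext _ _ _ _ (cst 0)); first exact: closed_openC.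
    by move=> z /set_mem nKz; rewrite Phi0.
  exact: Ck_cst.
have DPhi0 a y : ~ K y -> 'D_(basis_vec R a) (Phi a) y = 0.
  move=> nKy; rewrite (@near_eq_derive _ _ _ _ (cst 0)) ?derive_cst//.
  by apply: filterS (nearK _ nKy) => z; exact: Phi0.
rewrite (@Rintegral_chart _ _ _ _ _ _ _ muP i H); last 2 first.
- exact: continuous_borel (smooth_fun_continuous sH).
- move=> x nix; rewrite /H; have -> : b x = 0.
    by apply/eqP; apply: contra_notT nix => /bK[].
  by rewrite /chart_ext asboolF// !mulr0 subr0.
(* the product rule turns the difference H of the two integrands into a
   divergence *)
have -> : \int[lam]_(y in c) (H (s y) * density g i y) =
    \int[lam]_y (\sum_a 'D_(basis_vec R a) (Phi a) y).
  rewrite Rintegral_mkcond; apply: eq_Rintegral => y _; rewrite /restrict.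
  case: ifPn => [/set_mem cy|]; last first.
    rewrite notin_setE => ncy; rewrite big1// => a _; apply: DPhi0.
    by move=> /Ki.
  have du : differentiable (u \o s) y by exact: smooth_fun_diff.
  have DPhi a : 'D_(basis_vec R a) (Phi a) y =
      u (s y) * 'D_(basis_vec R a) (W a) y + W a y * 'D_(basis_vec R a) (u \o s) y.
    rewrite (@near_eq_derive _ _ _ _ ((u \o s) * W a)).
      rewrite deriveM//; apply: diff_derivable => //; exact: Ck_diff (CW a 0%N) cy.
    by apply: filterS (near_chart_cod cy) => z; exact: PhiE.
  under eq_bigr do rewrite DPhi.
  rewrite big_split/= -mulr_sumr /H vf_apply_coord// chart_ext_inv//.
  have w0 : density g i y != 0 by rewrite gt_eqF// density_gt0.
  rewrite mulrBl [RHS]addrC; congr (_ + _).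
    rewrite !mulr_suml; apply: eq_bigr => a _; rewrite /W !fctE /=; ring.
  rewrite /Psi !fctE fct_sumE mulN1r mulrN mulNr opprK -mulrA; congr (_ * _).
  by rewrite mulrAC mulVf// mul1r.
rewrite Rintegral_sum.
  apply: big1 => a _; apply: (integral_partial_eq0 lamP a (CPhi a 1%N) (N := N + 1)).
  by move=> y /KN; exact: Phi0.
move=> a; apply: (integrable_compact_support lamP (N := N + 1)).
  move=> y; apply: differentiable_continuous.
  by have /CkSE[_ /(_ a) /Ck_diff] := CPhi a 1%N; exact.
by move=> y /KN; exact: DPhi0.
Unshelve. all: by end_near. Qed.

(** A partition of unity reduces this to test functions supported in one
    chart. *)
Lemma vf_transpose (X : vector_field M) psi : smooth_fun M psi ->
  exists2 psi', smooth_fun M psi' & forall u, smooth_fun M u ->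
    \int[mu]_x (vf_apply X u x * psi x) = \int[mu]_x (u x * psi' x).
Proof.
move=> spsi.
have [N [chi [idx [schi cchi chi1]]]] := partition_of_unity M cT.
have sb a : smooth_fun M (fun x => chi a x * psi x) by exact: smooth_funM.
have cb a : chart_supported (idx a) (fun x => chi a x * psi x).
  have [K [cK Ki bK]] := cchi a; exists K; split => // x cx; apply: bK.
  by apply: contraNneq cx => ->; rewrite mul0r.
have /choice[q qP] a : exists q, smooth_fun M q /\ forall u, smooth_fun M u ->
    \int[mu]_x (vf_apply X u x * (chi a x * psi x)) = \int[mu]_x (u x * q x).
  by have [q sq qP] := local_transpose X (sb a) (cb a); exists q.
exists (fun x => \sum_a q a x); first by apply: smooth_fun_sum => a; have [] := qP a.
move=> u su; have sX := vf_apply_smooth X su.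
transitivity (\int[mu]_x (\sum_a (vf_apply X u x * (chi a x * psi x)))).
  apply: eq_Rintegral => x _.
  by rewrite -mulr_sumr -mulr_suml chi1 mul1r.
rewrite Rintegral_sum; last first.
  by move=> a; apply: smooth_integrable; exact: smooth_funM.
transitivity (\int[mu]_x (\sum_a (u x * q a x))); last first.
  by apply: eq_Rintegral => x _; rewrite mulr_sumr.
rewrite Rintegral_sum; last first.
  by move=> a; apply: smooth_integrable; apply: smooth_funM => //; have [] := qP a.
by apply: eq_bigr => a _; have [_ ->] := qP a.
Qed.

End Divergence.

(** * Smooth functions separate integrable functions *)

Section SmoothApproximation.
Context (R : realType) (n : nat) (T : ptopologicalType).
Variable M : smooth_manifold R n T.

Lemma ramp_le (x y : R) : x <= y -> ramp x <= ramp y.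
Proof.
move=> xy; have [x0|x0] := ltP 0 x; last by rewrite ramp_eq0// ramp_ge0.
have y0 := lt_le_trans x0 xy.
rewrite /ramp /flat x0 y0 !hornerC !mul1r ler_expR lerN2.
by rewrite lef_pV2// posrE.
Qed.

(** Each point of O has a bump supported in O, which is positive on some
    member of a countable base containing the point; one bump is chosen for
    each member for which there is any. *)
Lemma open_bump_cover (O : set T) : open O ->
  exists b : nat -> T -> R, [/\ forall k, smooth_fun M (b k),
    forall k x, 0 <= b k x, forall k x, b k x != 0 -> O x &
    forall x, O x -> exists k, 0 < b k x].
Proof.
move=> oO; have [B cB [Bo Bb]] := manifold_second_countable M.
pose good (U : set T) (b : T -> R) := [/\ smooth_fun M b, forall x, 0 <= b x,
  forall x, b x != 0 -> O x & forall x, U x -> 0 < b x].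
pose D := [set U | B U /\ exists b, good U b].
have cD : countable D by apply: sub_countable cB; apply: subset_card_le => U [].
have cover x : O x -> exists2 U, D U & U x.
  move=> Ox; have [b [sb _ b0 bx bO]] := bump_exists oO Ox (at_chart_dom M x).
  have oP : open [set z | 0 < b z].
    apply: (@open_comp _ _ b [set r | 0 < r]) => [z _|]; last exact: open_gt.
    exact: (smooth_fun_continuous sb).
  have [U [BU Ux] UP] := Bb x _ (open_nbhs_nbhs (conj oP bx)).
  by exists U => //; split => //; exists b.
have [D0|D0] := pselect (D !=set0); last first.
  exists (fun _ => cst 0); split => //.
  - by move=> _; exact: smooth_fun_cst.
  - by move=> k x; rewrite /cst eqxx.
  - by move=> x /cover[U DU _]; exfalso; apply: D0; exists U.
have /pfcard_geP[D0'|[f]] := cD.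
  by have [U DU] := D0; rewrite D0' in DU.
have /choice[b bP] k : exists b, good (f k) b by have [_] := @funS _ _ _ _ f k I.
exists b; split.
- by move=> k; have [] := bP k.
- by move=> k; have [] := bP k.
- by move=> k; have [] := bP k.
- move=> x /cover[U DU Ux]; have [k _ fk] := @surj _ _ _ _ f _ DU.
  by exists k; have [_ _ _] := bP k; apply; rewrite fk.
Qed.

(** With the bumps b_k of [open_bump_cover], ramp (N (b_0 + ... + b_(N-1)))
    tends to 1 where some b_k is positive, that is on O, and is 0 elsewhere. *)
Lemma smooth_approx_open (O : set T) : open O ->
  exists e : nat -> T -> R, [/\ forall k, smooth_fun M (e k),
    forall k x, 0 <= e k x <= 1 &
    forall x, (fun k => e k x) @ \oo --> (\1_O x : R)].
Proof.
move=> oO; have [b [sb b0 bO Ob]] := open_bump_cover oO.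
pose S N x := \sum_(k < N) b k x.
have SO N x : S N x != 0 -> O x.
  apply: contra_neqP => nOx; rewrite /S big1// => k _; apply/eqP.
  by apply: contra_notT nOx; exact: bO.
exists (fun N x => ramp (N.+1%:R * S N x)); split.
- by move=> N; apply: smooth_fun_ramp; apply: smooth_funZ; exact: smooth_fun_sum.
- by move=> N x; rewrite ramp_ge0 ramp_le1.
move=> x; rewrite indicE; case: (boolP (x \in O)) => [/set_mem Ox|/negP xO].
  have [k bk] := Ob _ Ox; have := @cvg_ramp R (b k x); rewrite bk => c1.
  have h : \forall N \near \oo, ramp (N.+1%:R * b k x) <=
      ramp (N.+1%:R * S N x) <= (cst 1 : nat -> R) N.
    near=> N; rewrite ramp_le1 andbT; apply: ramp_le; rewrite ler_wpM2l//.
    have kN : (k < N)%N by near: N; exists k.+1.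
    rewrite /S (bigD1 (Ordinal kN))//= lerDl.
    by apply: sumr_ge0.
  exact: (squeeze_cvgr h c1 (cvg_cst (1 : R))).
rewrite (_ : (fun k => _) = cst 0); first exact: cvg_cst.
apply/funext => N; rewrite ramp_eq0//.
have -> : S N x = 0 by apply/eqP; apply: contra_notT xO => /SO /mem_set.
by rewrite mulr0.
Unshelve. all: by end_near. Qed.

End SmoothApproximation.

Lemma Rintegral_dominated_mul d (T : measurableType d) (R : realType)
    (mu : {measure set T -> \bar R}) (v : T -> R) (e_ : nat -> T -> R) (e : T -> R) :
  mu.-integrable setT (EFin \o v) ->
  (forall k, measurable_fun setT (e_ k)) -> measurable_fun setT e ->
  (forall k x, `|e_ k x| <= 1) -> (forall x, (fun k => e_ k x) @ \oo --> e x) ->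
  (fun k => \int[mu]_x (v x * e_ k x)) @ \oo --> \int[mu]_x (v x * e x).
Proof.
move=> iv me_ me e1 ee; have mv := integrableR_measurable iv.
have ae1 : {ae mu, forall x, (fun k => v x * e_ k x) @ \oo --> v x * e x}.
  by apply: aeW => x; apply: cvgM; [exact: cvg_cst|exact: ee].
have ae2 : {ae mu, forall x, forall k, `|v x * e_ k x| <= `|v x|}.
  by apply: aeW => x k; rewrite normrM ler_piMr.
by have [] := Rintegral_dominated (fun k => measurable_funM mv (me_ k))
  (measurable_funM mv me) ae1 (integrableR_norm iv) ae2.
Qed.

Section FundamentalLemma.
Context (R : realType) (n : nat) (T : ptopologicalType).
Variables (M : smooth_manifold R n T).
Variable mu : {measure set (borel T) -> \bar R}.

(** The indicator of O is a bounded pointwise limit of smooth functions. *)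
Lemma integral_open_eq0 (v : T -> R) : mu.-integrable setT (EFin \o v) ->
  (forall psi, smooth_fun M psi -> \int[mu]_x (v x * psi x) = 0) ->
  forall O, open O -> \int[mu]_x (v x * \1_O x) = 0.
Proof.
move=> iv v0 O oO; have [e [se e01 eO]] := smooth_approx_open M oO.
have mv := integrableR_measurable iv.
have me k : measurable_fun setT (e k : borel T -> R).
  by apply: continuous_borel; exact: smooth_fun_continuous (se k).
have mO : measurable (O : set (borel T)) by exact: open_borel.
have e1 k x : `|e k x| <= 1 by have /andP[e0 ?] := e01 k x; rewrite ger0_norm.
have h := Rintegral_dominated_mul iv me (measurable_indic mO) e1 eO.
rewrite (_ : (fun k => _) = cst 0) in h.
  by have := cvg_unique _ (cvg_cst (0 : R)) h => ->.
by apply/funext => k; exact: v0.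
Qed.

(** The sets over which v has integral zero form a lambda-system. It contains
    the open sets, which are stable under intersection, hence all Borel sets;
    and a function with integral zero over every measurable set vanishes
    almost everywhere. *)
Lemma fundamental_lemma (v : T -> R) : mu.-integrable setT (EFin \o v) ->
  (forall psi, smooth_fun M psi -> \int[mu]_x (v x * psi x) = 0) ->
  {ae mu, forall x, v x = 0}.
Proof.
move=> iv v0; have mv := integrableR_measurable iv.
pose H := [set A : set (borel T) | measurable A /\ \int[mu]_x (v x * \1_A x) = 0].
have iA (A : set (borel T)) : measurable A ->
    mu.-integrable setT (EFin \o (fun x => v x * \1_A x)).
  move=> mA; apply: (integrableR_le _ (integrableR_norm iv)).
  - by apply: measurable_funM => //; exact: measurable_indic.
  - by move=> x; rewrite normrM ler_piMr// indicE; case: (_ \in _); rewrite ?normr1 ?normr0.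
have HT : lambda_system setT H.
  split => //.
  - split; first exact: measurableT.
    under eq_Rintegral do rewrite indicT mulr1.
    have := v0 (cst 1) (@smooth_fun_cst _ _ _ M 1).
    by under eq_Rintegral do rewrite mulr1.
  - move=> A B BA [mA A0] [mB B0]; split; first exact: measurableD.
    rewrite (_ : (fun x => _) = (fun x => v x * \1_A x - v x * \1_B x)).
      by rewrite RintegralB ?A0 ?B0 ?subr0//; exact: iA.
    apply/funext => x; rewrite -mulrBr; congr (_ * _); rewrite !indicE in_setD.
    case: (boolP (x \in B)) => [/set_mem /BA xA|_]; last by rewrite subr0 andbT.
    by rewrite (mem_set xA) subrr.
  - move=> F ndF HF; have mF k : measurable (F k) by have [] := HF k.
    have mUF : measurable (\bigcup_k F k) by exact: bigcup_measurable.
    split => //.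
    have i1 (A : set (borel T)) x : `|(\1_A x : R)| <= 1.
      by rewrite indicE; case: (_ \in _); rewrite ?normr1 ?normr0.
    have cF x : (fun k => (\1_(F k) x : R)) @ \oo --> (\1_(\bigcup_k F k) x : R).
      rewrite [X in _ --> X]indicE; case: (boolP (x \in _)) => [/set_mem[k _ Fk]|].
        apply: cvg_near_cst; near=> m; rewrite indicE mem_set//.
        have /subsetPset : (F k <= F m)%O by apply: ndF; near: m; exists k.
        exact.
      rewrite notin_setE => nF; apply: cvg_near_cst; near=> m.
      by rewrite indicE memNset// => Fm; apply: nF; exists m.
    have h := Rintegral_dominated_mul iv (fun k => measurable_indic (mF k))
      (measurable_indic mUF) (fun k => i1 (F k)) cF.
    rewrite (_ : (fun k => _) = cst 0) in h.
      by have := cvg_unique _ (cvg_cst (0 : R)) h => ->.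
    by apply/funext => k; have [] := HF k.
have HO : [set A | open A] `<=` H.
  move=> O oO; split; first exact: open_borel.
  exact: integral_open_eq0.
have Hall (A : set (borel T)) : measurable A -> \int[mu]_x (v x * \1_A x) = 0.
  move=> mA; have [] // := @lambda_system_subset _ _ _ _ _ HT HO _ A mA.
  by move=> A' B'; exact: openI.
have : ae_eq mu setT (EFin \o v) (cst 0%E).
  apply: integral_ae_eq => // E _ mE.
  rewrite integral0 integral_mkcond.
  rewrite (_ : _ \_ E = EFin \o (fun x => v x * \1_E x)).
    have iE := iA _ mE.
    by rewrite -[LHS]fineK ?(integrable_fin_num _ iE)//; congr (_%:E); exact: Hall.
  apply/funext => x; rewrite /restrict /= indicE.
  by case: (x \in E); rewrite ?mulr1 ?mulr0.
by apply: filterS => x /(_ I) /= [].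
Unshelve. all: by end_near. Qed.

End FundamentalLemma.

(** * Completeness of L^1 *)

Section L1Complete.
Context d (T : measurableType d) (R : realType) (mu : {measure set T -> \bar R}).
Local Notation integrableR f := (mu.-integrable setT (EFin \o f)).
Implicit Types (f u v w : T -> R).

Lemma EFin_Rintegral f : integrableR f ->
  ((\int[mu]_x f x)%:E = \int[mu]_x (f x)%:E)%E.
Proof. by move=> iF; rewrite /Rintegral fineK//; exact: integrable_fin_num. Qed.

Lemma Rintegral_norm_triangle u v w : integrableR u -> integrableR v ->
  integrableR w -> \int[mu]_x `|u x - w x| <=
  \int[mu]_x `|u x - v x| + \int[mu]_x `|v x - w x|.
Proof.
move=> iu iv iw.
have i1 := integrableR_norm (integrableRB iu iw).
have i2 := integrableR_norm (integrableRB iu iv).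
have i3 := integrableR_norm (integrableRB iv iw).
rewrite -RintegralD//; apply: le_Rintegral => //; first exact: integrableRD.
by move=> x _; exact: ler_distD.
Qed.

(** The series S of the |u_(m+1) - u_m| is integrable, hence finite almost
    everywhere. Where it is finite the sequence converges, and |u_0| + S
    dominates it. *)
Lemma fast_cauchy_cvg (u_ : nat -> T -> R) : (forall m, integrableR (u_ m)) ->
  (forall m, \int[mu]_x `|u_ m.+1 x - u_ m x| <= 1 / (2 ^ (m + 1))%:R) ->
  exists2 f, integrableR f & (fun m => \int[mu]_x `|u_ m x - f x|) @ \oo --> (0 : R).
Proof.
move=> iu uP.
pose D m x := `|u_ m.+1 x - u_ m x|.
have D0 m x : 0 <= D m x by exact: normr_ge0.
have iD m : integrableR (D m) by exact/integrableR_norm/integrableRB.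
have mD m := integrableR_measurable (iD m).
pose S x := (\sum_(0 <= m <oo) (D m x)%:E)%E.
have mS : measurable_fun setT S.
  apply: ge0_emeasurable_sum => [m x _ _|m _]; first by rewrite lee_fin.
  exact/measurable_EFinP.
have S0 x : (0 <= S x)%E by apply: nneseries_ge0 => m _ _; rewrite lee_fin.
have iS : mu.-integrable setT S.
  apply/integrableP; split => //.
  under eq_integral do rewrite gee0_abs//.
  rewrite integral_nneseries; [|exact: measurableT|by move=> m; exact/measurable_EFinP|
    by move=> m x _; rewrite lee_fin].
  apply: (@le_lt_trans _ _ (\sum_(0 <= m <oo) ((1 : R) / (2 ^ (m + 1))%:R)%:E)%E).
    apply: lee_nneseries => [m _ _|m _].
      by apply: integral_ge0 => x _; rewrite lee_fin.
    by rewrite -EFin_Rintegral// lee_fin; exact: uP.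
  have c1 := @cvg_geometric_eseries_half R 1 0.
  by rewrite (cvg_lim _ c1)// ltry.
pose E := [set x | (S x < +oo)%E].
have mE : measurable E.
  have := measurable_lte measurableT mS (measurable_cst (+oo%E : \bar R)).
  by rewrite setTI.
have ES x : E x -> S x = (fine (S x))%:E.
  by move=> Ex; rewrite fineK// ge0_fin_numE.
have aeE : {ae mu, forall x, E x}.
  have := integrable_ae measurableT iS; apply: filterS => x /(_ I) xf.
  by rewrite /E /= -ge0_fin_numE.
(* u_ m cut off to the set E where S is finite, so that the sequence
   converges everywhere and its limit is measurable *)
pose h m x := u_ m x * \1_E x.
have psum m x : E x -> \sum_(k < m) D k x <= fine (S x).
  move=> Ex; rewrite -lee_fin -ES// -sumEFin.
  rewrite -(big_mkord xpredT (fun k => (D k x)%:E)).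
  by apply: nneseries_lim_ge => k _ _; rewrite lee_fin.
have hS m x : `|h m x| <= (`|u_ 0%N x| + fine (S x)) * \1_E x.
  rewrite /h normrM indicE; case: (boolP (x \in E)) => [/set_mem Ex|_]; last first.
    by rewrite normr0 !mulr0.
  rewrite normr1 !mulr1.
  have -> : u_ m x = u_ 0%N x + \sum_(k < m) (u_ k.+1 x - u_ k x).
    elim: (m) => [|k ih]; first by rewrite big_ord0 addr0.
    by rewrite big_ord_recr/= addrA -ih addrCA subrr addr0.
  rewrite (le_trans (ler_normD _ _))// lerD2l.
  by rewrite (le_trans (ler_norm_sum _ _ _))// psum.
have uE x : E x -> (fun m => h m x) = (fun m => u_ m x).
  by move=> Ex; apply/funext => m; rewrite /h indicE mem_set// mulr1.
have hcvg x : cvgn (fun m => h m x).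
  have [Ex|nEx] := pselect (E x); last first.
    rewrite (_ : (fun m => _) = cst 0); first exact: is_cvg_cst.
    by apply/funext => m; rewrite /h indicE memNset// mulr0.
  rewrite (uE _ Ex).
  have ct : cvgn (series (telescope (fun m => u_ m x))).
    apply: normed_cvg; apply: nondecreasing_is_cvgn.
      by apply: nondecreasing_series => k _ _; exact: normr_ge0.
    exists (fine (S x)) => _ [m _ <-] /=; rewrite seriesEord.
    exact: psum.
  rewrite telescopeK in ct.
  rewrite (_ : (fun m => _) = (fun m => (u_ m x - u_ 0%N x) + u_ 0%N x)).
    by apply: is_cvgD => //; exact: is_cvg_cst.
  by apply/funext => m; rewrite subrK.
pose f x := limn (fun m => h m x).
have mu_ m := integrableR_measurable (iu m).
have mh m : measurable_fun setT (h m).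
  by apply: measurable_funM => //; exact: measurable_indic.
have mf : measurable_fun setT f.
  by apply: (measurable_fun_cvg mh) => x _; exact: hcvg.
pose G x := (`|u_ 0%N x| + fine (S x)) * \1_E x.
have mG : measurable_fun setT G.
  apply: measurable_funM; last exact: measurable_indic.
  apply: measurable_funD; first exact: measurableT_comp.
  exact: (measurableT_comp (fine_measurable measurableT) mS).
have iG : integrableR G.
  apply: (@le_integrable _ _ _ _ _ measurableT _ (fun x => (`|u_ 0%N x|)%:E + S x)%E).
  - exact/measurable_EFinP.
  - move=> x _; rewrite /= /G indicE; case: (boolP (x \in E)) => [/set_mem Ex|_].
      rewrite mulr1 (ES _ Ex) -EFinD lee_fin; exact: lexx.
    by rewrite mulr0 normr0 abse_ge0.
  - by apply: integrableD => //; exact: integrableR_norm.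
have ae1 : {ae mu, forall x, (fun m => u_ m x) @ \oo --> f x}.
  by apply: filterS aeE => x Ex; rewrite -(uE _ Ex); exact: hcvg.
have ae2 : {ae mu, forall x, forall m, `|u_ m x| <= G x}.
  apply: filterS aeE => x Ex m; have := hS m x.
  by rewrite -[u_ m x]/((fun m => u_ m x) m) -(uE _ Ex).
have [iff cf _] := Rintegral_dominated mu_ mf ae1 iG ae2.
by exists f.
Qed.

(** A Cauchy sequence has a subsequence to which [fast_cauchy_cvg] applies,
    and it has the same limit as that subsequence. *)
Lemma L1_complete (u_ : nat -> T -> R) : (forall m, integrableR (u_ m)) ->
  (forall e : R, 0 < e -> exists N, forall p q, (N <= p)%N -> (N <= q)%N ->
     \int[mu]_x `|u_ p x - u_ q x| <= e) ->
  exists2 f, integrableR f & (fun m => \int[mu]_x `|u_ m x - f x|) @ \oo --> (0 : R).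
Proof.
move=> iu uC.
have /choice[N NP] k : exists N, forall p q, (N <= p)%N -> (N <= q)%N ->
    \int[mu]_x `|u_ p x - u_ q x| <= 1 / (2 ^ (k + 1))%:R by apply: uC; rewrite divr_gt0// ltr0n expn_gt0.
pose s k := (k + \max_(j < k.+1) N j)%N.
have sk k : (k <= s k)%N by rewrite leq_addr.
have sN k j : (j <= k)%N -> (N j <= s k)%N.
  move=> jk; rewrite /s (leq_trans _ (leq_addl _ _))//.
  exact: (@leq_bigmax _ (fun j : 'I_k.+1 => N j) (Ordinal (jk : (j < k.+1)%N))).
have [f iff fP] := @fast_cauchy_cvg (fun k => u_ (s k)) (fun k => iu _)
  (fun k => NP k _ _ (sN k.+1 k (leqnSn k)) (sN k k (leqnn k))).
exists f => //; apply/cvgr0Pnorm_le => e e0.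
have e2 : 0 < e / 2 by rewrite divr_gt0.
have [N0 N0P] := uC _ e2.
move/cvgr0Pnorm_le : fP => /(_ _ e2) [N1 _ N1P].
near=> m; rewrite ger0_norm; last by apply: Rintegral_ge0.
pose k := maxn N0 N1.
apply: (le_trans (Rintegral_norm_triangle (iu m) (iu (s k)) iff)).
rewrite (splitr e) lerD//.
  apply: N0P; first by near: m; exists N0.
  by rewrite (leq_trans _ (sk k))// leq_maxl.
by apply: le_trans (N1P k _); [exact: ler_norm|rewrite /= leq_maxr].
Unshelve. all: by end_near. Qed.

End L1Complete.

(** * Weak derivatives *)

Section AlmostEverywhere.
Context d (T : measurableType d) (R : realType) (mu : {measure set T -> \bar R}).
Implicit Types f g : T -> R.

(** This and the next two lemmas are [filterS], [filterS2] and [filter_forall]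
    for the filter of an almost-everywhere statement, stated for an arbitrary
    measurable type so that they apply by unification to Borel types. *)
Lemma ae_mono (P Q : T -> Prop) : (forall x, P x -> Q x) ->
  {ae mu, forall x, P x} -> {ae mu, forall x, Q x}.
Proof. by move=> PQ; apply: filterS. Qed.

Lemma ae_mono2 (P Q S : T -> Prop) : (forall x, P x -> Q x -> S x) ->
  {ae mu, forall x, P x} -> {ae mu, forall x, Q x} -> {ae mu, forall x, S x}.
Proof. by move=> PQS; apply: filterS2. Qed.

Lemma ae_forall (I : finType) (P : I -> T -> Prop) :
  (forall a, {ae mu, forall x, P a x}) -> {ae mu, forall x, forall a, P a x}.
Proof. by move=> aeP; apply: filter_forall. Qed.

Lemma Rintegral_ae f g : measurable_fun setT f -> measurable_fun setT g ->
  {ae mu, forall x, f x = g x} -> \int[mu]_x f x = \int[mu]_x g x.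
Proof.
move=> mf mg fg; rewrite /Rintegral; congr fine; apply: ae_eq_integral => //.
- exact/measurable_EFinP.
- exact/measurable_EFinP.
- by apply: filterS fg => x /= -> _.
Qed.

Lemma Rintegral_norm_eq0 f : mu.-integrable setT (EFin \o f) ->
  \int[mu]_x `|f x| = 0 -> {ae mu, forall x, f x = 0}.
Proof.
move=> iF F0.
have h : (\int[mu]_(x in setT) `|(EFin \o f) x| = 0)%E.
  by rewrite -(EFin_Rintegral (integrableR_norm iF)) F0.
have mf : measurable_fun setT (EFin \o f) := measurable_int _ iF.
have /(ae_eq_integral_abs mu measurableT mf) := h.
by apply: filterS => x /(_ I) /= [].
Qed.

End AlmostEverywhere.

Section IteratedFields.
Context (R : realType) (n : nat) (T : ptopologicalType).
Variables (M : smooth_manifold R n T).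
Implicit Types (Ys : seq (vector_field M)) (u v : T -> R).

Definition fields_apply Ys u : T -> R := foldr (fun Y v => vf_apply Y v) u Ys.

Lemma fields_apply_smooth Ys u : smooth_fun M u -> smooth_fun M (fields_apply Ys u).
Proof. by elim: Ys => //= Y Ys ih /ih; exact: vf_apply_smooth. Qed.

Lemma fields_apply_lin Ys (a : R) u v : smooth_fun M u -> smooth_fun M v ->
  fields_apply Ys (fun x => a * u x + v x) =
  (fun x => a * fields_apply Ys u x + fields_apply Ys v x).
Proof.
move=> su sv; elim: Ys => //= Y Ys ->; apply/funext => x.
rewrite vf_applyD ?vf_applyZ//; do ?exact: fields_apply_smooth.
by apply: smooth_funZ; exact: fields_apply_smooth.
Qed.

(** The word in the vector fields that D^al applies. Writing the nested
    iterations of classical_D as the action of a single list makes properties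
    of D^al follow by induction on a list. *)
Definition mindex_fields k l (X : 'I_l -> vector_field M) (al : mindex k l) :=
  [seq X i | i <- flatten [seq nseq (al i) i | i <- enum 'I_l]].

Lemma classical_DE k l (X : 'I_l -> vector_field M) (al : mindex k l) u :
  classical_D X al u = fields_apply (mindex_fields X al) u.
Proof.
rewrite /classical_D /mindex_fields; elim: (enum _) => //= i s ->.
rewrite map_cat map_nseq /fields_apply foldr_cat; move: (foldr _ u _) => v.
by elim: (nat_of_ord (al i)) => //= m ->.
Qed.

Lemma classical_D_smooth k l (X : 'I_l -> vector_field M) (al : mindex k l) u :
  smooth_fun M u -> smooth_fun M (classical_D X al u).
Proof. by rewrite classical_DE; exact: fields_apply_smooth. Qed.

Lemma classical_DB k l (X : 'I_l -> vector_field M) (al : mindex k l) u v :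
  smooth_fun M u -> smooth_fun M v ->
  classical_D X al (fun x => u x - v x) =
  (fun x => classical_D X al u x - classical_D X al v x).
Proof.
move=> su sv; rewrite !classical_DE.
rewrite (_ : (fun x => u x - v x) = (fun x => (-1) * v x + u x)); last first.
  by apply/funext => x; rewrite mulN1r addrC.
by rewrite fields_apply_lin//; apply/funext => x; rewrite mulN1r addrC.
Qed.

Variables (g : riemannian_metric M) (mu : {measure set (borel T) -> \bar R}).
Hypotheses (mu_vol : is_riemannian_volume g mu) (cT : compact [set: T]).

(** The transpose of a composite is the composite of the transposes in the
    opposite order. *)
Lemma fields_transpose Ys psi : smooth_fun M psi ->
  exists2 psi', smooth_fun M psi' & forall u, smooth_fun M u ->
    \int[mu]_x (fields_apply Ys u x * psi x) = \int[mu]_x (u x * psi' x).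
Proof.
elim: Ys psi => [|Y Ys ih] psi spsi; first by exists psi.
have [psi1 s1 P1] := vf_transpose mu_vol cT Y spsi.
have [psi2 s2 P2] := ih _ s1.
by exists psi2 => // u su; rewrite /= P1 ?P2//; exact: fields_apply_smooth.
Qed.

Lemma transpose_D_exists k l (X : 'I_l -> vector_field M) (al : mindex k l) psi :
  smooth_fun M psi -> exists2 psi', smooth_fun M psi' & transpose_D mu X al psi psi'.
Proof.
move=> /(fields_transpose (mindex_fields X al))[psi' s' P'].
by exists psi' => // u su; rewrite classical_DE; exact: P'.
Qed.

End IteratedFields.

Section WeakDerivatives.
Context (R : realType) (n : nat) (T : ptopologicalType).
Variables (M : smooth_manifold R n T) (cT : compact [set: T]).
Variables (g : riemannian_metric M) (mu : {measure set (borel T) -> \bar R}).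
Hypothesis mu_vol : is_riemannian_volume g mu.
Context (k l : nat) (X : 'I_l -> vector_field M).
Implicit Types (al : mindex k l) (f h u v : T -> R).
Local Notation integrableR f := (mu.-integrable setT (EFin \o f)).

Lemma smooth_bounded u : smooth_fun M u -> exists C, forall x, `|u x| <= C.
Proof. by move=> /smooth_fun_continuous; exact: continuous_bounded. Qed.

Lemma smooth_measurable u : smooth_fun M u ->
  measurable_fun setT (u : borel T -> R).
Proof. by move=> /smooth_fun_continuous; exact: continuous_borel. Qed.

Lemma integrableR_smooth f psi : integrableR f -> smooth_fun M psi ->
  integrableR (fun x => f x * psi x).
Proof.
move=> iF spsi; have [C psiC] := smooth_bounded spsi.
have h := integrableRM (smooth_measurable spsi) iF psiC.
rewrite (_ : (fun x => f x * psi x) = (fun x => psi x * f x))//.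
by apply/funext => x; rewrite mulrC.
Qed.

Lemma L1_cvg_smooth (u_ : nat -> T -> R) f psi : (forall m, integrableR (u_ m)) ->
  integrableR f -> (fun m => \int[mu]_x `|u_ m x - f x|) @ \oo --> (0 : R) ->
  smooth_fun M psi ->
  (fun m => \int[mu]_x (u_ m x * psi x)) @ \oo --> \int[mu]_x (f x * psi x).
Proof.
move=> iu iF uf spsi; have [C psiC] := smooth_bounded spsi.
apply: integrable_cvg => [m||].
- exact: integrableR_smooth.
- exact: integrableR_smooth.
have h : (fun m => C * \int[mu]_x `|u_ m x - f x|) @ \oo --> (0 : R).
  by rewrite -(mulr0 C); apply: cvgMr.
apply: (squeeze_cvgr _ (cvg_cst (0 : R)) h); apply: nearW => m.
apply/andP; split; first by apply: Rintegral_ge0.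
rewrite -RintegralZl//; last exact/integrableR_norm/integrableRB.
apply: le_Rintegral => //.
- by apply: integrableR_norm; apply: integrableRB; exact: integrableR_smooth.
- by apply: integrableRZ; exact/integrableR_norm/integrableRB.
- by move=> x _; rewrite -mulrBl normrM mulrC ler_wpM2r.
Qed.

(** Every smooth psi has a transposed image under D^al, so v - v' is
    orthogonal to all smooth functions. *)
Lemma weak_D_unique al f v v' : weak_D mu X al f v -> weak_D mu X al f v' ->
  {ae mu, forall x, v x = v' x}.
Proof.
move=> [iv vP] [iv' vP'].
have := @fundamental_lemma _ _ _ M mu (fun x => v x - v' x) (integrableRB iv iv').
move=> h; have {}h : {ae mu, forall x, v x - v' x = 0}.
  apply: h => psi spsi.
  have [psi' s' P'] := transpose_D_exists mu_vol cT X al spsi.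
  under eq_Rintegral do rewrite mulrBl.
  rewrite RintegralB//; do ?exact: integrableR_smooth.
  by rewrite (vP psi psi')// (vP' psi psi')// subrr.
by apply: ae_mono h => x /eqP; rewrite subr_eq0 => /eqP.
Qed.

Lemma weak_D_ae al f f' v : integrableR f -> integrableR f' ->
  {ae mu, forall x, f x = f' x} -> weak_D mu X al f v -> weak_D mu X al f' v.
Proof.
move=> iF iF' ff' [iv vP]; split => // psi psi' s s' P'; rewrite (vP psi psi')//.
apply: Rintegral_ae.
- exact: integrableR_measurable (integrableR_smooth iF s').
- exact: integrableR_measurable (integrableR_smooth iF' s').
- by apply: ae_mono ff' => x ->.
Qed.

(** The equality holds everywhere: a weak derivative is tested by integrals
    against f, so f and f' have the same set of weak derivatives, from which
    Dw makes a choice depending on the set alone. *)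
Lemma Dw_ae al f f' : integrableR f -> integrableR f' ->
  {ae mu, forall x, f x = f' x} -> Dw mu X al f = Dw mu X al f'.
Proof.
move=> iF iF' ff'; rewrite /Dw; congr xget; apply/seteqP; split => v /=.
  exact: weak_D_ae.
by apply: weak_D_ae => //; apply: ae_mono ff' => x ->.
Qed.

Lemma Dw_weak al f v : weak_D mu X al f v -> weak_D mu X al f (Dw mu X al f).
Proof. by move=> fv; apply: (xgetPex (fun=> 0)) ; exists v. Qed.

Lemma weak_D_classical al u : smooth_fun M u -> weak_D mu X al u (classical_D X al u).
Proof.
move=> su; split => [|psi psi' s s' P'].
  by apply: (smooth_integrable mu_vol cT); exact: classical_D_smooth.
exact: P'.
Qed.

Lemma weak_D_lin al (a : R) f v h z : integrableR f -> integrableR h ->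
  weak_D mu X al f v -> weak_D mu X al h z ->
  weak_D mu X al (fun x => a * f x + h x) (fun x => a * v x + z x).
Proof.
move=> iF ih [iv vP] [iz zP]; split; first exact/integrableRD/iz/integrableRZ.
move=> psi psi' s s' P'.
have E (p q r : T -> R) : integrableR p -> integrableR q -> smooth_fun M r ->
    \int[mu]_x ((a * p x + q x) * r x) =
    a * \int[mu]_x (p x * r x) + \int[mu]_x (q x * r x).
  move=> ip iq sr; under eq_Rintegral do rewrite mulrDl -mulrA.
  rewrite RintegralD//; do ?exact: integrableR_smooth.
    by rewrite RintegralZl//; exact: integrableR_smooth.
  by apply: integrableRZ; exact: integrableR_smooth.
by rewrite !E// (vP psi psi')// (zP psi psi').
Qed.

(** Both sides of the identity that defines a weak derivative are continuous
    in L^1, the test functions being bounded. *)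
Lemma weak_D_limit al (u_ : nat -> T -> R) f v : (forall m, smooth_fun M (u_ m)) ->
  integrableR f -> (fun m => \int[mu]_x `|u_ m x - f x|) @ \oo --> (0 : R) ->
  integrableR v ->
  (fun m => \int[mu]_x `|classical_D X al (u_ m) x - v x|) @ \oo --> (0 : R) ->
  weak_D mu X al f v.
Proof.
move=> su iF uf iv Duv; split => // psi psi' s s' P'.
have sD m := classical_D_smooth X al (su m).
have c1 := L1_cvg_smooth (fun m => smooth_integrable mu_vol cT (sD m)) iv Duv s.
have c2 := L1_cvg_smooth (fun m => smooth_integrable mu_vol cT (su m)) iF uf s'.
rewrite (_ : (fun m => _) = (fun m => \int[mu]_x (u_ m x * psi' x))) in c1.
  by have := cvg_unique _ c1 c2 => ->.
by apply/funext => m; exact: P'.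
Qed.

End WeakDerivatives.

(** * Representatives of Sobolev classes and their derivatives *)

Lemma cvg0D (R : realType) (a b : nat -> R) : a @ \oo --> (0 : R) ->
  b @ \oo --> (0 : R) -> (fun m => a m + b m) @ \oo --> (0 : R).
Proof. by move=> ha hb; rewrite -(addr0 (0 : R)); exact: cvgD. Qed.

Section Sobolev.
Context (R : realType) (n : nat) (T : ptopologicalType).
Variables (M : smooth_manifold R n T) (cT : compact [set: T]).
Variables (g : riemannian_metric M) (mu : {measure set (borel T) -> \bar R}).
Hypothesis mu_vol : is_riemannian_volume g mu.
Variables (k : nat) (W : completeNormedModType R) (iota : (T -> R) -> W).
Hypothesis W_sobolev : is_sobolev_space g mu k iota.
Implicit Types (u f h : T -> R) (w v : W).
Local Notation integrableR f := (mu.-integrable setT (EFin \o f)).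
Local Notation represents := (represents M mu iota).

Lemma iotaD (a : R) u f : smooth_fun M u -> smooth_fun M f ->
  iota (fun x => a * u x + f x) = a *: iota u + iota f.
Proof. by case: W_sobolev => + _ _; exact. Qed.

Lemma iotaB u f : smooth_fun M u -> smooth_fun M f ->
  iota (fun x => u x - f x) = iota u - iota f.
Proof.
move=> su sf; rewrite (_ : (fun x => _) = (fun x => (-1) * f x + u x)).
  by rewrite iotaD// scaleN1r addrC.
by apply/funext => x; rewrite mulN1r addrC.
Qed.

Lemma nabla_norm0 u x : nabla_norm g 0 u x = `|u x|.
Proof.
rewrite /nabla_norm /covariant_norm.
have E : (u \o chart_inv (M (chart_at M x))) (coord_at M x) = u x.
  by rewrite /= /coord_at chart_mapK//; exact: at_chart_dom.
under eq_bigr do under eq_bigr do rewrite big_ord0 mul1r /= [u _]E.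
rewrite !sumr_const card_ffun !card_ord expn0 !mulr1n.
by rewrite -expr2 sqrtr_sqr.
Qed.

Lemma L1_le_sobolev u : smooth_fun M u -> \int[mu]_x `|u x| <= `|iota u|.
Proof.
move=> su; case: W_sobolev => _ -> // _.
rewrite /nabla_sobolev_norm (bigD1 ord0)//= ler_wpDr//.
  by apply: sumr_ge0 => j _; apply: Rintegral_ge0 => x _; rewrite sqrtr_ge0.
by under eq_Rintegral do rewrite -nabla_norm0.
Qed.

Lemma smooth_dense w : exists2 u_ : nat -> T -> R, (forall m, smooth_fun M (u_ m)) &
  iota (u_ m) @[m --> \oo] --> w.
Proof.
case: W_sobolev => _ _ dW.
have /choice[u_ uP] (m : nat) : exists u, smooth_fun M u /\ `|w - iota u| < m.+1%:R^-1.
  have := dW (ball w (m.+1%:R^-1 : R)) _ (ball_open _ _).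
  case; first by exists w; apply: ballxx; rewrite invr_gt0.
  move=> z [zw [u su uz]]; exists u; split => //; rewrite uz.
  by move: zw; rewrite -ball_normE.
exists u_; first by move=> m; have [] := uP m.
apply/cvgrPdist_le => e e0.
move/cvgr0Pnorm_le : (@cvg_harmonic R) => /(_ _ e0); apply: filterS => m.
move=> hm; apply: (le_trans (ltW (uP m).2)).
exact: le_trans (ler_norm _) hm.
Qed.

Lemma iota_dist_cvg0 (u_ v_ : nat -> T -> R) w :
  (forall m, smooth_fun M (u_ m)) -> (forall m, smooth_fun M (v_ m)) ->
  iota (u_ m) @[m --> \oo] --> w -> iota (v_ m) @[m --> \oo] --> w ->
  (fun m => \int[mu]_x `|u_ m x - v_ m x|) @ \oo --> (0 : R).
Proof.
move=> su sv cu cv.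
have c0 : (fun m => `|iota (u_ m) - iota (v_ m)|) @ \oo --> (0 : R).
  rewrite -(@normr0 _ W) -(subrr w); apply: cvg_norm.
  exact: (cvgB cu cv).
apply: (squeeze_cvgr _ (cvg_cst (0 : R)) c0); apply: nearW => m.
apply/andP; split; first by apply: Rintegral_ge0.
by rewrite -iotaB//; apply: L1_le_sobolev; exact: smooth_funB.
Qed.

(** A representative may be tested on one sequence: two sequences of smooth
    functions with the same limit in W are asymptotically equal in L^1,
    because the norm of W dominates the L^1 norm. *)
Lemma represents_seq (u_ : nat -> T -> R) w f : (forall m, smooth_fun M (u_ m)) ->
  iota (u_ m) @[m --> \oo] --> w -> integrableR f ->
  (fun m => \int[mu]_x `|u_ m x - f x|) @ \oo --> (0 : R) -> represents w f.
Proof.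
move=> su cu iF uf; split => // z_ sz cz.
have iu m := smooth_integrable mu_vol cT (su m).
have iz m := smooth_integrable mu_vol cT (sz m).
have c0 := cvg0D (iota_dist_cvg0 sz su cz cu) uf.
apply: (squeeze_cvgr _ (cvg_cst (0 : R)) c0); apply: nearW => m.
apply/andP; split; first by apply: Rintegral_ge0.
exact: Rintegral_norm_triangle.
Qed.

(** Smooth functions converging in W form a Cauchy sequence in L^1. *)
Lemma represents_exists w : exists f, represents w f.
Proof.
have [u_ su cu] := smooth_dense w.
have iu m := smooth_integrable mu_vol cT (su m).
have [|f iF fP] := L1_complete iu; last by exists f; exact: represents_seq fP.
move=> e e0; have e2 : 0 < e / 2 by rewrite divr_gt0.
have /cvgrPdist_le/(_ _ e2)[N _ NP] := cu.
exists N => p q Np Nq.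
apply: (@le_trans _ _ `|iota (u_ p) - iota (u_ q)|).
  by rewrite -iotaB//; apply: L1_le_sobolev; exact: smooth_funB.
apply: (le_trans (ler_distD w _ _)); rewrite (splitr e) lerD//.
  by rewrite distrC; exact: NP.
exact: NP.
Qed.

Lemma represents_unique w f f' : represents w f -> represents w f' ->
  {ae mu, forall x, f x = f' x}.
Proof.
move=> [iF fP] [iF' fP']; have [u_ su cu] := smooth_dense w.
have iu m := smooth_integrable mu_vol cT (su m).
have h : {ae mu, forall x, f x - f' x = 0}.
  apply: Rintegral_norm_eq0; first exact: integrableRB.
  have c0 := cvg0D (fP _ su cu) (fP' _ su cu).
  have c1 : (fun _ : nat => \int[mu]_x `|f x - f' x|) @ \oo --> (0 : R).
    apply: (squeeze_cvgr _ (cvg_cst (0 : R)) c0); apply: nearW => m.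
    apply/andP; split; first by apply: Rintegral_ge0.
    apply: (le_trans (Rintegral_norm_triangle iF (iu m) iF')).
    rewrite lerD2r; apply: le_Rintegral => //.
    - exact/integrableR_norm/integrableRB.
    - exact/integrableR_norm/integrableRB.
    - by move=> x _; rewrite distrC.
  exact: (cvg_unique _ (cvg_cst _) c1).
by apply: ae_mono h => x /eqP; rewrite subr_eq0 => /eqP.
Qed.

Lemma represents_smooth u : smooth_fun M u -> represents (iota u) u.
Proof.
move=> su; apply: (represents_seq (u_ := fun=> u)) => //.
- exact: cvg_cst.
- exact: (smooth_integrable mu_vol cT).
under eq_fun do under eq_Rintegral do rewrite subrr normr0.
rewrite (_ : (fun m => _) = cst 0); first exact: cvg_cst.
by apply/funext => m; rewrite Rintegral_cst// mul0r.
Qed.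

Lemma represents_lin (a : R) w v f h : represents w f -> represents v h ->
  represents (a *: w + v) (fun x => a * f x + h x).
Proof.
move=> [iF fP] [ih hP].
have [u_ su cu] := smooth_dense w; have [z_ sz cz] := smooth_dense v.
have iu m := smooth_integrable mu_vol cT (su m).
have iz m := smooth_integrable mu_vol cT (sz m).
apply: (represents_seq (u_ := fun m x => a * u_ m x + z_ m x)).
- by move=> m; apply: smooth_funD => //; exact: smooth_funZ.
- under eq_fun do rewrite iotaD//.
  exact: (cvgD (cvgZ (cvg_cst a) cu) cz).
- by apply: integrableRD => //; exact: integrableRZ.
have c0 : (fun m => `|a| * \int[mu]_x `|u_ m x - f x| + \int[mu]_x `|z_ m x - h x|)
    @ \oo --> (0 : R).
  apply: cvg0D; last exact: hP.
  by rewrite -(mulr0 `|a|); apply: cvgMr; exact: fP.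
apply: (squeeze_cvgr _ (cvg_cst (0 : R)) c0); apply: nearW => m.
apply/andP; split; first by apply: Rintegral_ge0.
have i1 := integrableR_norm (integrableRB (iu m) iF).
have i2 := integrableR_norm (integrableRB (iz m) ih).
rewrite -RintegralZl// -RintegralD//; last exact: integrableRZ.
apply: le_Rintegral => //.
- apply: integrableR_norm; apply: integrableRB.
    by apply: integrableRD => //; exact: integrableRZ.
  by apply: integrableRD => //; exact: integrableRZ.
- by apply: integrableRD => //; exact: integrableRZ.
move=> x _; rewrite opprD addrACA -mulrBr.
by rewrite (le_trans (ler_normD _ _))// normrM.
Qed.

Lemma representativeP w : represents w (representative M mu iota w).
Proof. by apply: xgetPex; exact: represents_exists. Qed.

Context (l : nat) (X : 'I_l -> vector_field M).
Hypothesis X_norm : phi_equivalent_norm mu k X iota.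
Local Notation Dw := (Dw mu X).
Local Notation phi := (phi mu k X iota).
Implicit Type al : mindex k l.

Lemma phiE w f : represents w f ->
  phi w = \sum_(al : mindex k l | (mdegree al <= k)%N) \int[mu]_x `|Dw al f x|.
Proof.
move=> wf; have wr := representativeP w; rewrite /Defs.phi.
apply: eq_bigr => al _.
have [ir _] := wr; have [iF _] := wf.
by rewrite (Dw_ae cT X al ir iF (represents_unique wr wf)).
Qed.

(** The left-hand side is one of the terms of phi (iota u), as the weak
    derivatives of u are its classical ones. *)
Lemma classical_D_bound : exists2 C : R, 0 < C & forall al u, (mdegree al <= k)%N ->
  smooth_fun M u -> \int[mu]_x `|classical_D X al u x| <= C * `|iota u|.
Proof.
have [c [C [c0 C0 cC]]] := X_norm; exists C => // al u alk su.
have /andP[_ phiC] := cC (iota u); apply: le_trans phiC.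
rewrite (phiE (represents_smooth su)) (bigD1 al)//= ler_wpDr//.
  by apply: sumr_ge0 => be _; apply: Rintegral_ge0.
have wD := weak_D_classical cT mu_vol X al su.
have wDw := Dw_weak wD.
have [iD _] := wD; have [iDw _] := wDw.
rewrite le_eqVlt; apply/orP; left; apply/eqP.
apply: Rintegral_ae.
- exact: integrableR_measurable (integrableR_norm iD).
- exact: integrableR_measurable (integrableR_norm iDw).
by apply: ae_mono (weak_D_unique cT mu_vol wD wDw) => x ->.
Qed.

(** Approximate w by smooth u_m. By [classical_D_bound] the D^al u_m form a
    Cauchy sequence in L^1, and its limit is a weak derivative of f. *)
Lemma Dw_represents al w f : (mdegree al <= k)%N -> represents w f ->
  weak_D mu X al f (Dw al f).
Proof.
move=> alk [iF fP]; have [u_ su cu] := smooth_dense w.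
have [C C0 CP] := classical_D_bound.
have iD m := smooth_integrable mu_vol cT (classical_D_smooth X al (su m)).
have [|v iv vP] := L1_complete iD.
  move=> e e0; have e2 : 0 < e / C / 2 by rewrite !divr_gt0.
  have /cvgrPdist_le/(_ _ e2)[N _ NP] := cu.
  exists N => p q Np Nq.
  rewrite (_ : \int[mu]_x _ =
      \int[mu]_x `|classical_D X al (fun x => u_ p x - u_ q x) x|); last first.
    by rewrite classical_DB.
  apply: (le_trans (CP _ _ alk _)); first exact: smooth_funB.
  rewrite iotaB// mulrC -ler_pdivlMr//.
  apply: (le_trans (ler_distD w _ _)); rewrite (splitr (e / C)) lerD//.
    by rewrite distrC; exact: NP.
  exact: NP.
by apply: Dw_weak; exact: (weak_D_limit cT mu_vol su iF (fP _ su cu) iv vP).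
Qed.

Lemma Dw_integrable al w f : (mdegree al <= k)%N -> represents w f ->
  integrableR (Dw al f).
Proof. by move=> alk /(Dw_represents alk)[]. Qed.

Lemma Dw_lin al (a : R) w v f h : (mdegree al <= k)%N ->
  represents w f -> represents v h ->
  {ae mu, forall x, Dw al (fun x => a * f x + h x) x = a * Dw al f x + Dw al h x}.
Proof.
move=> alk wf vh.
have D1 := Dw_represents alk (represents_lin a wf vh).
have [iF _] := wf; have [ih _] := vh.
have D2 := weak_D_lin cT a iF ih (Dw_represents alk wf) (Dw_represents alk vh).
exact: (weak_D_unique cT mu_vol D1 D2).
Qed.

(** The class t *: v + w is represented by t h + f, and D^al of this function
    is t (D^al h) + D^al f almost everywhere. *)
Lemma phi_line (t : R) w v f h : represents w f -> represents v h ->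
  phi (t *: v + w) = \sum_(al : mindex k l | (mdegree al <= k)%N)
    \int[mu]_x `|t * Dw al h x + Dw al f x|.
Proof.
move=> wf vh; rewrite (phiE (represents_lin t vh wf)); apply: eq_bigr => al alk.
have i1 := Dw_integrable alk (represents_lin t vh wf).
have i2 := integrableRD (integrableRZ t (Dw_integrable alk vh)) (Dw_integrable alk wf).
apply: Rintegral_ae.
- exact: integrableR_measurable (integrableR_norm i1).
- exact: integrableR_measurable (integrableR_norm i2).
by apply: ae_mono (Dw_lin t alk vh wf) => x ->.
Qed.

End Sobolev.

(** * Smooth functions with a nonvanishing derivative *)

Section NonvanishingDerivative.
Context (R : realType) (n : nat) (T : ptopologicalType).
Variables (M : smooth_manifold R n T).

(** The row v_j is the list of coefficients of a nonzero polynomial, and the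
    linear form with coefficients 1, t, t^2, ... evaluates this polynomial at
    t. It is enough that t is not a root of the product of these polynomials. *)
Lemma common_functional l (v : 'I_l -> 'rV[R]_n) : (forall j, v j != 0) ->
  exists c : 'rV[R]_n, forall j, \sum_a v j 0 a * c 0 a != 0.
Proof.
move=> v0; pose p := \prod_j rVpoly (v j).
have p0 : p != 0.
  apply/prodf_neq0 => j _; apply: contra (v0 j) => /eqP pj.
  by rewrite -[v j]rVpolyK pj linear0.
have [t tp] : exists t : R, ~~ root p t.
  apply: contrapT => /forallNP h.
  (* if every t were a root, p would have more roots than its degree allows *)
  pose rs : seq R := [seq i%:R | i <- iota 0 (size p)].
  have rsp : all (root p) rs by apply/allP => y _; apply/negPn/negP; exact: h.
  have urs : uniq rs.
    by rewrite map_inj_uniq ?iota_uniq// => i j /eqP; rewrite eqr_nat => /eqP.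
  by have := max_poly_roots p0 rsp urs; rewrite size_map size_iota ltnn.
exists (\row_a t ^+ a) => j.
have -> : \sum_a v j 0 a * (\row_a t ^+ a) 0 a = (rVpoly (v j)).[t].
  rewrite /rVpoly horner_poly; apply: eq_bigr => a _.
  by rewrite mxE insubT//= => ?; congr (v j 0 _ * _); exact: val_inj.
apply: contra tp => h.
by rewrite /root horner_prod (bigD1 j)//= (eqP h) mul0r.
Qed.

(** A field X_j maps u^(q+1) r to u^q times (q+1) (X_j u) r + u (X_j r), and
    this factor is nonzero at x if r and X_j u are. So each field of the list
    lowers the exponent of u by one. *)
Lemma fields_apply_exp l (X : 'I_l -> vector_field M) (u : T -> R) x :
  smooth_fun M u -> u x = 0 -> (forall j, vf_apply (X j) u x != 0) ->
  forall (s : seq 'I_l) m, exists r, [/\ smooth_fun M r, r x != 0 &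
    forall z, fields_apply (map X s) (fun z => u z ^+ (m + size s)) z =
      u z ^+ m * r z].
Proof.
move=> su ux Xu; elim => [|j s ih] m.
  exists (cst 1); split; [exact: smooth_fun_cst|exact: oner_neq0|].
  by move=> z; rewrite /= addn0 mulr1.
have [r [sr r0 rE]] := ih m.+1.
exists (fun z => u z * vf_apply (X j) r z + m.+1%:R * (r z * vf_apply (X j) u z)).
have sXr := vf_apply_smooth (X j) sr; have sXu := vf_apply_smooth (X j) su.
split.
- apply: smooth_funD; first exact: smooth_funM.
  by apply: smooth_funZ; exact: smooth_funM.
- by rewrite ux mul0r add0r !mulf_neq0// pnatr_eq0.
move=> z; rewrite /= addnS -addSn.
have -> : fields_apply (map X s) (fun z => u z ^+ (m.+1 + size s)) =
    (fun z => u z ^+ m.+1 * r z) by apply/funext.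
have vf_exp q : vf_apply (X j) (fun z => u z ^+ q.+1) z =
    q.+1%:R * (u z ^+ q * vf_apply (X j) u z).
  elim: q => [|q IH].
    have -> : (fun z => u z ^+ 1) = u by apply/funext => y; rewrite expr1.
    by rewrite expr0; ring.
  rewrite (_ : (fun z => _) = (fun z => u z * u z ^+ q.+1)); last first.
    by apply/funext => y; rewrite exprS.
  rewrite vf_applyM//; last exact: smooth_fun_exp.
  by rewrite IH [in RHS]mulrSr exprS; ring.
rewrite vf_applyM//; last exact: smooth_fun_exp.
by rewrite vf_exp exprS; ring.
Qed.

(** An affine function of the coordinates with linear part c that vanishes at
    x, cut off by a bump b. Because of the zero at x, the derivatives of b do
    not contribute at x, and q = b x. *)
Lemma coordinate_function x (c : 'rV[R]_n) : exists u, [/\ smooth_fun M u, u x = 0 &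
  exists2 q, q != 0 & forall X : vector_field M,
    vf_apply X u x = q * \sum_a vf_at X x 0 a * c 0 a].
Proof.
set i := chart_at M x; set y0 := coord_at M x.
have xi : chart_dom (M i) x := at_chart_dom M x.
have y0i : chart_cod (M i) y0 := coord_at_cod M x.
have invy0 : chart_inv (M i) y0 = x by rewrite /y0 /coord_at -/i chart_mapK.
have [b [sb [K [cK Ki bK]] b0 bx _]] := bump_exists (@openT T) I xi.
pose L (y : 'rV[R]_n) : R := \sum_a c 0 a * (y 0 a - y0 0 a).
have oi := @chart_cod_open _ _ _ (M i).
have CL m : Ck m setT L.
  have h := @Ck_sum _ _ m setT _ (index_enum 'I_n) (fun a => cst (c 0 a) *
    ((fun y : 'rV[R]_n => y 0 a) + cst (- y0 0 a))) openT
    (fun a => CkM openT (@Ck_cst _ _ m setT (c 0 a))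
      (CkD openT (@Ck_coord _ _ m setT a) (@Ck_cst _ _ m setT (- y0 0 a)))).
  apply: Ck_ext h; first exact: openT.
  by move=> y _; rewrite fct_sumE.
have dL := Ck_diff (CL 0%N) (I : setT y0).
have DL v : 'D_v L y0 = \sum_a v 0 a * c 0 a.
  apply: cvg_lim => //; apply: cvg_near_cst; near=> t.
  have t0 : t != 0 by near: t; exact: nbhs_dnbhs_neq.
  rewrite /L [X in _ - X]big1 => [|a _]; last by rewrite subrr mulr0.
  rewrite subr0 scaler_sumr; apply: eq_bigr => a _.
  rewrite !mxE addrK /GRing.scale /=; field; exact: t0.
pose f := (b \o chart_inv (M i)) * L.
have Cf m : Ck m (chart_cod (M i)) f.
  apply: CkM => //; first by have /smooth_funP := sb; exact.
  by apply: Ck_sub (CL m).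
have L0 : L y0 = 0 by rewrite /L big1// => a _; rewrite subrr mulr0.
have sf : smooth_fun M (chart_ext i f).
  apply: (chart_ext_smooth cK Ki Cf) => y cy nKy; rewrite /f !fctE /=.
  have -> : b (chart_inv (M i) y) = 0; last by rewrite mul0r.
  by apply/eqP; apply: contra_notT nKy => /bK[_]; rewrite chart_invK.
exists (chart_ext i f); split => //.
  by rewrite -invy0 chart_ext_inv// /f !fctE L0 mulr0.
exists (b x); first by rewrite gt_eqF.
move=> X; rewrite /vf_apply -/i -/y0.
rewrite (@near_eq_derive _ _ _ _ f); last first.
  by apply: filterS (near_chart_cod y0i) => z zi /=; rewrite chart_ext_inv.
rewrite deriveM//; last 2 first.
- by apply: diff_derivable; exact: smooth_fun_diff.
- exact: diff_derivable.
by rewrite L0 scale0r addr0 DL /= invy0.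
Unshelve. all: by end_near. Qed.

Lemma nonvanishing_derivative k l (X : 'I_l -> vector_field M) (al : mindex k l) x :
  (forall j, vf_at (X j) x != 0) ->
  exists2 u, smooth_fun M u & classical_D X al u x != 0.
Proof.
move=> X0; have [c cP] := common_functional X0.
have [u [su ux [q q0 uE]]] := coordinate_function x c.
have Xu j : vf_apply (X j) u x != 0 by rewrite uE mulf_neq0.
pose s := flatten [seq nseq (al i) i | i <- enum 'I_l].
have [r [sr r0 rE]] := fields_apply_exp su ux Xu s 0.
exists (fun z => u z ^+ (0 + size s)); first exact: smooth_fun_exp.
by rewrite classical_DE /mindex_fields rE expr0 mul1r.
Qed.

Variables (mu : {measure set (borel T) -> \bar R}).

(** By [nonvanishing_derivative], and as the topology has a countable base,
    there is a sequence of smooth functions such that at almost every point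
    D^al of some member is nonzero. Off a negligible set no point of Z is such
    a point. *)
Lemma nonvanishing_ae k l (X : 'I_l -> vector_field M) (al : mindex k l) (Z : set T) :
  nondegenerate_family mu X ->
  (forall u, smooth_fun M u -> {ae mu, forall x, Z x -> classical_D X al u x = 0}) ->
  {ae mu, forall x, ~ Z x}.
Proof.
move=> X0 ZP; have [B cB [Bo Bb]] := manifold_second_countable M.
pose good (U : set T) u := smooth_fun M u /\ forall x, U x -> classical_D X al u x != 0.
pose D := [set U | B U /\ exists u, good U u].
have cD : countable D by apply: sub_countable cB; apply: subset_card_le => U [].
have cover x : (forall j, vf_at (X j) x != 0) -> exists2 U, D U & U x.
  move=> /(nonvanishing_derivative al)[u su ux].
  have sDu := classical_D_smooth X al su.
  have oP : open [set z | classical_D X al u z != 0].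
    apply: (@open_comp _ _ (classical_D X al u) [set r | r != 0]) => [z _|].
      exact: (smooth_fun_continuous sDu).
    exact: open_neq.
  have [U [BU Ux] UP] := Bb x _ (open_nbhs_nbhs (conj oP ux)).
  by exists U => //; split => //; exists u.
have aeX : {ae mu, forall x, forall j, vf_at (X j) x != 0} by exact: ae_forall.
have [D0|D0] := pselect (D !=set0); last first.
  by apply: ae_mono aeX => x /cover[U DU _]; exfalso; apply: D0; exists U.
have /pfcard_geP[D0'|[F]] := cD.
  by have [U DU] := D0; rewrite D0' in DU.
have /choice[u uP] m : exists u, good (F m) u by have [_] := @funS _ _ _ _ F m I.
have aeZ : {ae mu, forall x, forall m, Z x -> classical_D X al (u m) x = 0}.
  by apply/ae_foralln => m; apply: ZP; have [] := uP m.
apply: ae_mono2 aeX aeZ => x /cover[U DU Ux] xZ Zx.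
have [m _ Fm] := @surj _ _ _ _ F _ DU.
have [_ /(_ x)] := uP m; rewrite Fm => /(_ Ux) /eqP; apply.
exact: xZ.
Qed.

End NonvanishingDerivative.

(** * One-sided derivatives of the L^1 norm *)

Definition zero_part (T : Type) (R : realType) (a b : T -> R) : T -> R :=
  fun x => (a x == 0)%:R * `|b x|.

Section NormDerivative.
Context d (T : measurableType d) (R : realType) (mu : {measure set T -> \bar R}).
Implicit Types a b : T -> R.
Local Notation integrableR f := (mu.-integrable setT (EFin \o f)).

Lemma measurable_sgr : measurable_fun setT (Num.sg : R -> R).
Proof.
rewrite (_ : Num.sg = (fun x : R => \1_[set y : R | 0 < y] x - \1_[set y : R | y < 0] x)).
  by apply: measurable_funB; apply: measurable_indic; apply: open_measurable;
    [exact: open_gt|exact: open_lt].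
apply/funext => x; rewrite !indicE; have [x0|x0|->] := ltgtP x 0.
- by rewrite ltr0_sg// memNset ?mem_set ?sub0r//= ltNge ltW.
- by rewrite gtr0_sg// mem_set ?memNset ?subr0//= ltNge ltW.
- by rewrite sgr0 !memNset ?subrr//= ltxx.
Qed.

Lemma integrable_sg a b : integrableR a -> integrableR b ->
  integrableR (fun x => Num.sg (a x) * b x).
Proof.
move=> ia ib; apply: (integrableRM (C := 1) _ ib).
  exact: (measurableT_comp measurable_sgr (integrableR_measurable ia)).
by move=> x; rewrite normr_sg; case: (_ != 0).
Qed.

Lemma integrable_zero_part a b : integrableR a -> integrableR b ->
  integrableR (zero_part a b).
Proof.
move=> ia ib; apply: (integrableRM (C := 1) _ (integrableR_norm ib)).
  have -> : (fun x => (a x == 0)%:R) = \1_(a @^-1` [set 0]) :> (T -> R).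
    apply/funext => x; rewrite indicE; congr (nat_of_bool _)%:R.
    by apply/eqP/idP => [ax|/set_mem//]; exact/mem_set.
  apply: measurable_indic; rewrite -[X in measurable X]setTI.
  exact: (integrableR_measurable ia).
by move=> x; case: (_ == _); rewrite ?normr1 ?normr0.
Qed.

Lemma norm_quotient_le (t x y : R) : 0 < t ->
  `|t^-1 * (`|t * y + x| - `|x|)| <= `|y|.
Proof.
move=> t0; rewrite normrM normfV (gtr0_norm t0) ler_pdivrMl//.
rewrite (le_trans (ler_dist_dist _ _))// addrK normrM (gtr0_norm t0)//.
Qed.

(** If x is nonzero then t y + x has the sign of x for all small t, and the
    quotient is eventually constant. *)
Lemma norm_quotient_cvg (t_ : nat -> R) (x y : R) : (forall m, 0 < t_ m) ->
  t_ @ \oo --> (0 : R) ->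
  (fun m => (t_ m)^-1 * (`|t_ m * y + x| - `|x|)) @ \oo -->
  Num.sg x * y + (x == 0)%:R * `|y|.
Proof.
move=> t0 tc; have [->|x0] := eqVneq x 0.
  rewrite sgr0 mul0r add0r mul1r; apply: cvg_near_cst; near=> m.
  by rewrite addr0 normr0 subr0 normrM (gtr0_norm (t0 m)) mulKf// gt_eqF.
rewrite mul0r addr0; apply: cvg_near_cst.
have c0 : (fun m => t_ m * y) @ \oo --> (0 : R).
  by rewrite -(mul0r y); apply: cvgMl.
have x1 : 0 < `|x| by rewrite normr_gt0.
move/cvgr0Pnorm_lt : c0 => /(_ _ x1); apply: filterS => m tx.
have tm0 : t_ m != 0 by rewrite gt_eqF.
move: tx; have [xp|xn] := ltP 0 x.
  rewrite (gtr0_norm xp) ltr_norml => /andP[h1 h2].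
  rewrite gtr0_norm; last by rewrite -ltrBlDr sub0r.
  by rewrite gtr0_sg// mul1r addrK mulKf.
have {}xn : x < 0 by rewrite lt_neqAle x0.
rewrite (ltr0_norm xn) ltr_norml opprK => /andP[h1 h2].
rewrite ltr0_norm; last by rewrite -ltrBrDr sub0r.
by rewrite ltr0_sg// mulN1r opprD -addrA addNr addr0 mulrN mulKf.
Unshelve. all: by end_near. Qed.

Lemma L1_norm_right_quotient a b (t_ : nat -> R) : integrableR a -> integrableR b ->
  (forall m, 0 < t_ m) -> t_ @ \oo --> (0 : R) ->
  (fun m => (t_ m)^-1 * (\int[mu]_x `|t_ m * b x + a x| - \int[mu]_x `|a x|)) @ \oo -->
  \int[mu]_x (Num.sg (a x) * b x) + \int[mu]_x zero_part a b x.
Proof.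
move=> ia ib t0 tc.
have itb m : integrableR (fun x => t_ m * b x + a x).
  by apply: integrableRD => //; exact: integrableRZ.
have iq m : integrableR (fun x => (t_ m)^-1 * (`|t_ m * b x + a x| - `|a x|)).
  by apply: integrableRZ; apply: integrableRB; exact: integrableR_norm.
rewrite (_ : (fun m => _) =
    (fun m => \int[mu]_x ((t_ m)^-1 * (`|t_ m * b x + a x| - `|a x|)))); last first.
  apply/funext => m; rewrite RintegralZl//; last by apply: integrableRB; exact: integrableR_norm.
  by rewrite RintegralB//; exact: integrableR_norm.
rewrite -RintegralD//; [|exact: integrable_sg|exact: integrable_zero_part].
have iz := integrableRD (integrable_sg ia ib) (integrable_zero_part ia ib).
have [||_ _ //] := Rintegral_dominated (fun m => integrableR_measurable (iq m))
  (integrableR_measurable iz) _ (integrableR_norm ib).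
  by apply: aeW => x; exact: norm_quotient_cvg.
by apply: aeW => x m; exact: norm_quotient_le.
Qed.

(** Replacing both t and b by their opposites reduces this to
    [L1_norm_right_quotient]. *)
Lemma L1_norm_left_quotient a b (t_ : nat -> R) : integrableR a -> integrableR b ->
  (forall m, t_ m < 0) -> t_ @ \oo --> (0 : R) ->
  (fun m => (t_ m)^-1 * (\int[mu]_x `|t_ m * b x + a x| - \int[mu]_x `|a x|)) @ \oo -->
  \int[mu]_x (Num.sg (a x) * b x) - \int[mu]_x zero_part a b x.
Proof.
move=> ia ib t0 tc.
have tN : (fun m => - t_ m) @ \oo --> (0 : R) by rewrite -oppr0; exact: cvgN.
have tN0 m : 0 < - t_ m by rewrite oppr_gt0.
have ibN := integrableRZ (-1) ib.
have /cvgN := L1_norm_right_quotient ia ibN tN0 tN.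
have -> : - (\int[mu]_x (Num.sg (a x) * (-1 * b x)) + \int[mu]_x zero_part a (fun x => -1 * b x) x) =
    \int[mu]_x (Num.sg (a x) * b x) - \int[mu]_x zero_part a b x.
  rewrite opprD; congr (_ - _).
    under eq_Rintegral do rewrite mulrCA.
    by rewrite RintegralZl ?mulN1r ?opprK//; exact: integrable_sg.
  by apply: eq_Rintegral => x _; rewrite /zero_part mulN1r normrN.
apply: cvg_trans; apply: near_eq_cvg; apply: nearW => m.
rewrite !fctE invrN mulNr opprK; congr (_ * (_ - _)); apply: eq_Rintegral => x _.
by rewrite mulN1r mulrNN.
Qed.

End NormDerivative.

(** * Gateaux differentiability of phi *)

Lemma cvg_bigsum (R : realType) (I : Type) (r : seq I) (P : pred I) (F : I -> nat -> R)
    (a : I -> R) : (forall i, P i -> F i @ \oo --> a i) ->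
  (fun m => \sum_(i <- r | P i) F i m) @ \oo --> \sum_(i <- r | P i) a i.
Proof.
move=> Fa; elim: r => [|i r ih].
  by rewrite big_nil; under eq_fun do rewrite big_nil; exact: cvg_cst.
rewrite big_cons; under eq_fun do rewrite big_cons.
by case: ifPn => // Pi; apply: cvgD => //; exact: Fa.
Qed.

Section Differentiability.
Context (R : realType) (n : nat) (T : ptopologicalType).
Variables (M : smooth_manifold R n T) (cT : compact [set: T]).
Variables (g : riemannian_metric M) (mu : {measure set (borel T) -> \bar R}).
Hypothesis mu_vol : is_riemannian_volume g mu.
Variables (k : nat) (W : completeNormedModType R) (iota : (T -> R) -> W).
Hypothesis W_sobolev : is_sobolev_space g mu k iota.
Context (l : nat) (X : 'I_l -> vector_field M).
Hypothesis X_norm : phi_equivalent_norm mu k X iota.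
Implicit Types (u f h : T -> R) (w v : W) (al : mindex k l).
Local Notation represents := (represents M mu iota).
Local Notation Dw := (Dw mu X).
Local Notation phi := (phi mu k X iota : W -> R^o).

(** The half-sum and the half-difference of the one-sided derivatives of phi
    at w in the direction v, when f and h represent w and v. *)
Let sg_sum f h := \sum_(al : mindex k l | (mdegree al <= k)%N)
  \int[mu]_x (Num.sg (Dw al f x) * Dw al h x).
Let zero_sum f h := \sum_(al : mindex k l | (mdegree al <= k)%N)
  \int[mu]_x zero_part (Dw al f) (Dw al h) x.

Lemma phi_quotient (t : R) w v f h : represents w f -> represents v h ->
  t^-1 *: (phi (t *: v + w) - phi w) =
  \sum_(al : mindex k l | (mdegree al <= k)%N)
    (t^-1 * (\int[mu]_x `|t * Dw al h x + Dw al f x| - \int[mu]_x `|Dw al f x|)).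
Proof.
move=> wf vh.
rewrite (phi_line cT mu_vol W_sobolev X_norm _ wf vh) (phiE cT mu_vol W_sobolev X wf).
by rewrite -sumrB /GRing.scale /= mulr_sumr.
Qed.

Lemma phi_right_derivative w v f h : represents w f -> represents v h ->
  t^-1 *: (phi (t *: v + w) - phi w) @[t --> 0^'+] --> (sg_sum f h + zero_sum f h : R^o).
Proof.
move=> wf vh; apply/cvg_at_rightP => t_ [t0 tc].
under eq_fun do rewrite (phi_quotient _ wf vh).
rewrite /sg_sum /zero_sum -big_split /=.
apply: cvg_bigsum => al alk; apply: L1_norm_right_quotient => //.
- exact: (Dw_integrable cT mu_vol W_sobolev X_norm alk wf).
- exact: (Dw_integrable cT mu_vol W_sobolev X_norm alk vh).
Qed.

Lemma phi_left_derivative w v f h : represents w f -> represents v h ->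
  t^-1 *: (phi (t *: v + w) - phi w) @[t --> 0^'-] --> (sg_sum f h - zero_sum f h : R^o).
Proof.
move=> wf vh; apply/cvg_at_leftP => t_ [t0 tc].
under eq_fun do rewrite (phi_quotient _ wf vh).
rewrite /sg_sum /zero_sum -sumrB.
apply: cvg_bigsum => al alk; apply: L1_norm_left_quotient => //.
- exact: (Dw_integrable cT mu_vol W_sobolev X_norm alk wf).
- exact: (Dw_integrable cT mu_vol W_sobolev X_norm alk vh).
Qed.

(** The derivative from the right equals the derivative from the left. *)
Lemma derivable_zero_sum w v f h : represents w f -> represents v h ->
  derivable phi w v -> zero_sum f h = 0.
Proof.
move=> wf vh dphi.
have cr := cvg_dnbhs_at_right dphi.
have cl := cvg_dnbhs_at_left dphi.
have er := cvg_unique (@norm_hausdorff _ R^o) (phi_right_derivative wf vh) cr.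
have el := cvg_unique (@norm_hausdorff _ R^o) (phi_left_derivative wf vh) cl.
have /addrI/esym/eqP : sg_sum f h + zero_sum f h = sg_sum f h - zero_sum f h :> R.
  by rewrite er el.
by rewrite eqNr => /eqP.
Qed.

Lemma zero_sum_derive w v f h : represents w f -> represents v h ->
  zero_sum f h = 0 -> derivable phi w v /\ 'D_v phi w = sg_sum f h.
Proof.
move=> wf vh z0.
have cr := phi_right_derivative wf vh; have cl := phi_left_derivative wf vh.
rewrite z0 addr0 in cr; rewrite z0 subr0 in cl.
have c := cvg_at_right_left_dnbhs cr cl.
by split; [apply/cvg_ex; exists (sg_sum f h)|exact: cvg_lim c].
Qed.

Lemma nowhere_vanishing_zero_sum w v f h : represents w f -> represents v h ->
  nowhere_vanishing_D mu k X f -> zero_sum f h = 0.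
Proof.
move=> wf vh f0; rewrite /zero_sum big1// => al alk.
have iz := integrable_zero_part (Dw_integrable cT mu_vol W_sobolev X_norm alk wf)
  (Dw_integrable cT mu_vol W_sobolev X_norm alk vh).
rewrite (@Rintegral_ae _ _ _ mu _ (cst 0)).
- by rewrite Rintegral_cst// mul0r.
- exact: integrableR_measurable iz.
- exact: measurable_cst.
by apply: ae_mono (f0 al alk) => x /negPf fx; rewrite /zero_part fx mul0r.
Qed.

(** The terms of zero_sum f u are nonnegative, so each of them is zero: D^al u
    vanishes almost everywhere on the zero set of D^al f, for every smooth u. *)
Lemma zero_sum_nowhere_vanishing w f : nondegenerate_family mu X -> represents w f ->
  (forall u, smooth_fun M u -> zero_sum f u = 0) -> nowhere_vanishing_D mu k X f.
Proof.
move=> X0 wf f0 al alk.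
suff : {ae mu, forall x, ~ [set x | Dw al f x = 0] x} by apply: ae_mono => x /eqP.
apply: (nonvanishing_ae (al := al) (Z := [set x | Dw al f x = 0]) X0) => u su.
have wu := represents_smooth cT mu_vol W_sobolev su.
have iz (be : mindex k l) : (mdegree be <= k)%N ->
    mu.-integrable setT (EFin \o zero_part (Dw be f) (Dw be u)).
  by move=> bek; apply: integrable_zero_part;
    [exact: (Dw_integrable cT mu_vol W_sobolev X_norm bek wf)|
     exact: (Dw_integrable cT mu_vol W_sobolev X_norm bek wu)].
have z_ge0 (be : mindex k l) x : 0 <= zero_part (Dw be f) (Dw be u) x by rewrite mulr_ge0.
have zal : \int[mu]_x `|zero_part (Dw al f) (Dw al u) x| = 0.
  under eq_Rintegral do rewrite ger0_norm//.
  move/eqP : (f0 u su); rewrite /zero_sum psumr_eq0 => [|be _]; last exact: Rintegral_ge0.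
  by move=> /allP/(_ al (mem_index_enum _)); rewrite alk => /eqP.
have wD := weak_D_classical cT mu_vol X al su.
apply: ae_mono2 (Rintegral_norm_eq0 (iz al alk) zal)
  (weak_D_unique cT mu_vol wD (Dw_weak wD)) => x zx -> /= fx.
by move: zx; rewrite /zero_part fx eqxx mul1r => /eqP; rewrite normr_eq0 => /eqP.
Qed.

Lemma sg_sum_lin w v v' f h h' (a : R) : represents w f -> represents v h ->
  represents v' h' -> sg_sum f (fun x => a * h x + h' x) = a * sg_sum f h + sg_sum f h'.
Proof.
move=> wf vh vh'; rewrite /sg_sum mulr_sumr -big_split; apply: eq_bigr => al alk /=.
have iF := Dw_integrable cT mu_vol W_sobolev X_norm alk wf.
have i1 := Dw_integrable cT mu_vol W_sobolev X_norm alk vh.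
have i2 := Dw_integrable cT mu_vol W_sobolev X_norm alk vh'.
have i3 := Dw_integrable cT mu_vol W_sobolev X_norm alk
  (represents_lin cT mu_vol W_sobolev a vh vh').
have s1 := integrableRZ a (integrable_sg iF i1); have s2 := integrable_sg iF i2.
rewrite -RintegralZl//; last exact: integrable_sg.
rewrite -RintegralD//; apply: Rintegral_ae.
- exact: integrableR_measurable (integrable_sg iF i3).
- exact: integrableR_measurable (integrableRD s1 s2).
by apply: ae_mono (Dw_lin cT mu_vol W_sobolev X_norm a alk vh vh') => x ->; rewrite mulrDr mulrCA.
Qed.

Lemma sg_sum_le w v f h : represents w f -> represents v h -> `|sg_sum f h| <= phi v.
Proof.
move=> wf vh; rewrite (phiE cT mu_vol W_sobolev X vh).
apply: (le_trans (ler_norm_sum _ _ _)); apply: ler_sum => al alk.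
have iF := Dw_integrable cT mu_vol W_sobolev X_norm alk wf.
have i1 := Dw_integrable cT mu_vol W_sobolev X_norm alk vh.
have i2 := integrable_sg iF i1.
apply: (le_trans (le_normr_Rintegral _ i2)) => //.
apply: le_Rintegral => //; [exact: integrableR_norm|exact: integrableR_norm|].
move=> x _; rewrite normrM normr_sg; case: (_ != 0); first by rewrite mul1r.
by rewrite mul0r.
Qed.

Lemma gateaux_phi w f : represents w f -> nowhere_vanishing_D mu k X f ->
  gateaux_differentiable phi w /\
  forall v h, represents v h -> gateaux_deriv phi w v = sg_sum f h.
Proof.
move=> wf f0.
have D v h : represents v h -> derivable phi w v /\ 'D_v phi w = sg_sum f h.
  by move=> vh; apply: (zero_sum_derive wf vh); exact: (nowhere_vanishing_zero_sum wf vh).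
have rP v := representativeP cT mu_vol W_sobolev v.
split; last by move=> v h /D[].
split.
- by move=> v; have [] := D _ _ (rP v).
- move=> a v v'; rewrite /gateaux_deriv.
  have [_ ->] := D _ _ (represents_lin cT mu_vol W_sobolev a (rP v) (rP v')).
  have [_ ->] := D _ _ (rP v); have [_ ->] := D _ _ (rP v').
  exact: (sg_sum_lin a wf (rP v) (rP v')).
have [c [C [_ _ cC]]] := X_norm; exists C => v.
have /andP[_] := cC v; apply: le_trans.
by have [_] := D _ _ (rP v); rewrite /gateaux_deriv => ->; exact: (sg_sum_le wf (rP v)).
Qed.

Lemma gateaux_phi_nowhere_vanishing w f : nondegenerate_family mu X -> represents w f ->
  gateaux_differentiable phi w -> nowhere_vanishing_D mu k X f.
Proof.
move=> X0 wf [dphi _ _]; apply: (zero_sum_nowhere_vanishing X0 wf) => u su.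
exact: (derivable_zero_sum wf (represents_smooth cT mu_vol W_sobolev su) (dphi _)).
Qed.

Lemma nowhere_vanishing_represents w f f' : represents w f -> represents w f' ->
  nowhere_vanishing_D mu k X f -> nowhere_vanishing_D mu k X f'.
Proof.
move=> wf wf' f0 al alk; have [iF _] := wf; have [iF' _] := wf'.
by rewrite -(Dw_ae cT X al iF iF' (represents_unique cT mu_vol W_sobolev wf wf')); exact: f0.
Qed.

End Differentiability.

Theorem theorem3p4 (R : realType) (n : nat) (T : ptopologicalType)
    (M : smooth_manifold R n T) (compact_M : compact [set: T])
    (g : riemannian_metric M)
    (mu : {measure set (borel T) -> \bar R})
    (mu_vol : is_riemannian_volume g mu)
    (k : nat) (k_ge1 : (1 <= k)%N)
    (W : completeNormedModType R) (iota : (T -> R) -> W)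
    (W_sobolev : is_sobolev_space g mu k iota)
    (l : nat) (X : 'I_l -> vector_field M)
    (X_norm : phi_equivalent_norm mu k X iota)
    (X_nondeg : nondegenerate_family mu X) :
  let B := B_some mu k X iota in
  [/\ B = B_any mu k X iota,
      [set w | gateaux_differentiable (phi mu k X iota : W -> R^o) w] = B &
      forall (w : W) (f : T -> R) (h : W) (fh : T -> R),
        B w -> represents M mu iota w f -> represents M mu iota h fh ->
        gateaux_deriv (phi mu k X iota : W -> R^o) w h =
        \sum_(al : mindex k l | (mdegree al <= k)%N)
          \int[mu]_x (Num.sg (Dw mu X al f x) * Dw mu X al fh x)].
Proof.
move=> B; have rP v := representativeP compact_M mu_vol W_sobolev v.
have nvP w f f' := @nowhere_vanishing_represents _ _ _ _ compact_M _ _ mu_vol _ _ _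
  W_sobolev _ X w f f'.
have gP := gateaux_phi compact_M mu_vol W_sobolev X_norm.
split.
- apply/seteqP; split=> w; first by move=> [f wf f0] f' wf'; exact: nvP wf wf' f0.
  by move=> wB; exists (representative M mu iota w) => //; exact: wB.
- apply/seteqP; split=> w /=; last by move=> [f wf f0]; have [] := gP _ _ wf f0.
  move=> dw; exists (representative M mu iota w) => //.
  exact: (gateaux_phi_nowhere_vanishing compact_M mu_vol W_sobolev X_norm X_nondeg (rP w) dw).
move=> w f h fh [f' wf' f0'] wf hfh.
by have [_ gE] := gP _ _ wf (nvP _ _ _ wf' wf f0'); exact: gE.
Qed.
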